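(* Let $1\le p\le+\infty$, assume that $B\in\mathcal L(U,\partial X)$ is $p$-boundary admissible, and let $t>0$. Then the following three assertions are equivalent: (1) $e^+\mathcal R^{\mathrm{BC}}_t\subset X^+$; (2) $a^+\mathcal R^{\mathrm{BC}}_t\subset X^+$; (3) there exists $\lambda\in\mathbb R\cap\rho(A)$ such that $$\bigl(e^{\lambda\beta}\,T(t-\beta)-e^{\lambda\alpha}\,T(t-\alpha)\bigr)B_\lambda\ge0\qquad\text{for all }0\le\alpha\le\beta\le t.$$ Moreover, if $(T(t))_{t\ge0}$ is positive, then (1)--(3) are satisfied if and only if any one of the following (which are then all equivalent) holds: (4) $e^+\mathcal R^{\mathrm{BC}}\subset X^+$; (5) $a^+\mathcal R^{\mathrm{BC}}\subset X^+$; (6) there exist $\lambda>\omega_0(A)$ and $\tau>0$ such that $\bigl(e^{\lambda s}-T(s)\bigr)B_\lambda\ge0$ for all $0\le s\le\tau$; (7) there exists $\lambda_0>\omega_0(A)$ such that $B_\lambda\ge0$ for all $\lambda\ge\lambda_0$.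
   Context: Abstract setting. $X$, $\partial X$, $U$ are Banach spaces, and in addition $X$ and $U$ are Banach lattices with positive cones $X^+$, $U^+$; no positivity is assumed on $T(t)$, $B$ or $Q_\lambda$ unless stated. $A_m:D(A_m)\subseteq X\to X$ is a closed, densely defined operator; $Q\in\mathcal L([D(A_m)],\partial X)$, where $[D(A_m)]$ is $D(A_m)$ with the graph norm; $B\in\mathcal L(U,\partial X)$. Standing assumptions: (i) the restriction $A\subset A_m$ with domain $D(A):=\ker Q$ generates a strongly continuous semigroup $(T(t))_{t\ge0}$ on $X$; (ii) $Q:D(A_m)\to\partial X$ is surjective. $\rho(A)$ is the resolvent set of $A$ and $\omega_0(A)$ is the growth bound of $(T(t))_{t\ge0}$. For $\lambda\in\rho(A)$ the restriction $Q|_{\ker(\lambda-A_m)}$ is invertible with bounded inverse $Q_\lambda:\partial X\to\ker(\lambda-A_m)\subseteq X$, and $B_\lambda:=Q_\lambda B\in\mathcal L(U,X)$. An operator $S$ between Banach lattices is $\ge0$ (positive) if it maps the positive cone into the positive cone. For $1\le p\le+\infty$, $B$ is called $p$-boundary admissible if there exist $t>0$ and $\lambda\in\rho(A)$ such that $\int_0^tT(t-s)B_\lambda u(s)\,ds\in D(A)$ for all $u\in L^p([0,t],U)$; the same then holds for every $t>0$ and $\lambda\in\rho(A)$. In this case, for $t>0$ the controllability map $\mathcal B_t^{\mathrm{BC}}\in\mathcal L(L^p([0,t],U),X)$ is $\mathcal B_t^{\mathrm{BC}}u:=(\lambda-A)\int_0^tT(t-s)B_\lambda u(s)\,ds$,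 which does not depend on $\lambda\in\rho(A)$ (and $\mathcal B_0^{\mathrm{BC}}=0$). Positive reachability spaces: $e^+\mathcal R^{\mathrm{BC}}_t:=\{\mathcal B_t^{\mathrm{BC}}u:u\in L^p([0,t],U^+)\}$, $e^+\mathcal R^{\mathrm{BC}}:=\bigcup_{t\ge0}e^+\mathcal R^{\mathrm{BC}}_t$, $a^+\mathcal R^{\mathrm{BC}}_t:=\overline{e^+\mathcal R^{\mathrm{BC}}_t}$, $a^+\mathcal R^{\mathrm{BC}}:=\overline{\bigcup_{t\ge0}a^+\mathcal R^{\mathrm{BC}}_t}$. *)

(* Defs.v *)
From HB Require Import structures.
From mathcomp Require Import all_boot all_order all_algebra.
From mathcomp Require Import complex.
From mathcomp Require Import all_classical all_reals all_analysis.
Import Order.TTheory GRing.Theory Num.Theory.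
Import numFieldNormedType.Exports.

Set Implicit Arguments.
Unset Strict Implicit.
Unset Printing Implicit Defensive.

Local Open Scope classical_set_scope.
Local Open Scope ring_scope.

(* Banach spaces and Banach lattices may be real or complex: the scalar field
   [K] is either [R] or [R[i]]. *)
Variant scalars (R : realType) : numFieldType -> Type :=
| RealScalars : scalars R R
| ComplexScalars : scalars R R[i].
Arguments RealScalars {R}.
Arguments ComplexScalars {R}.

Definition of_real (R : realType) (K : numFieldType) (s : scalars R K) :
    R -> K :=
  match s in scalars _ K return R -> K with
  | RealScalars => fun r => r
  | ComplexScalars => fun r => (r%:C)%C
  end.

Definition real_part (R : realType) (K : numFieldType) (s : scalars R K) :
    K -> R :=
  match s in scalars _ K return K -> R with
  | RealScalars => fun r => r
  | ComplexScalars => fun z => complex.Re z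
  end.

(* In MathComp-Analysis the norm of a normed [K]-module is [K]-valued. *)
Definition rnorm (R : realType) (K : numFieldType) (s : scalars R K)
    (V : normedModType K) (v : V) : R := real_part s `|v|.

Section BanachLattices.
Context (R : realType) (K : numFieldType) (s : scalars R K).
Context (X : completeNormedModType K) (Xp : set X).

Definition cone_le (x y : X) : Prop := Xp (y - x).

Definition cone_lub (S : set X) (m : X) : Prop :=
  (forall x, S x -> cone_le x m) /\
  (forall b, (forall x, S x -> cone_le x b) -> cone_le m b).

Definition cone_span : set X :=
  [set x | exists a b, [/\ Xp a, Xp b & x = a - b]].

(* The span [cone_span] of the cone is a real vector lattice, and the norm
   is a lattice norm on it. *)
Record normed_lattice_cone : Prop := NormedLatticeCone {
  cone0 : Xp 0;
  coneD : forall x y, Xp x -> Xp y -> Xp (x + y);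
  coneZ : forall (r : R) x, 0 <= r -> Xp x -> Xp (of_real s r *: x);
  cone_proper : forall x, Xp x -> Xp (- x) -> x = 0;
  cone_sup : forall x y, cone_span x -> cone_span y ->
    exists m, cone_lub [set x; y] m;
  cone_norm : forall x y mx my, cone_span x -> cone_span y ->
    cone_lub [set x; - x] mx -> cone_lub [set y; - y] my ->
    cone_le mx my -> `|x| <= `|y|
}.

End BanachLattices.

Definition real_banach_lattice (R : realType) (X : completeNormedModType R)
    (Xp : set X) : Prop :=
  normed_lattice_cone RealScalars Xp /\ forall x, cone_span Xp x.

(* A complex Banach lattice is the complexification of a real one: each vector
   is [x + i y] with [x], [y] in the real part, and its norm is the norm of its
   modulus [|x + i y| = sup_theta (cos theta x + sin theta y)]. *)
Definition complex_banach_lattice (R : realType)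
    (X : completeNormedModType R[i]) (Xp : set X) : Prop :=
  [/\ normed_lattice_cone ComplexScalars Xp,
      forall z, exists x y, [/\ cone_span Xp x, cone_span Xp y &
        z = x + (0 +i* 1)%C *: y]
    & forall x y, cone_span Xp x -> cone_span Xp y ->
        exists m, cone_lub Xp
            [set (cos theta)%:C%C *: x + (sin theta)%:C%C *: y
              | theta in [set: R]] m /\
          `|x + (0 +i* 1)%C *: y| = `|m| ].

Definition banach_lattice (R : realType) (K : numFieldType) (s : scalars R K) :
    forall X : completeNormedModType K, set X -> Prop :=
  match s in scalars _ K
    return forall X : completeNormedModType K, set X -> Prop with
  | RealScalars => @real_banach_lattice R
  | ComplexScalars => @complex_banach_lattice R
  end.

Definition positive_op (V W : Type) (Vp : set V) (Wp : set W) (S : V -> W) :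
    Prop := forall v, Vp v -> Wp (S v).

Section BochnerIntegral.
Context (R : realType) (K : numFieldType) (s : scalars R K).
Context (V : completeNormedModType K).
Let mu := @lebesgue_measure R.

Definition simple (g : {fimfun R >-> V}) : Prop :=
  forall v, measurable (g @^-1` [set v] : set (measurableTypeR R)).

Definition simple_integral (D : set R) (g : {fimfun R >-> V}) : V :=
  \sum_(v \in range g) of_real s (fine (mu (D `&` g @^-1` [set v]))) *: v.

Definition strongly_measurable (D : set R) (f : R -> V) : Prop :=
  exists2 g : nat -> {fimfun R >-> V}, (forall n, simple (g n)) &
    forall x, D x -> g n x @[n --> \oo] --> f x.

(* Meant for measurable [D] of finite measure. *)
Definition is_bochner_integral (D : set R) (f : R -> V) (v : V) : Prop :=
  strongly_measurable D f /\
  exists g : nat -> {fimfun R >-> V},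
    [/\ forall n, simple (g n),
        (\int[mu]_(x in D) (rnorm s (f x - g n x))%:E)%E @[n --> \oo] --> 0%E
      & simple_integral D (g n) @[n --> \oo] --> v].

Definition bochner_integral (D : set R) (f : R -> V) : V :=
  xget 0 [set v | is_bochner_integral D f v].

(* Membership of (the class of) [f] in L^p(D, V); values outside [D] are
   irrelevant. *)
Definition Lp (p : \bar R) (D : set R) : set (R -> V) :=
  [set f | strongly_measurable D f /\
    ('N[mu]_p[(fun x => (rnorm s (f x))%:E) \_ D] < +oo)%E].

Definition Lp_cone (p : \bar R) (D : set R) (Vp : set V) : set (R -> V) :=
  [set f | Lp p D f /\ {ae mu, forall x, D x -> Vp (f x)}].

End BochnerIntegral.

(* An operator with domain [D] is given by [D] and a total function [A] whose
   values outside [D] are irrelevant. *)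
Section Operators.
Context (R : realType) (K : numFieldType) (s : scalars R K).
Context (X : completeNormedModType K).

Definition linear_on (Y : completeNormedModType K) (D : set X) (A : X -> Y) :
    Prop :=
  forall (a : K) x y, D x -> D y -> A (a *: x + y) = a *: A x + A y.

Definition linear_subspace (D : set X) : Prop :=
  D 0 /\ forall (a : K) x y, D x -> D y -> D (a *: x + y).

Definition closed_op (D : set X) (A : X -> X) : Prop :=
  closed [set xy : X * X | D xy.1 /\ xy.2 = A xy.1].

Definition resolvent_set (D : set X) (A : X -> X) : set K :=
  [set l | (forall y, exists! x, D x /\ l *: x - A x = y) /\
    exists C : K, forall x, D x -> `|x| <= C * `|l *: x - A x|].

Definition C0_semigroup (T : R -> {linear X -> X}) : Prop :=
  [/\ forall t, 0 <= t -> continuous (T t),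
      forall x, T 0 x = x,
      forall t r x, 0 <= t -> 0 <= r -> T (t + r) x = T t (T r x)
    & forall x, T h x @[h --> 0^'+] --> x].

Definition generates (D : set X) (A : X -> X) (T : R -> {linear X -> X}) :
    Prop :=
  C0_semigroup T /\
  forall x y, (D x /\ A x = y) <->
    ((of_real s h)^-1 *: (T h x - x) @[h --> 0^'+] --> y).

Definition growth_bound (T : R -> {linear X -> X}) : \bar R :=
  ereal_inf [set w%:E | w in [set w : R | exists M : R,
    forall t, 0 <= t ->
    forall x, `|T t x| <= of_real s (M * expR (w * t)) * `|x|]].

End Operators.

Record boundary_system (R : realType) (K : numFieldType) (s : scalars R K)
    (X dX U : completeNormedModType K) := BoundarySystem {
  Dm : set X;
  Am : X -> X;
  Q : X -> dX;
  B : {linear U -> dX};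
  T : R -> {linear X -> X};
  Dm_subspace : linear_subspace Dm;
  Am_linear : linear_on Dm Am;
  Am_closed : closed_op Dm Am;
  Dm_dense : dense Dm;
  Q_linear : linear_on Dm Q;
  Q_bounded : exists C : K, forall x, Dm x -> `|Q x| <= C * (`|x| + `|Am x|);
  B_bounded : continuous B;
  A_generates : generates s [set x | Dm x /\ Q x = 0] Am T;
  Q_surjective : forall y, exists2 x, Dm x & Q x = y
}.

Section BoundaryControl.
Context (R : realType) (K : numFieldType) (s : scalars R K).
Context (X dX U : completeNormedModType K).
Variable S : boundary_system s X dX U.

(* The generator [A] is [Am S] on this domain. *)
Definition DA : set X := [set x | Dm S x /\ Q S x = 0].

Definition rhoA : set K := resolvent_set DA (Am S).

Definition omega0 : \bar R := growth_bound s (T S).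

(* For [l] in [rhoA] this is the inverse of [Q] restricted to ker (l - Am). *)
Definition Q_ (l : K) (y : dX) : X :=
  xget 0 [set x | [/\ Dm S x, Am S x = l *: x & Q S x = y]].

Definition B_ (l : K) (v : U) : X := Q_ l (B S v).

Definition convolution (l : K) (t : R) (u : R -> U) : X :=
  bochner_integral s `[0, t] (fun r => T S (t - r) (B_ l (u r))).

Definition boundary_admissible (p : \bar R) : Prop :=
  exists (t : R) (l : K), [/\ 0 < t, rhoA l &
    forall u, Lp s p `[0, t] u -> DA (convolution l t u)].

(* Under admissibility the value does not depend on the point [l] of [rhoA];
   an arbitrary one is chosen. *)
Definition controllability_map (t : R) (u : R -> U) : X :=
  let l := xget 0 rhoA in l *: convolution l t u - Am S (convolution l t u).

Definition exact_reach_at (p : \bar R) (Up : set U) (t : R) : set X :=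
  controllability_map t @` Lp_cone s p `[0, t] Up.

Definition exact_reach (p : \bar R) (Up : set U) : set X :=
  \bigcup_(t in [set t : R | 0 <= t]) exact_reach_at p Up t.

Definition approx_reach_at (p : \bar R) (Up : set U) (t : R) : set X :=
  closure (exact_reach_at p Up t).

Definition approx_reach (p : \bar R) (Up : set U) : set X :=
  closure (\bigcup_(t in [set t : R | 0 <= t]) approx_reach_at p Up t).

End BoundaryControl.

(* Main.v *)
From HB Require Import structures.
Require Import Defs.
From mathcomp Require Import all_boot all_order all_algebra.
From mathcomp Require Import complex.
From mathcomp Require Import all_classical all_reals all_analysis.
From mathcomp Require Import finmap measurable_realfun ess_sup_inf ring lra.
Import Order.TTheory GRing.Theory Num.Theory.
Import numFieldNormedType.Exports HBNNSimple.

Set Implicit Arguments.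
Unset Strict Implicit.
Unset Printing Implicit Defensive.

Local Open Scope classical_set_scope.
Local Open Scope ring_scope.

(** A positive control is tested on exponentials. Fix a real [l] in the
    resolvent set and [v] in the cone of [U]. The control
    [r |-> expR (l * r) *: v], switched on during [ ]a, b] ], steers the system at
    time [t] to
      [expR (l b) T(t - b) B_l v - expR (l a) T(t - a) B_l v],
    by the fundamental theorem of calculus along an orbit ([orbit_expc_int]).
    Hence positive reachable states imply monotonicity in [a <= b] of
    [expR (l a) T(t - a) B_l] ([reach_exp_monotone]), for every real [l] in the
    resolvent set; such [l] exist because large real numbers belong to it
    ([growth_bound_finite], [rho_growth_bound]).

    Conversely, the state reached by [u] is [l z - A z] for the convolution [z],
    which is the limit of [h^-1 (z - expR (- l h) T(h) z)]. Carried under the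
    integral sign, this quotient acts on the integrand [T(t - r) B_l u(r)], and
    monotonicity between [r - h] and [r] makes the result positive, except near
    [r = 0]; there the semigroup leaves room to compare [r] with [r + h]
    ([exp_monotone_reach]). Positivity passes to the integral and to the limit
    because the cone of a Banach lattice is closed ([bochner_integral_cone],
    [banach_lattice_closed]); for the same reason exact and approximate
    reachability spaces are positive together.

    Let now the semigroup be positive. Monotonicity up to time [t] then amounts to
    [T(r) B_l <= expR (l r) B_l] for [r <= t] ([exp_monotone_dominates],
    [exp_dominates_monotone]), and this inequality propagates from short times to
    all times by the semigroup law ([exp_dominates_all]). So the horizon does not
    matter, which gives the statements about all times and about small times. The
    statement about [B_m] alone rests on the resolvent identity
    [B_m = (l - A) (m - A)^-1 B_l]. Differentiating the inequality at [r = 0] and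
    applying the positive resolvent shows [B_m >= 0] for [m >= l]
    ([exp_dominates_B_pos]). In the other direction [x_m = m (m - A)^-1 B_l v]
    tends to [B_l v], and [l x_m - A x_m = m B_m v] is positive, so that
    [expR (l r) x_m - T(r) x_m], an integral of orbits of this vector, is positive
    as well ([B_pos_dominates]).

    The integrals are Bochner integrals, built from simple functions. The theory of
    resolvents is developed with Laplace transforms cut off at a finite time
    ([lapl]), which satisfy the resolvent equation up to a boundary term and avoid
    improper integrals. Zabreiko's lemma ([zabreiko]) provides the uniform
    boundedness of the semigroup near [0] and the boundedness of the Dirichlet
    operators. *)

(** * Real scalars and real-valued norms *)

Section Scalars.
Context (R : realType) (K : numFieldType) (s : scalars R K).

Lemma of_realD a b : of_real s (a + b) = of_real s a + of_real s b.
Proof. by case: s => //=; apply: rmorphD. Qed.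

Lemma of_realN a : of_real s (- a) = - of_real s a.
Proof. by case: s => //=; apply: rmorphN. Qed.

Lemma of_realM a b : of_real s (a * b) = of_real s a * of_real s b.
Proof. by case: s => //=; apply: rmorphM. Qed.

Lemma of_real1 : of_real s 1 = 1.
Proof. by case: s. Qed.

Lemma of_real0 : of_real s 0 = 0.
Proof. by case: s. Qed.

Lemma of_realB a b : of_real s (a - b) = of_real s a - of_real s b.
Proof. by rewrite of_realD of_realN. Qed.

Lemma of_realV a : of_real s a^-1 = (of_real s a)^-1.
Proof. by case: s => //=; apply: fmorphV. Qed.

Lemma of_realK a : real_part s (of_real s a) = a.
Proof. by case: s. Qed.

Lemma real_partK x : 0 <= x -> of_real s (real_part s x) = x.
Proof. by case: s x => //= -[a b]; rewrite lecE /= => /andP[/eqP -> _]. Qed.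

Lemma le_of_real a b : (of_real s a <= of_real s b) = (a <= b).
Proof. by case: s => //=; rewrite lecR. Qed.

Lemma lt_of_real a b : (of_real s a < of_real s b) = (a < b).
Proof. by case: s => //=; rewrite ltcR. Qed.

Lemma of_real_eq0 a : (of_real s a == 0) = (a == 0).
Proof. by rewrite -of_real0 eq_le !le_of_real -eq_le. Qed.

Lemma norm_of_real a : `|of_real s a| = of_real s `|a|.
Proof.
have [a0|a0] := leP 0 a; first by rewrite !ger0_norm// -of_real0 le_of_real.
by rewrite !ltr0_norm ?of_realN// -of_real0 lt_of_real.
Qed.

Section Norm.
Context (V : completeNormedModType K).
Implicit Types u v w : V.
Local Notation N := (rnorm s).

Lemma normE v : `|v| = of_real s (N v).
Proof. by rewrite /rnorm real_partK. Qed.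

Lemma rnorm_ge0 v : 0 <= N v.
Proof. by rewrite -le_of_real of_real0 -normE. Qed.

Lemma rnorm0 : N (0 : V) = 0.
Proof. by rewrite /rnorm normr0 -of_real0 of_realK. Qed.

Lemma rnorm_eq0 v : (N v == 0) = (v == 0).
Proof. by rewrite -of_real_eq0 -normE normr_eq0. Qed.

Lemma rnormN v : N (- v) = N v.
Proof. by rewrite /rnorm normrN. Qed.

Lemma rnormB v w : N (v - w) = N (w - v).
Proof. by rewrite -rnormN opprB. Qed.

Lemma ler_rnormD v w : N (v + w) <= N v + N w.
Proof. by rewrite -le_of_real of_realD -!normE ler_normD. Qed.

Lemma ler_rnormB v w : N (v - w) <= N v + N w.
Proof. by rewrite (le_trans (ler_rnormD _ _))// rnormN. Qed.

Lemma ler_rnormtri u v w : N (u - w) <= N (u - v) + N (v - w).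
Proof. by rewrite (le_trans _ (ler_rnormD _ _))// addrA subrK. Qed.

Lemma ler_rnorm_dist v w : N v <= N w + N (v - w).
Proof. by rewrite (le_trans _ (ler_rnormD _ _))// addrCA subrr addr0. Qed.

Lemma rnormZ (k : K) v : N (k *: v) = real_part s `|k| * N v.
Proof.
rewrite /rnorm normrZ -{1}(real_partK (normr_ge0 k)) -{1}(real_partK (normr_ge0 v)).
by rewrite -of_realM of_realK.
Qed.

Lemma rnormZr (a : R) v : N (of_real s a *: v) = `|a| * N v.
Proof. by rewrite rnormZ norm_of_real of_realK. Qed.

Lemma rnorm_sum (I : Type) (r : seq I) (F : I -> V) :
  N (\sum_(i <- r) F i) <= \sum_(i <- r) N (F i).
Proof.
elim: r => [|i r IH]; first by rewrite !big_nil rnorm0.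
by rewrite !big_cons (le_trans (ler_rnormD _ _))// lerD2l.
Qed.

(** Convergence in a [K]-valued norm is tested on the real-valued norm. *)
Lemma rcvgP (T : Type) (F : set_system T) {FF : Filter F} (f : T -> V) (l : V) :
  f @ F --> l <-> forall e : R, 0 < e -> \forall x \near F, N (f x - l) < e.
Proof.
split=> [/cvgrPdist_lt h e e0|h].
  have /h : 0 < of_real s e by rewrite -of_real0 lt_of_real.
  by apply: filterS => x; rewrite normE lt_of_real rnormB.
apply/cvgrPdist_lt => e e0; have [e' ee'] : exists e', e = of_real s e'.
  by exists (real_part s e); rewrite real_partK// ltW.
have /h : 0 < e' by rewrite -lt_of_real of_real0 -ee'.
by apply: filterS => x; rewrite ee' normE lt_of_real rnormB.
Qed.

Lemma rcvg0P (T : Type) (F : set_system T) {FF : Filter F} (f : T -> V) (l : V) :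
  f @ F --> l <-> N (f x - l) @[x --> F] --> (0 : R).
Proof.
rewrite rcvgP; split=> [h|/cvgrPdist_lt h e e0].
  apply/cvgrPdist_lt => e e0; apply: filterS (h e e0) => x.
  by rewrite sub0r normrN ger0_norm// rnorm_ge0.
by apply: filterS (h e e0) => x; rewrite sub0r normrN ger0_norm// rnorm_ge0.
Qed.

Lemma rcvg_dom (T : Type) (F : set_system T) {FF : Filter F} (f : T -> V) (l : V)
    (b : T -> R) :
  (\forall x \near F, N (f x - l) <= b x) -> b x @[x --> F] --> (0 : R) ->
  f @ F --> l.
Proof.
move=> h /cvgrPdist_lt hb; apply/rcvgP => e e0.
have := hb e e0; apply: filterS2 h => x h1.
by rewrite sub0r normrN; apply: le_lt_trans; rewrite (le_trans h1)// ler_norm.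
Qed.

Lemma rnbhsP (x : V) (A : set V) :
  nbhs x A <-> exists2 e : R, 0 < e & forall y, N (y - x) < e -> A y.
Proof.
split=> [/nbhs_ballP[e /= e0 h]|[e e0 h]].
  exists (real_part s e).
    by rewrite -lt_of_real of_real0 real_partK// ltW.
  move=> y yx; apply: h; rewrite -ball_normE /ball_ /= distrC normE.
  by rewrite -[ltRHS]real_partK ?lt_of_real// ltW.
apply/nbhs_ballP; exists (of_real s e) => /=; first by rewrite -of_real0 lt_of_real.
by move=> y; rewrite -ball_normE /ball_ /= distrC normE lt_of_real => /h.
Qed.

End Norm.

Lemma rcauchy_cvg (V : completeNormedModType K) (u : nat -> V) :
  (forall e : R, 0 < e -> exists n, forall i j, (n <= i)%N -> (n <= j)%N ->
     rnorm s (u i - u j) < e) -> exists l : V, u @ \oo --> l.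
Proof.
move=> h; suff : cvg (u @ \oo) by move=> /cvg_ex.
apply: cauchy_cvg; apply: cauchy_exP => e e0.
have e1 : 0 < real_part s e by rewrite -lt_of_real of_real0 real_partK// ltW.
have [n hn] := h _ e1; exists (u n); exists n => // m /= nm.
rewrite -ball_normE /ball_ /= normE -[ltRHS]real_partK ?(ltW e0)//.
by rewrite lt_of_real hn.
Qed.

Lemma continuous_bounded (V W : completeNormedModType K) (L : {linear V -> W}) :
  continuous L -> exists2 M, 0 < M & forall x, rnorm s (L x) <= M * rnorm s x.
Proof.
move=> /(_ 0); rewrite /continuous_at linear0 => /rcvgP /(_ _ ltr01).
move=> /rnbhsP[e e0 h]; exists (2 / e) => [|x]; first by rewrite divr_gt0.
have [->|x0] := eqVneq x 0; first by rewrite linear0 !rnorm0 mulr0.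
have nx0 : 0 < rnorm s x by rewrite lt_def rnorm_eq0 x0 rnorm_ge0.
have := h (of_real s (e / 2 / rnorm s x) *: x).
rewrite subr0 linearZ /= subr0 !rnormZr ger0_norm; last first.
  by rewrite !divr_ge0// ltW.
rewrite divfK ?gt_eqF// => /(_ _)/ltW H.
have {}H : e / 2 / rnorm s x * rnorm s (L x) <= 1.
  by apply: H; rewrite ltr_pdivrMr// mulr_natr mulr2n ltrDl.
have -> : rnorm s (L x) =
    2 / e * rnorm s x * (e / 2 / rnorm s x * rnorm s (L x)).
  by field; rewrite !gt_eqF.
by rewrite ler_piMr// mulr_ge0 ?divr_ge0// ltW.
Qed.

Lemma bounded_continuous (V W : completeNormedModType K) (L : V -> W) (M : R) :
  (forall x y, rnorm s (L x - L y) <= M * rnorm s (x - y)) -> continuous L.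
Proof.
move=> LM x; apply: (@rcvg_dom _ _ _ _ _ _ (fun y => M * rnorm s (y - x))).
  by near=> y; exact: LM.
rewrite -[0](mulr0 M); apply: cvgMr; apply/rcvg0P; exact: cvg_id.
Unshelve. all: by end_near. Qed.

End Scalars.

(** * Zabreiko's lemma *)

Section Zabreiko.
Context (R : realType) (K : numFieldType) (s : scalars R K).
Context (V : completeNormedModType K) (p : V -> R).
Local Notation N := (rnorm s).
Hypothesis pD : forall x y, p (x + y) <= p x + p y.
Hypothesis pZ : forall (a : R) x, p (of_real s a *: x) = `|a| * p x.
Hypothesis p_series : forall (u : nat -> V) x (c : R),
  (\sum_(k < n) u k) @[n --> \oo] --> x ->
  (forall n, \sum_(k < n) p (u k) <= c) -> p x <= c.

Let p0 : p 0 = 0.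
Proof. by rewrite -(scale0r 0) -(of_real0 s) pZ normr0 mul0r. Qed.

Let pN x : p (- x) = p x.
Proof. by rewrite -scaleN1r -(of_real1 s) -of_realN pZ normrN1 mul1r. Qed.

Let expV2_small (e : R) : 0 < e -> exists n, (2^-1 : R) ^+ n < e.
Proof.
move=> e0; have /cvgrPdist_lt /(_ e e0)[n _ h] : (2^-1 : R) ^+ n @[n --> \oo] --> (0 : R).
  by apply: cvg_expr; rewrite ger0_norm// invf_lt1// ltr1n.
exists n; have := h n (leqnn n).
by rewrite sub0r normrN ger0_norm// exprn_ge0.
Qed.

(** Baire's argument: if no sublevel set of [p] were dense in a ball, one could
    nest balls of radius tending to [0], the [n]-th of which has [p] above [n];
    their common point would have [p] infinite. *)
Let somewhere_dense : exists (c : R) x (r : R), 0 < r /\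
  forall y, N (y - x) <= r -> forall e : R, 0 < e -> exists2 z, N (z - y) < e & p z <= c.
Proof.
apply: contrapT => hn.
have step (a : nat * (V * R)) : exists b : V * R, 0 < a.2.2 ->
    [/\ 0 < b.2, b.2 <= a.2.2 / 2, N (b.1 - a.2.1) <= a.2.2 / 2 &
        forall z, N (z - b.1) <= b.2 -> a.1%:R < p z].
  case: a => n [x r] /=; have [r0|] := ltP 0 r; last by exists (x, r).
  apply: contrapT => h; apply: hn; exists n%:R, x, (r / 2).
  split=> [|y yx e e0]; first by rewrite divr_gt0.
  apply: contrapT => h2; apply: h; exists (y, Num.min (r / 2) (e / 2)) => _ /=.
  split=> // [||z].
  - by rewrite lt_min !divr_gt0.
  - by rewrite ge_min lexx.
  - rewrite le_min => /andP[_ ze]; rewrite ltNge; apply/negP => pz; apply: h2.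
    by exists z => //; rewrite (le_lt_trans ze)// ltr_pdivrMr// ltr_pMr// ltr1n.
have [f hf] := choice step.
(* The [n]-th ball, as a pair of center and radius. *)
pose w := fix w (n : nat) : V * R := if n is m.+1 then f (m, w m) else (0 : V, 1 : R).
have w0 n : 0 < (w n).2.
  by elim: n => [|n IH] /=; [exact: ltr01|have [] := hf (n, w n) IH].
have ww n := hf (n, w n) (w0 n).
have wexp n : (w n).2 <= (2^-1 : R) ^+ n.
  elim: n => [|n IH]; first by rewrite expr0.
  have [_ h _ _] := ww n; rewrite (le_trans h)//= exprSr ler_wpM2r//.
have nest n m : (n <= m)%N -> N ((w m).1 - (w n).1) + (w m).2 <= (w n).2.
  elim: m => [|m IH]; first by rewrite leqn0 => /eqP->; rewrite subrr rnorm0 add0r.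
  rewrite leq_eqVlt => /predU1P[->|/IH {}IH]; first by rewrite subrr rnorm0 add0r.
  have [_ h1 h2 _] := ww m; apply: le_trans IH.
  have := ler_rnormtri s (w m.+1).1 (w m).1 (w n).1.
  by move: h1 h2 => /=; lra.
have nest' n m : (n <= m)%N -> N ((w m).1 - (w n).1) <= (w n).2.
  by move=> /nest; apply: le_trans; rewrite lerDl ltW.
have [l hl] : exists l : V, (w n).1 @[n --> \oo] --> l.
  apply: (@rcauchy_cvg _ _ s) => e e0.
  have [|n hn2] := @expV2_small (e / 2); first by lra.
  exists n => i j ni nj /=; have := nest' _ _ ni; have := nest' _ _ nj.
  have := ler_rnormtri s (w i).1 (w n).1 (w j).1.
  rewrite (rnormB s (w n).1); have := wexp n.
  by move: hn2; move: (_ ^+ n) => A; lra.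
have ln n : N (l - (w n).1) <= (w n).2.
  rewrite leNgt; apply/negP; rewrite -subr_gt0 => /(proj1 (@rcvgP _ _ s _ _ _ _ _ _) hl)[m _ h].
  have := h _ (leq_maxl m n); have := nest' _ _ (leq_maxr m n).
  have := ler_rnormtri s l (w (maxn m n)).1 (w n).1.
  by rewrite (rnormB s l (w (maxn m n)).1) => /=; lra.
have pl n : n%:R < p l.
  have [_ _ _] := ww n; apply; exact: ln n.+1.
have := pl (Num.truncn (p l)).+1; apply/negP; rewrite -leNgt ltW//.
exact: Num.Theory.truncnS_gt.
Qed.

(** Half differences of points of the ball given by [somewhere_dense] fill a
    ball around [0] densely, and [p] stays bounded on them; homogeneity then
    makes the bound proportional to [N x]. *)
Let approx_by : exists2 M, 0 <= M & forall x (e : R), 0 < e ->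
  exists2 z, N (z - x) < e & p z <= M * N x.
Proof.
have [c [x0 [r [r0 h]]]] := somewhere_dense.
have c0 : 0 <= c.
  have [|z _ pz] := h x0 _ 1 ltr01; first by rewrite subrr rnorm0 ltW.
  apply: le_trans pz; have := pD z (- z); rewrite subrr p0 pN => H.
  by move: H; lra.
have hs x : N x <= r -> forall e : R, 0 < e -> exists2 z, N (z - x) < e & p z <= c.
  move=> xr e e0.
  have [|z1 h1 k1] := h (x0 + x) _ e e0; first by rewrite addrAC subrr add0r.
  have [|z2 h2 k2] := h (x0 - x) _ e e0; first by rewrite addrAC subrr add0r rnormN.
  exists (of_real s 2^-1 *: (z1 - z2)).
    have -> : of_real s 2^-1 *: (z1 - z2) - x =
        of_real s 2^-1 *: ((z1 - (x0 + x)) - (z2 - (x0 - x))).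
      rewrite opprB [x0 - x - z2]addrC [in RHS]addrACA opprD.
      rewrite (addrACA (- x0)) addNr add0r -opprD [in RHS]scalerBr; congr (_ - _).
      rewrite scalerDr -scalerDl -of_realD.
      have -> : (2^-1 + 2^-1 : R) = 1 by field.
      by rewrite of_real1 scale1r.
    rewrite rnormZr ger0_norm//; have := ler_rnormB s (z1 - (x0 + x)) (z2 - (x0 - x)).
    by lra.
  by rewrite pZ ger0_norm//; have := pD z1 (- z2); rewrite pN; lra.
exists (c / r) => [|x e e0]; first by rewrite divr_ge0// ltW.
have [->|x0'] := eqVneq x 0; first by exists 0; rewrite ?subrr ?p0 ?rnorm0// mulr0.
have nx : 0 < N x by rewrite lt_def rnorm_eq0 x0' rnorm_ge0.
have ar : 0 < r / N x by rewrite divr_gt0.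
have [||z hz pz] := hs (of_real s (r / N x) *: x) _ (r / N x * e).
- by rewrite rnormZr gtr0_norm// divfK// gt_eqF.
- by rewrite mulr_gt0.
exists (of_real s (r / N x)^-1 *: z).
  have -> : of_real s (r / N x)^-1 *: z - x =
      of_real s (r / N x)^-1 *: (z - of_real s (r / N x) *: x).
    by rewrite scalerBr scalerA -of_realM mulVf ?gt_eqF// of_real1 scale1r.
  by rewrite rnormZr gtr0_norm ?invr_gt0// ltr_pdivrMl.
rewrite pZ gtr0_norm ?invr_gt0// invf_div mulrC mulrA mulrAC ler_wpM2r//.
  by rewrite ltW.
by rewrite ler_wpM2r// invr_ge0 ltW.
Qed.

(** Zabreiko's lemma. The hypothesis [p_series] is countable subadditivity, in a
    form that only speaks of partial sums. Every [x] is the sum of successive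
    approximants of its remainders, whose norms halve at each step, and [p] of
    the [k]-th one is at most [M * N x / 2 ^ k]. The lemma serves below both as
    the uniform boundedness principle and as the closed graph theorem. *)
Theorem zabreiko : exists2 M, 0 < M & forall x, p x <= M * N x.
Proof.
have [M M0 h] := approx_by; exists (2 * M + 1) => [|x]; first by lra.
have [->|x0] := eqVneq x 0; first by rewrite p0 rnorm0 mulr0.
have nx : 0 < N x by rewrite lt_def rnorm_eq0 x0 rnorm_ge0.
have step (a : nat * V) : exists z, N (z - a.2) < N x * 2^-1 ^+ a.1.+1 /\ p z <= M * N a.2.
  have [|z ? ?] := h a.2 (N x * 2^-1 ^+ a.1.+1); last by exists z.
  by rewrite mulr_gt0// exprn_gt0.
have [f hf] := choice step.
(* [y n] is what remains of [x] after [n] approximants. *)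
pose y := fix y (n : nat) : V := if n is m.+1 then y m - f (m, y m) else x.
have ny n : N (y n) <= N x * 2^-1 ^+ n.
  case: n => [|n]; first by rewrite expr0 mulr1.
  by have [/ltW] := hf (n, y n); rewrite rnormB.
have sumE n : \sum_(k < n) f (nat_of_ord k, y k) = x - y n.
  elim: n => [|n IH]; first by rewrite big_ord0 subrr.
  by rewrite big_ord_recr IH /= opprB addrCA addrC.
apply: (@p_series (fun k => f (k, y k))).
  under eq_fun do rewrite sumE.
  apply: (@rcvg_dom _ _ s _ _ _ _ _ _ (fun n => N x * 2^-1 ^+ n)).
    by apply: nearW => n; rewrite addrAC subrr add0r rnormN.
  rewrite -[0](mulr0 (N x)); apply: cvgMr; apply: cvg_expr.
  by rewrite ger0_norm// invf_lt1// ltr1n.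
move=> n; apply: (@le_trans _ _ (\sum_(k < n) M * (N x * 2^-1 ^+ k))).
  apply: ler_sum => i _; have [_] := hf (nat_of_ord i, y i).
  by move=> h1; apply: (le_trans h1); rewrite ler_wpM2l//; exact: ny.
have -> : \sum_(k < n) M * (N x * 2^-1 ^+ k) = 2 * M * N x * (1 - 2^-1 ^+ n).
  elim: n => [|n IH]; first by rewrite big_ord0 expr0 subrr mulr0.
  by rewrite big_ord_recr /= IH exprS; field.
apply: (@le_trans _ _ (2 * M * N x)); last by rewrite ler_wpM2r ?ltW//; lra.
by apply: ler_piMr; [rewrite !mulr_ge0// ltW|rewrite gerBl exprn_ge0].
Qed.

End Zabreiko.

(** * Simple functions and their integrals *)

Section SimpleFunctions.
Context (R : realType).
Let mu := @lebesgue_measure R.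

(** Stated for plain functions, so that compositions with arbitrary maps need no
    repackaging of the finiteness of the range. *)
Definition is_simple (W : Type) (h : R -> W) : Prop :=
  finite_set (range h) /\
  forall v, measurable (h @^-1` [set v] : set (measurableTypeR R)).

Lemma is_simple_preimage (W : Type) (h : R -> W) (P : set W) :
  is_simple h -> measurable (h @^-1` P : set (measurableTypeR R)).
Proof.
move=> [hf hm]; have -> : h @^-1` P = \bigcup_(v in range h `&` P) h @^-1` [set v].
  apply/seteqP; split=> [x Px|x [v [_ Pv] /= hx]]; last by rewrite hx.
  by exists (h x) => //; split=> //; exists x.
by apply: fin_bigcup_measurable => //; apply: finite_setIl.
Qed.

Lemma is_simple_cst (W : Type) (w : W) : is_simple (fun _ : R => w).
Proof.
split=> [|v]; first exact: finite_image_cst.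
have [wv|wv] := pselect (w = v).
  by rewrite (_ : _ @^-1` _ = setT)//; apply/seteqP; split.
by rewrite (_ : _ @^-1` _ = set0)//; apply/seteqP; split.
Qed.

Lemma is_simple_comp (V W : Type) (phi : V -> W) (h : R -> V) :
  is_simple h -> is_simple (phi \o h).
Proof.
move=> hs; split=> [|v]; last exact: (is_simple_preimage (phi @^-1` [set v]) hs).
by rewrite -(image_comp h phi); apply: finite_image; case: hs.
Qed.

Lemma is_simple_pair (V W : Type) (h : R -> V) (k : R -> W) :
  is_simple h -> is_simple k -> is_simple (fun x => (h x, k x)).
Proof.
move=> hs ks; split=> [|[v w]].
  apply: (@sub_finite_set _ _ (range h `*` range k)).
    by move=> _ [x _ <-]; split; exists x.
  by apply: finite_setX; [case: hs|case: ks].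
rewrite (_ : _ @^-1` _ = h @^-1` [set v] `&` k @^-1` [set w]).
  by apply: measurableI; apply: is_simple_preimage.
by apply/seteqP; split=> x /= [-> ->].
Qed.

Lemma is_simple_comp2 (V W Z : Type) (phi : V -> W -> Z) (h : R -> V) (k : R -> W) :
  is_simple h -> is_simple k -> is_simple (fun x => phi (h x) (k x)).
Proof.
move=> hs ks; exact: (is_simple_comp (fun p => phi p.1 p.2) (is_simple_pair hs ks)).
Qed.

Lemma is_simple_if (W : Type) (A : set R) (h k : R -> W) :
  measurable (A : set (measurableTypeR R)) -> is_simple h -> is_simple k ->
  is_simple (fun x => if x \in A then h x else k x).
Proof.
move=> mA hs ks.
have As : is_simple (fun x => x \in A).
  split=> [|v]; first exact: finite_finset.
  have [->|->] : v = true \/ v = false by case: v; [left|right].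
    by rewrite (_ : _ @^-1` _ = A)//; apply/seteqP; split=> x /= => [/set_mem|/mem_set].
  rewrite (_ : _ @^-1` _ = ~` A); first exact: measurableC.
  apply/seteqP; split=> x /=; first by move=> /negbT; rewrite notin_setE.
  by move=> nA; apply/negbTE; rewrite notin_setE.
exact: (is_simple_comp2 (fun (b : bool) p => if b then p.1 else p.2) As (is_simple_pair hs ks)).
Qed.

End SimpleFunctions.

Section SimpleIntegral.
Context (R : realType) (K : numFieldType) (s : scalars R K).
Local Notation mu := (@lebesgue_measure R).
Local Notation N := (rnorm s).

Lemma of_real_sum (I : Type) (r : seq I) (P : pred I) (F : I -> R) :
  of_real s (\sum_(i <- r | P i) F i) = \sum_(i <- r | P i) of_real s (F i).
Proof.
apply: (big_morph (of_real s)); [exact: of_realD|exact: of_real0].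
Qed.

Definition sint (V : completeNormedModType K) (D : set R) (h : R -> V) : V :=
  \sum_(v \in range h) of_real s (fine (mu (D `&` h @^-1` [set v]))) *: v.

Section Domain.
Variables (D : set R).
Hypotheses (mD : measurable (D : set (measurableTypeR R))) (fD : (mu D < +oo)%E).

Let mfin (E : set R) : measurable (E : set (measurableTypeR R)) ->
  mu (D `&` E) \is a fin_num.
Proof.
move=> mE; rewrite ge0_fin_numE//; apply: le_lt_trans fD.
by apply: le_measure => //; apply/mem_set => //; exact: measurableI.
Qed.

Lemma measure_simple_preimage (W : choiceType) (w : R -> W) (P : pred W) :
  is_simple w ->
  fine (mu (D `&` w @^-1` [set` P])) =
  \sum_(y <- fset_set (range w) | P y) fine (mu (D `&` w @^-1` [set y])).
Proof.
move=> ws; have [wf wm] := ws.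
rewrite sum_fine => [|y _]; last exact: mfin.
congr fine.
rewrite (_ : D `&` _ = \bigcup_(y in range w `&` [set` P]) (D `&` w @^-1` [set y])).
  rewrite measure_fin_bigcup//; first last.
  - by move=> y _; apply: measurableI.
  - apply/trivIsetP => y z _ _ yz; rewrite setIACA setIid.
    rewrite (_ : _ `&` (w @^-1` [set z]) = set0) ?setI0//.
    by apply/seteqP; split=> x //= [wy wz]; case/negP: yz; rewrite -wy -wz.
  - exact: finite_setIl.
  rewrite fsbig_mkcondr fsbig_finite// [RHS]big_mkcond /=.
  by apply: eq_bigr => y _; rewrite mem_setE.
apply/seteqP; split=> [x [Dx Px]|x [y [_ Py] [Dx /= xy]]].
  by exists (w x) => //; split=> //; exists x.
by split=> //; rewrite /= xy.
Qed.

(** Group the level sets of [w] by the value of [phi]. For [w] a pair of simple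
    functions this puts both on common level sets. *)
Lemma sint_comp (V : completeNormedModType K) (W : choiceType) (w : R -> W)
    (phi : W -> V) : is_simple w ->
  sint D (phi \o w) = \sum_(y <- fset_set (range w))
    of_real s (fine (mu (D `&` w @^-1` [set y]))) *: phi y.
Proof.
move=> ws; have [wf wm] := ws; have [pf pm] := is_simple_comp phi ws.
rewrite /sint fsbig_finite//.
transitivity (\sum_(v <- fset_set (range (phi \o w)))
   \sum_(y <- fset_set (range w) | phi y == v)
     of_real s (fine (mu (D `&` w @^-1` [set y]))) *: phi y).
  apply: eq_bigr => v _.
  rewrite (_ : (phi \o w) @^-1` [set v] = w @^-1` [set` (fun y => phi y == v)]).
    rewrite measure_simple_preimage// of_real_sum scaler_suml.
    by apply: eq_bigr => y /eqP ->.
  by apply/seteqP; split=> x /= /eqP.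
rewrite (exchange_big_dep xpredT)//=; apply: eq_big_seq => y yw.
rewrite (eq_bigl (fun v => v == phi y)) => [|v]; last by rewrite eq_sym.
rewrite big_mkcond (bigD1_seq (phi y)) /= ?fset_uniq//.
  by rewrite eqxx big1 ?addr0// => v /negbTE ->.
move: yw; rewrite in_fset_set// => /set_mem[x _ <-].
by rewrite in_fset_set//; apply/mem_set; exists x.
Qed.

Section Linear.
Context (V : completeNormedModType K).
Implicit Types h k : R -> V.

Lemma sintD h k : is_simple h -> is_simple k ->
  sint D (fun x => h x + k x) = sint D h + sint D k.
Proof.
move=> hs ks; have ps := is_simple_pair hs ks.
rewrite -[LHS]/(sint D ((fun q : V * V => q.1 + q.2) \o (fun x => (h x, k x)))).
rewrite -[sint D h]/(sint D (fst \o (fun x => (h x, k x)))).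
rewrite -[sint D k]/(sint D (snd \o (fun x => (h x, k x)))).
rewrite !sint_comp// -big_split; apply: eq_bigr => y _ /=.
by rewrite scalerDr.
Qed.

Lemma sint_norm h : is_simple h ->
  ((N (sint D h))%:E <= \int[mu]_(x in D) (N (h x))%:E)%E.
Proof.
move=> hs; have [hf hm] := hs.
pose f (v : V) (x : measurableTypeR R) : \bar R := ((N v)%:E * (\1_(h @^-1` [set v]) x)%:E)%E.
have mf v : @measurable_fun _ _ (measurableTypeR R) (\bar R) D (f v).
  by apply/measurable_EFinP; apply: measurable_funM.
have f0 v x : D x -> (0 <= f v x)%E.
  by move=> _; rewrite mule_ge0 ?lee_fin ?rnorm_ge0.
have E : (\int[mu]_(x in D) (N (h x))%:E =
    \int[mu]_(x in D) (\sum_(v \in range h) f v x)%R)%E.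
  apply: eq_integral => x _; rewrite (fsbigD1 (h x))//=.
  rewrite fsbig1 => [|v [_ vh]].
    by rewrite addr0 /f indicE mem_set//= mule1.
  by rewrite /f indicE memNset ?mule0// => hv; apply: vh.
  by exists x.
rewrite E (ge0_integral_fsum mu mD mf f0 hf).
rewrite /sint fsbig_finite// fsbig_finite//=.
apply: (@le_trans _ _ (\sum_(v <- fset_set (range h))
   (fine (mu (D `&` h @^-1` [set v])) * N v)%:E)%E).
  rewrite sumEFin lee_fin (le_trans (rnorm_sum _ _ _))//.
  by apply: ler_sum => v _; rewrite rnormZr ger0_norm// fine_ge0.
apply: lee_sum => v _.
have -> : (\int[mu]_(x in D) f v x = (N v)%:E * mu (h @^-1` [set v] `&` D))%E.
  rewrite /f ge0_integralZl//; last by rewrite lee_fin rnorm_ge0.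
  - by rewrite integral_indic.
  - exact/measurable_EFinP/measurable_indic.
by rewrite EFinM fineK ?mfin// muleC setIC.
Qed.

End Linear.

Lemma sint_op (V W : completeNormedModType K) (L : {linear V -> W}) (h : R -> V) :
  is_simple h -> sint D (L \o h) = L (sint D h).
Proof.
move=> hs; rewrite sint_comp// /sint fsbig_finite//; last by case: hs.
by rewrite linear_sum; apply: eq_bigr => v _; rewrite linearZ.
Qed.

End Domain.

Lemma sintU (V : completeNormedModType K) (D E : set R) (h : R -> V) :
  measurable (D : set (measurableTypeR R)) ->
  measurable (E : set (measurableTypeR R)) ->
  (mu D < +oo)%E -> (mu E < +oo)%E -> D `&` E = set0 -> is_simple h ->
  sint (D `|` E) h = sint D h + sint E h.
Proof.
move=> mD mE fD fE DE hs; have [hf hm] := hs.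
rewrite /sint !fsbig_finite// -big_split; apply: eq_bigr => v _ /=.
rewrite -scalerDl -of_realD -fineD.
- by rewrite setIUl measureU//; [exact: measurableI|exact: measurableI|
    rewrite setIACA DE set0I].
- rewrite ge0_fin_numE//; apply: le_lt_trans fD.
  by apply: le_measure => //; apply/mem_set => //; exact: measurableI.
- rewrite ge0_fin_numE//; apply: le_lt_trans fE.
  by apply: le_measure => //; apply/mem_set => //; exact: measurableI.
Qed.

End SimpleIntegral.

(** * Strong measurability *)

Section StrongMeasurability.
Context (R : realType) (K : numFieldType) (s : scalars R K).
Local Notation mu := (@lebesgue_measure R).
Local Notation N := (rnorm s).
Local Notation meas D := (measurable (D : set (measurableTypeR R))).

Lemma fimfun_of_simple (V : completeNormedModType K) (g : nat -> R -> V) :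
  (forall n, is_simple (g n)) -> exists2 k : nat -> {fimfun R >-> V},
    (forall n, simple (k n)) & forall n, k n = g n :> (R -> V).
Proof.
move=> gs.
have [k kg] : {k : nat -> {fimfun R >-> V} & forall n, k n = g n :> (R -> V)}.
  have gf n : g n \in fimfun by apply/mem_set; case: (gs n).
  by exists (fun n => fimfun_Sub (gf n)).
exists k => // n v; rewrite kg; by case: (gs n).
Qed.

Lemma simpleP (V : completeNormedModType K) (g : {fimfun R >-> V}) :
  simple g -> is_simple g.
Proof. by move=> gs; split=> //; exact: fimfunP. Qed.

Lemma strongly_measurableP (V : completeNormedModType K) (D : set R) (f : R -> V) :
  strongly_measurable D f <-> exists2 g : nat -> R -> V,
    (forall n, is_simple (g n)) & forall x, D x -> g n x @[n --> \oo] --> f x.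
Proof.
split=> [[g gs gf]|[g gs gf]].
  by exists (fun n => g n : R -> V) => // n; apply: simpleP.
have [k ks kg] := fimfun_of_simple gs; exists k => // x Dx.
by under eq_fun do rewrite kg; exact: gf.
Qed.

Lemma ecvg0P (a : nat -> \bar R) : (forall n, 0 <= a n)%E ->
  a @ \oo --> 0%E <->
  forall e : R, 0 < e -> exists n, forall m, (n <= m)%N -> (a m < e%:E)%E.
Proof.
move=> a0; split=> [/fine_cvgP[af /cvgrPdist_lt ha] e e0|h].
  have [n1 _ h1] := af; have [n2 _ h2] := ha e e0.
  exists (maxn n1 n2) => m; rewrite geq_max => /andP[m1 m2].
  have := h2 m m2; rewrite sub0r normrN /= => /(le_lt_trans (ler_norm _)).
  by rewrite -lte_fin fineK//; exact: h1.
have af : \forall n \near \oo, a n \is a fin_num.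
  have [n hn] := h 1 ltr01; exists n => // m /= nm.
  by rewrite ge0_fin_numE// (lt_trans (hn m nm))// ltry.
apply/fine_cvgP; split=> //; apply/cvgrPdist_lt => e e0.
have [n hn] := h e e0; exists n => // m /= nm.
rewrite sub0r normrN ger0_norm ?fine_ge0//.
have hm := hn m nm.
by rewrite -lte_fin fineK// ge0_fin_numE// (lt_trans hm)// ltry.
Qed.

Section Measurability.
Context (V : completeNormedModType K).
Implicit Types (D : set R) (f g : R -> V).

Lemma simple_strongly_measurable D g : is_simple g -> strongly_measurable D g.
Proof.
by move=> gs; apply/strongly_measurableP; exists (fun=> g) => // x _; exact: cvg_cst.
Qed.

Lemma strongly_measurable_sub D D' f :
  D' `<=` D -> strongly_measurable D f -> strongly_measurable D' f.
Proof. by move=> DD [g gs gf]; exists g => // x /DD; exact: gf. Qed.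

Lemma eq_strongly_measurable D f g : (forall x, D x -> f x = g x) ->
  strongly_measurable D f -> strongly_measurable D g.
Proof. by move=> fg [k ks kf]; exists k => // x Dx; rewrite -fg//; exact: kf. Qed.

Lemma simple_measurable D (g : R -> R) : is_simple g ->
  measurable_fun (D : set (measurableTypeR R)) g.
Proof. by move=> gs mD Y mY; apply: measurableI => //; apply: is_simple_preimage. Qed.

Lemma measurable_rnorm D f : strongly_measurable D f ->
  measurable_fun (D : set (measurableTypeR R)) (fun x => N (f x)).
Proof.
move=> /strongly_measurableP[g gs gf].
apply: (measurable_fun_cvg (h := fun n x => N (g n x))).
  by move=> n; apply: simple_measurable; exact: (is_simple_comp (fun v : V => N v) (gs n)).
move=> x /gf /(rcvgP s) h; apply/cvgrPdist_lt => e /h; apply: filterS => n.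
rewrite ltr_norml => hn; have := ler_rnorm_dist s (f x) (g n x).
have := ler_rnorm_dist s (g n x) (f x); rewrite (rnormB s (f x)) => h1 h2.
by apply/andP; split; lra.
Qed.

End Measurability.

Lemma strongly_measurable_comp2 (V W Z : completeNormedModType K) (D : set R)
    (phi : V -> W -> Z) (f : R -> V) (g : R -> W) :
  (forall x (u : nat -> V) (w : nat -> W), D x -> u @ \oo --> f x ->
     w @ \oo --> g x -> phi (u n) (w n) @[n --> \oo] --> phi (f x) (g x)) ->
  strongly_measurable D f -> strongly_measurable D g ->
  strongly_measurable D (fun x => phi (f x) (g x)).
Proof.
move=> phic /strongly_measurableP[h hs hf] /strongly_measurableP[k ks kg].
apply/strongly_measurableP; exists (fun n x => phi (h n x) (k n x)).
  by move=> n; apply: is_simple_comp2.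
by move=> x Dx; apply: phic => //; [exact: hf|exact: kg].
Qed.

Lemma strongly_measurableD (V : completeNormedModType K) (D : set R) (f g : R -> V) :
  strongly_measurable D f -> strongly_measurable D g ->
  strongly_measurable D (fun x => f x + g x).
Proof.
apply: (strongly_measurable_comp2 (phi := fun v w => v + w)) => x u w _.
exact: cvgD.
Qed.

Lemma strongly_measurable_comp (V W : completeNormedModType K) (D : set R)
    (L : V -> W) (f : R -> V) : continuous L ->
  strongly_measurable D f -> strongly_measurable D (fun x => L (f x)).
Proof.
move=> Lc mf; apply: (strongly_measurable_comp2 (phi := fun v (w : V) => L v) _ mf mf).
by move=> x u w _ uf _; apply: (@cvg_comp _ _ _ u L _ _ _ uf); exact: Lc.
Qed.

Lemma continuous_opp (V : completeNormedModType K) : continuous (fun x : V => - x).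
Proof. by move=> x; exact: opp_continuous. Qed.

Lemma strongly_measurableB (V : completeNormedModType K) (D : set R) (f g : R -> V) :
  strongly_measurable D f -> strongly_measurable D g ->
  strongly_measurable D (fun x => f x - g x).
Proof.
move=> mf mg; apply: strongly_measurableD => //.
by apply: (@strongly_measurable_comp _ _ _ (fun v : V => - v)) => //; exact: continuous_opp.
Qed.

Lemma nnsfun_simple (g : {nnsfun measurableTypeR R >-> R}) :
  is_simple (g : R -> R).
Proof.
split=> [|v]; first exact: (fimfunP g).
have := @measurable_funPT _ _ _ _ g measurableT [set v] (measurable_set1 v).
by rewrite setTI.
Qed.

(** The delay [k] is a limit of simple functions, which can be fed into [phi]
    together with the simple approximations of [f]. The case of interest is
    [phi a v = T a v], jointly continuous but not norm continuous in [a]. *)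
Lemma strongly_measurable_delay (V W : completeNormedModType K) (D : set R)
    (k : R -> R) (phi : R -> V -> W) (f : R -> V) :
  measurable_fun (setT : set (measurableTypeR R)) k -> (forall x, 0 <= k x) ->
  (forall x (a : nat -> R) (u : nat -> V), D x -> (forall n, 0 <= a n) ->
     a @ \oo --> k x -> u @ \oo --> f x ->
     phi (a n) (u n) @[n --> \oo] --> phi (k x) (f x)) ->
  strongly_measurable D f -> strongly_measurable D (fun x => phi (k x) (f x)).
Proof.
move=> mk k0 phic /strongly_measurableP[g gs gf].
have mk' : measurable_fun (setT : set (measurableTypeR R)) (EFin \o k).
  exact/measurable_EFinP.
pose a n : measurableTypeR R -> R := nnsfun_approx measurableT mk' n.
apply/strongly_measurableP; exists (fun n x => phi (a n x) (g n x)).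
  by move=> n; apply: is_simple_comp2 => //; exact: nnsfun_simple.
move=> x Dx; apply: phic => //; last exact: gf.
have := @cvg_nnsfun_approx _ _ _ _ measurableT _ mk' (fun x _ => k0 x) x I.
by move/fine_cvgP => [].
Qed.

End StrongMeasurability.

(** * The Bochner integral *)

Section BochnerIntegral.
Context (R : realType) (K : numFieldType) (s : scalars R K).
Local Notation mu := (@lebesgue_measure R).
Local Notation N := (rnorm s).
Local Notation meas D := (measurable (D : set (measurableTypeR R))).

Lemma measurable_Ernorm (V : completeNormedModType K) (D : set R) (f : R -> V) :
  strongly_measurable D f ->
  measurable_fun (D : set (measurableTypeR R)) (fun x => (N (f x))%:E).
Proof. by move=> /(measurable_rnorm s) ?; exact/measurable_EFinP. Qed.

Definition bochner_integrable (V : completeNormedModType K) (D : set R) (f : R -> V) :=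
  strongly_measurable D f /\ (\int[mu]_(x in D) (N (f x))%:E < +oo)%E.

Definition approximates (V : completeNormedModType K) (D : set R) (f : R -> V)
    (g : nat -> R -> V) :=
  (forall n, is_simple (g n)) /\
  (\int[mu]_(x in D) (N (f x - g n x))%:E)%E @[n --> \oo] --> 0%E.

Lemma is_bochner_integralP (V : completeNormedModType K) (D : set R) (f : R -> V) v :
  is_bochner_integral s D f v <-> strongly_measurable D f /\
    exists2 g, approximates D f g & sint s D (g n) @[n --> \oo] --> v.
Proof.
split=> [[mf [g [gs gf gv]]]|[mf [g [gs gf] gv]]].
  split=> //; exists (fun n => g n : R -> V) => //; split=> // n.
  exact: simpleP.
have [k ks kg] := fimfun_of_simple gs.
split=> //; exists k; split=> //.
  by under eq_fun do under eq_integral do rewrite kg.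
suff -> : (fun n => simple_integral s D (k n)) = (fun n => sint s D (g n)) by [].
by apply/funext => n; rewrite /sint -kg.
Qed.

Lemma int_rnorm_ge0 (V : completeNormedModType K) (D : set R) (f : R -> V) :
  (0 <= \int[mu]_(x in D) (N (f x))%:E)%E.
Proof. by apply: integral_ge0 => x _; rewrite lee_fin rnorm_ge0. Qed.
Hint Resolve int_rnorm_ge0 : core.

Section Domain.
Variables (D : set R).
Hypotheses (mD : meas D) (fD : (mu D < +oo)%E).

Lemma le_int_rnormD (V W Z : completeNormedModType K) (f : R -> V) (g : R -> W)
    (h : R -> Z) : strongly_measurable D f -> strongly_measurable D g ->
  strongly_measurable D h -> (forall x, D x -> N (h x) <= N (f x) + N (g x)) ->
  (\int[mu]_(x in D) (N (h x))%:E <=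
   \int[mu]_(x in D) (N (f x))%:E + \int[mu]_(x in D) (N (g x))%:E)%E.
Proof.
move=> mf mg mh le_h; rewrite -ge0_integralD//; first last.
- exact: measurable_Ernorm.
- by move=> x _; rewrite lee_fin rnorm_ge0.
- exact: measurable_Ernorm.
- by move=> x _; rewrite lee_fin rnorm_ge0.
apply: ge0_le_integral => //.
- by move=> x _; rewrite lee_fin rnorm_ge0.
- exact: measurable_Ernorm.
- by apply: emeasurable_funD; exact: measurable_Ernorm.
Qed.

Lemma le_int_rnormZ (V W : completeNormedModType K) (f : R -> V) (g : R -> W) (M : R) :
  0 <= M -> strongly_measurable D f -> strongly_measurable D g ->
  {ae mu, forall x, D x -> N (g x) <= M * N (f x)} ->
  (\int[mu]_(x in D) (N (g x))%:E <= M%:E * \int[mu]_(x in D) (N (f x))%:E)%E.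
Proof.
move=> M0 mf mg le_g; rewrite -ge0_integralZl//; first last.
- by move=> x _; rewrite lee_fin rnorm_ge0.
- exact: measurable_Ernorm.
apply: ae_ge0_le_integral => //.
- by move=> x _; rewrite lee_fin rnorm_ge0.
- exact: measurable_Ernorm.
- by move=> x _; rewrite -EFinM lee_fin mulr_ge0// rnorm_ge0.
- by apply: emeasurable_funM => //; exact: measurable_Ernorm.
Qed.

Lemma ecvg0_le (a b : nat -> \bar R) : (forall n, 0 <= a n)%E ->
  (forall n, a n <= b n)%E -> b @ \oo --> 0%E -> a @ \oo --> 0%E.
Proof.
move=> a0 ab b0; apply: (squeeze_cvge _ (cvg_cst 0%E) b0).
by apply: nearW => n; rewrite a0 ab.
Qed.

Section Space.
Context (V : completeNormedModType K).
Implicit Types (f : R -> V) (g : nat -> R -> V).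

Lemma sint_close f (h k : R -> V) : strongly_measurable D f ->
  is_simple h -> is_simple k ->
  ((N (sint s D h - sint s D k))%:E <= \int[mu]_(x in D) (N (f x - h x))%:E +
    \int[mu]_(x in D) (N (f x - k x))%:E)%E.
Proof.
move=> mf hs ks.
have hks : is_simple (fun x => h x - k x) by apply: (is_simple_comp2 (fun v w : V => v - w)).
have -> : sint s D h - sint s D k = sint s D (fun x => h x - k x).
  apply/eqP; rewrite subr_eq -sintD//; apply/eqP; congr (sint s D _).
  by apply/funext => x; rewrite subrK.
apply: le_trans (sint_norm s mD fD hks) _.
apply: le_int_rnormD.
- by apply: strongly_measurableB => //; exact: simple_strongly_measurable.
- by apply: strongly_measurableB => //; exact: simple_strongly_measurable.
- exact: simple_strongly_measurable.
- by move=> x _; rewrite (rnormB s (f x) (h x)) ler_rnormtri.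
Qed.

Lemma approximates_cvg f g : strongly_measurable D f -> approximates D f g ->
  exists v : V, sint s D (g n) @[n --> \oo] --> v.
Proof.
move=> mf [gs gf0]; have gf := proj1 (ecvg0P (fun n => int_rnorm_ge0 D (fun x => f x - g n x))) gf0; apply: (@rcauchy_cvg _ _ s _) => e e0.
have [|n hn] := gf (e / 2); first by lra.
exists n => i j ni nj; rewrite -lte_fin.
apply: le_lt_trans (sint_close mf (gs i) (gs j)) _.
have -> : e = e / 2 + e / 2 by field.
by rewrite EFinD lteD// hn.
Qed.

(** Two sequences close to [f] in mean are close to each other, so that every
    approximating sequence computes the same integral. *)
Lemma approximates_lim f g v : is_bochner_integral s D f v -> approximates D f g ->
  sint s D (g n) @[n --> \oo] --> v.
Proof.
move=> /is_bochner_integralP[mf [k [ks kf] kv]] [gs gf].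
apply/(rcvgP s) => e e0; move/(rcvgP s) : kv => kv.
have e40 : 0 < e / 4 by lra.
have e20 : 0 < e / 2 by lra.
have {kv}[n1 _ h1] := kv _ e20.
have [n2 h2] := proj1 (ecvg0P (fun n => int_rnorm_ge0 D (fun x => f x - k n x))) kf _ e40.
have [n3 h3] := proj1 (ecvg0P (fun n => int_rnorm_ge0 D (fun x => f x - g n x))) gf _ e40.
exists n3 => // m /= nm; pose j := maxn n1 n2.
have := h1 j (leq_maxl _ _) => /= h1'.
have : N (sint s D (g m) - sint s D (k j)) < e / 2.
  rewrite -lte_fin; apply: le_lt_trans (sint_close mf (gs m) (ks j)) _.
  have -> : e / 2 = e / 4 + e / 4 by field.
  by rewrite EFinD lteD// ?h3// h2// leq_maxr.
have := ler_rnormtri s (sint s D (g m)) (sint s D (k j)) v.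
by lra.
Qed.

Lemma bochner_unique f v w :
  is_bochner_integral s D f v -> is_bochner_integral s D f w -> v = w.
Proof.
move=> hv hw; have /is_bochner_integralP[_ [g gf gw]] := hw.
exact: (cvg_unique _ (approximates_lim hv gf) gw).
Qed.

Lemma bochner_integral_eq f v :
  is_bochner_integral s D f v -> bochner_integral s D f = v.
Proof.
move=> hv; rewrite /bochner_integral; case: xgetP => [w _ /= hw|/(_ v)//].
exact: bochner_unique hw hv.
Qed.

(** Where the [n]-th pointwise approximation exceeds [N (f x) + 1] in norm it is
    replaced by [0]; the errors then have an integrable majorant and dominated
    convergence applies. *)
Lemma integrable_approx f : bochner_integrable D f -> exists g, approximates D f g.
Proof.
move=> [mf f_int]; have /strongly_measurableP[g gs gf] := mf.
have mN := measurable_rnorm s mf.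
pose E n := D `&` [set x | N (g n x) <= N (f x) + 1].
have mE n : meas (E n).
  have mgN : measurable_fun (D : set (measurableTypeR R)) (fun x => N (g n x)).
    exact: (measurable_rnorm s (simple_strongly_measurable D (gs n))).
  have mf1 : measurable_fun (D : set (measurableTypeR R)) (fun x => N (f x) + 1).
    by apply: measurable_funD.
  have := measurable_fun_ler mgN mf1 mD (Y := [set true]) I.
  by congr (measurable _).
pose h n x := if x \in E n then g n x else 0.
have hs n : is_simple (h n) by apply: is_simple_if => //; exact: is_simple_cst.
have hf x : D x -> h n x @[n --> \oo] --> f x.
  move=> Dx; have /(rcvgP s) gfx := gf x Dx.
  apply/(rcvgP s) => e e0; have := gfx _ e0; have := gfx 1 ltr01.
  apply: filterS2 => n h1 h2; rewrite /h mem_set//; split=> //=.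
  by have := ler_rnorm_dist s (g n x) (f x); move: h1; lra.
have hle n x : D x -> N (f x - h n x) <= 2 * N (f x) + 1.
  move=> Dx; rewrite /h; case: ifPn => [/set_mem[_ /= h1]|_].
    by have := ler_rnormB s (f x) (g n x); lra.
  by rewrite subr0; have := rnorm_ge0 s (f x); lra.
have mfh n : strongly_measurable D (fun x => f x - h n x).
  by apply: strongly_measurableB => //; exact: simple_strongly_measurable.
exists h; split=> //.
have dom_int : mu.-integrable D (fun x => (2 * N (f x) + 1)%:E).
  apply/integrableP; split.
    apply/measurable_EFinP; apply: measurable_funD => //.
    by apply: measurable_funM.
  apply: (@le_lt_trans _ _ (\int[mu]_(x in D) (2%:E * (N (f x))%:E + 1%:E))%E).
    apply: ge0_le_integral => //.
    - by apply: measurableT_comp => //; apply/measurable_EFinP; apply: measurable_funD => //; apply: measurable_funM.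
    - by apply: emeasurable_funD => //; apply: emeasurable_funM => //; exact: measurable_Ernorm.
    - move=> x _; rewrite gee0_abs ?lee_fin ?EFinD ?EFinM//.
      by have := rnorm_ge0 s (f x); lra.
  rewrite ge0_integralD//; first last.
  - by apply: emeasurable_funM => //; exact: measurable_Ernorm.
  - by move=> x _; rewrite mule_ge0// lee_fin// rnorm_ge0.
  rewrite ge0_integralZl//; first last.
  - by move=> x _; rewrite lee_fin rnorm_ge0.
  - exact: measurable_Ernorm.
  rewrite integral_cst// mul1e lte_add_pinfty// lte_mul_pinfty//.
have to0 : {ae mu, forall x, D x ->
    (fun n => (N (f x - h n x))%:E) @ \oo --> 0%E}.
  apply: aeW => x Dx; have /(rcvg0P s) := hf x Dx => h1.
  apply: cvg_EFin; first exact: nearW.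
  by under eq_fun do rewrite /= rnormB.
have dom : {ae mu, forall x n, D x -> (`|(N (f x - h n x))%:E| <= (2 * N (f x) + 1)%:E)%E}.
  apply: aeW => x n Dx; rewrite gee0_abs ?lee_fin ?rnorm_ge0//; exact: hle.
have [_ _] := @dominated_convergence _ _ _ mu D mD
  (fun n x => (N (f x - h n x))%:E) (fun=> 0%E) (fun x => (2 * N (f x) + 1)%:E)
  (fun n => measurable_Ernorm (mfh n)) (measurable_cst _) to0 dom_int dom.
by rewrite integral0.
Qed.

Lemma bochner_integralP f : bochner_integrable D f ->
  is_bochner_integral s D f (bochner_integral s D f).
Proof.
move=> fi; have [g gf] := integrable_approx fi; have [mf _] := fi.
have [v gv] := approximates_cvg mf gf.
have hv : is_bochner_integral s D f v by apply/is_bochner_integralP; split=> //; exists g.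
by rewrite (bochner_integral_eq hv).
Qed.

End Space.
End Domain.
End BochnerIntegral.

(** * Properties of the Bochner integral *)

Section Translation.
Context (R : realType).
Local Notation mu := (@lebesgue_measure R).
Local Notation meas D := (measurable (D : set (measurableTypeR R))).

Lemma measurable_translation (c : R) :
  measurable_fun (setT : set (measurableTypeR R)) (fun x : R => x - c : measurableTypeR R).
Proof. by apply: measurable_funB. Qed.

Lemma measurable_translate (c : R) (A : set R) :
  meas A -> meas ((fun x => x - c) @^-1` A).
Proof. by move=> mA; rewrite -[_ @^-1` _]setTI; apply: measurable_translation. Qed.

Lemma lebesgue_measure_translate (c : R) (A : set R) :
  meas A -> mu ((fun x => x - c) @^-1` A) = mu A.
Proof.
move=> mA.
pose S : {mfun measurableTypeR R >-> measurableTypeR R} :=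
  HB.pack (fun x : R => x - c) (isMeasurableFun.Build _ _ _ _ _ (measurable_translation c)).
rewrite [RHS](@lebesgue_measure_unique R (pushforward mu S))// => _ [[a b] _ <-] /=.
rewrite /pushforward (_ : S @^-1` _ = `](a + c), (b + c)]%classic).
  rewrite !lebesgue_measure_itv /= !lte_fin ltrD2r.
  by case: ifP => // _; rewrite -!EFinB opprD addrACA subrr addr0.
by apply/seteqP; split=> x; rewrite /= !in_itv /= ltrBrDr lerBlDr.
Qed.

Lemma ge0_integral_translate (c : R) (D : set R) (f : measurableTypeR R -> \bar R) :
  meas D -> measurable_fun (D : set (measurableTypeR R)) f ->
  (forall x, 0 <= f x)%E ->
  (\int[mu]_(x in (fun x => (x - c)%R) @^-1` D) f (x - c)%R = \int[mu]_(x in D) f x)%E.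
Proof.
move=> mD mf f0.
pose S : {mfun measurableTypeR R >-> measurableTypeR R} :=
  HB.pack (fun x : R => x - c) (isMeasurableFun.Build _ _ _ _ _ (measurable_translation c)).
have := @ge0_integral_pushforward _ _ _ _ _ S (measurable_translation c) mu D f mD mf (fun x _ => f0 x).
move=> <-; apply: eq_measure_integral => A mA _ /=.
exact: lebesgue_measure_translate.
Qed.

End Translation.

Section BochnerProperties.
Context (R : realType) (K : numFieldType) (s : scalars R K).
Local Notation mu := (@lebesgue_measure R).
Local Notation N := (rnorm s).
Local Notation meas D := (measurable (D : set (measurableTypeR R))).
Local Notation BI D f := (bochner_integrable s D f).
Local Notation I D f := (bochner_integral s D f).

Lemma ae_imply (P Q : R -> Prop) : (forall x, P x -> Q x) ->
  {ae mu, forall x, P x} -> {ae mu, forall x, Q x}.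
Proof.
move=> PQ [A [mA A0 h]]; exists A; split=> // x /= nQ; apply: h => /= Px.
exact/nQ/PQ.
Qed.

Lemma eq_bochner_integrable (V : completeNormedModType K) (D : set R) (f g : R -> V) :
  (forall x, D x -> f x = g x) -> BI D f -> BI D g.
Proof.
move=> fg [mf f_int]; split; first exact: eq_strongly_measurable mf.
suff -> : (\int[mu]_(x in D) (N (g x))%:E = \int[mu]_(x in D) (N (f x))%:E)%E by [].
by apply: eq_integral => x /set_mem Dx; rewrite fg.
Qed.

Lemma eq_bochner_integral (V : completeNormedModType K) (D : set R) (f g : R -> V) :
  (forall x, D x -> f x = g x) -> I D f = I D g.
Proof.
move=> fg; rewrite /bochner_integral; congr xget.
suff h (f1 f2 : R -> V) v : (forall x, D x -> f1 x = f2 x) ->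
    is_bochner_integral s D f1 v -> is_bochner_integral s D f2 v.
  by apply/seteqP; split=> v /=; apply: h => // x Dx; rewrite fg.
move=> f12 [mf [g' [gs gf gv]]]; split; first exact: eq_strongly_measurable mf.
exists g'; split=> //; rewrite (_ : (fun n => _) = (fun n =>
  (\int[mu]_(x in D) (N (f1 x - g' n x))%:E)%E))//.
by apply/funext => n; apply: eq_integral => x /set_mem Dx; rewrite f12.
Qed.

Section Domain.
Variables (D : set R).
Hypotheses (mD : meas D) (fD : (mu D < +oo)%E).

Lemma bochner_integrable_bounded (V : completeNormedModType K) (f : R -> V) (C : R) :
  strongly_measurable D f -> {ae mu, forall x, D x -> N (f x) <= C} -> BI D f.
Proof.
move=> mf fC; split=> //.
apply: (@le_lt_trans _ _ (\int[mu]_(x in D) (cst `|C|%:E x))%E).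
  apply: ae_ge0_le_integral => //.
  - by move=> x _; rewrite lee_fin rnorm_ge0.
  - exact: measurable_Ernorm.
  - by move=> x _; rewrite lee_fin.
  - by apply: ae_imply fC => x h Dx; rewrite lee_fin (le_trans (h Dx))// ler_norm.
by rewrite integral_cst// lte_mul_pinfty// lee_fin.
Qed.

Lemma bochner_integrable_dom (V W : completeNormedModType K) (f : R -> V) (g : R -> W)
    (M : R) : 0 <= M -> strongly_measurable D g ->
  (forall x, D x -> N (g x) <= M * N (f x)) -> BI D f -> BI D g.
Proof.
move=> M0 mg gM [mf f_int]; split=> //.
apply: (le_lt_trans (le_int_rnormZ mD M0 mf mg (aeW _ _))) => //.
by rewrite lte_mul_pinfty// ge0_fin_numE// int_rnorm_ge0.
Qed.

Lemma bochner_integral_norm (V : completeNormedModType K) (f : R -> V) : BI D f ->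
  ((N (I D f))%:E <= \int[mu]_(x in D) (N (f x))%:E)%E.
Proof.
move=> fi; have [g gf] := integrable_approx mD fD fi.
have := approximates_lim mD fD (bochner_integralP mD fD fi) gf.
case: fi gf => mf f_int [gs /(ecvg0P (fun n => int_rnorm_ge0 s D (fun x => f x - g n x))) gf].
move=> /(rcvgP s) gv; apply/lee_addgt0Pr => e e0.
have e20 : 0 < e / 2 by lra.
have [n1 _ h1] := gv _ e20; have [n2 h2] := gf _ e20.
pose n := maxn n1 n2; have := h1 n (leq_maxl _ _); have := h2 n (leq_maxr _ _).
move=> {}h2 /= {}h1.
have h3 : ((N (sint s D (g n)))%:E <=
    \int[mu]_(x in D) (N (f x))%:E + \int[mu]_(x in D) (N (f x - g n x))%:E)%E.
  apply: le_trans (sint_norm s mD fD (gs n)) _; apply: le_int_rnormD => //.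
  - by apply: strongly_measurableB => //; exact: simple_strongly_measurable.
  - exact: simple_strongly_measurable.
  - by move=> x _; rewrite (rnormB s (f x)) ler_rnorm_dist.
have h4 := ler_rnorm_dist s (I D f) (sint s D (g n)); rewrite rnormB in h4.
apply: (@le_trans _ _ (N (sint s D (g n)) + e / 2)%:E); first by rewrite lee_fin; lra.
rewrite EFinD (_ : e%:E = ((e / 2)%:E + (e / 2)%:E)%E); last by rewrite -EFinD; congr EFin; field.
rewrite addeA leeD2r//; apply: le_trans h3 _; rewrite leeD2l//; exact: ltW.
Qed.

Lemma bochner_integral_bound (V : completeNormedModType K) (f : R -> V) (C : R) :
  0 <= C -> BI D f -> {ae mu, forall x, D x -> N (f x) <= C} ->
  N (I D f) <= C * fine (mu D).
Proof.
move=> C0 fi fC; rewrite -lee_fin; apply: le_trans (bochner_integral_norm fi) _.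
rewrite EFinM fineK; last by rewrite ge0_fin_numE.
rewrite -integral_cst//; apply: ae_ge0_le_integral => //.
- by move=> x _; rewrite lee_fin rnorm_ge0.
- by case: fi => mf _; exact: measurable_Ernorm.
Qed.

Lemma bochner_integrable_op (V W : completeNormedModType K) (L : {linear V -> W})
    (f : R -> V) : continuous L -> BI D f -> BI D (fun x => L (f x)).
Proof.
move=> Lc fi; have [M M0 LM] := continuous_bounded s Lc.
apply: (bochner_integrable_dom (ltW M0) _ _ fi) => //.
by apply: strongly_measurable_comp => //; case: fi.
Qed.

Lemma bochner_integral_op (V W : completeNormedModType K) (L : {linear V -> W})
    (f : R -> V) : continuous L -> BI D f -> I D (fun x => L (f x)) = L (I D f).
Proof.
move=> Lc fi; have [M M0 LM] := continuous_bounded s Lc.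
have [g gf] := integrable_approx mD fD fi.
have gv := approximates_lim mD fD (bochner_integralP mD fD fi) gf.
have [mf f_int] := fi; have [gs gf0] := gf.
have mfg n : strongly_measurable D (fun x => f x - g n x).
  by apply: strongly_measurableB => //; exact: simple_strongly_measurable.
apply: bochner_integral_eq => //; apply/is_bochner_integralP; split.
  exact: strongly_measurable_comp.
exists (fun n => L \o g n).
  split=> [n|]; first exact: is_simple_comp.
  apply: (@ecvg0_le _ _ (fun n => M%:E * \int[mu]_(x in D) (N (f x - g n x))%:E)%E).
  - by move=> n; exact: int_rnorm_ge0.
  - move=> n; apply: le_int_rnormZ => //; first exact: ltW.
      apply: strongly_measurableB; first exact: strongly_measurable_comp.
      by apply: simple_strongly_measurable; exact: is_simple_comp.
    by apply: aeW => x _ /=; rewrite -linearB.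
  - by rewrite -(mule0 M%:E); apply: cvgeZl.
under eq_fun do rewrite sint_op//.
by apply: (@cvg_comp _ _ _ _ L _ _ _ gv); exact: Lc.
Qed.

Lemma bochner_integrableD (V : completeNormedModType K) (f g : R -> V) :
  BI D f -> BI D g -> BI D (fun x => f x + g x).
Proof.
move=> [mf f_int] [mg g_int].
have mfg : strongly_measurable D (fun x => f x + g x) by exact: strongly_measurableD.
split=> //; apply: le_lt_trans (lte_add_pinfty f_int g_int).
by apply: le_int_rnormD => // x _; exact: ler_rnormD.
Qed.

Lemma bochner_integralD (V : completeNormedModType K) (f g : R -> V) :
  BI D f -> BI D g -> I D (fun x => f x + g x) = I D f + I D g.
Proof.
move=> fi gi; have [h hf] := integrable_approx mD fD fi.
have [k kg] := integrable_approx mD fD gi.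
have hv := approximates_lim mD fD (bochner_integralP mD fD fi) hf.
have kv := approximates_lim mD fD (bochner_integralP mD fD gi) kg.
have [mf f_int] := fi; have [mg g_int] := gi.
have [hs hf0] := hf; have [ks kg0] := kg.
have mD' (f1 : R -> V) (h1 : nat -> R -> V) n : strongly_measurable D f1 ->
    (forall n, is_simple (h1 n)) -> strongly_measurable D (fun x => f1 x - h1 n x).
  by move=> ? ?; apply: strongly_measurableB => //; exact: simple_strongly_measurable.
have hks n : is_simple (fun x => h n x + k n x).
  exact: (is_simple_comp2 (fun v w : V => v + w)).
apply: bochner_integral_eq => //; apply/is_bochner_integralP; split.
  exact: strongly_measurableD.
exists (fun n x => h n x + k n x).
  split=> //.
  apply: (@ecvg0_le _ _ (fun n => \int[mu]_(x in D) (N (f x - h n x))%:E +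
    \int[mu]_(x in D) (N (g x - k n x))%:E)%E).
  - by move=> n; exact: int_rnorm_ge0.
  - move=> n; apply: le_int_rnormD => //; try exact: mD'.
      by apply: (mD' _ (fun n x => h n x + k n x)) => //; exact: strongly_measurableD.
    by move=> x _; rewrite opprD addrACA ler_rnormD.
  - by rewrite -(adde0 0%E); apply: cvgeD.
under eq_fun do rewrite sintD//.
exact: cvgD.
Qed.

(** The values of the approximating simple functions are moved to almost nearest
    points of the cone. As [f] takes its values in the cone, this multiplies the
    error by [3] at most, and the integrals become sums of elements of [C]. *)
Lemma bochner_integral_cone (V : completeNormedModType K) (C : set V) (f : R -> V) :
  closed C -> C 0 -> (forall x y, C x -> C y -> C (x + y)) ->
  (forall (r : R) x, 0 <= r -> C x -> C (of_real s r *: x)) ->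
  BI D f -> {ae mu, forall x, D x -> C (f x)} -> C (I D f).
Proof.
move=> Cc C0 CD CZ fi fC.
have [pi piP] : exists pi : V -> V, forall q, C (pi q) /\
    forall y, C y -> N (pi q - q) <= 2 * N (y - q).
  suff /choice[pi piP] : forall q : V, exists c, C c /\
    forall y, C y -> N (c - q) <= 2 * N (y - q) by exists pi.
  move=> q; have [Cq|nCq] := pselect (C q).
    by exists q; split=> // y Cy; rewrite subrr rnorm0 mulr_ge0// rnorm_ge0.
  have /(rnbhsP s)[e e0 he] : nbhs q (~` C).
    by apply: open_nbhs_nbhs; split=> //; exact: closed_openC.
  pose S := [set N (y - q) | y in C].
  have hS : has_inf S.
    split; first by exists (N (0 - q)), 0.
    by exists 0 => _ [y _ <-]; exact: rnorm_ge0.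
  have eS : e <= inf S.
    apply: lb_le_inf => [|_ [y Cy <-]]; first by case: hS.
    by rewrite leNgt; apply/negP => /he.
  have [_ [c Cc1 <-] hc] := inf_adherent e0 hS.
  exists c; split=> // y Cy; have : inf S <= N (y - q).
    by apply: ge_inf; [case: hS|exists y].
  by lra.
have [g gf] := integrable_approx mD fD fi; have [gs gf0] := gf; have [mf f_int] := fi.
have pgs n : is_simple (pi \o g n) by exact: is_simple_comp.
have mfg (h : R -> V) : is_simple h -> strongly_measurable D (fun x => f x - h x).
  by move=> hs; apply: strongly_measurableB => //; exact: simple_strongly_measurable.
have pgf : approximates s D f (fun n => pi \o g n).
  split=> //.
  apply: (@ecvg0_le _ _ (fun n => 3%:E * \int[mu]_(x in D) (N (f x - g n x))%:E)%E).
  - by move=> n; exact: int_rnorm_ge0.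
  - move=> n; apply: le_int_rnormZ => //; try exact: mfg.
    apply: ae_imply fC => x Cfx Dx /=.
    have := proj2 (piP (g n x)) _ (Cfx Dx).
    have := ler_rnormtri s (f x) (g n x) (pi (g n x)).
    by rewrite (rnormB s (g n x)); lra.
  - by rewrite -(mule0 3%:E); apply: cvgeZl.
have pgv := approximates_lim mD fD (bochner_integralP mD fD fi) pgf.
apply: (@closed_cvg _ _ \oo _ _ C Cc _ _ pgv); apply: nearW => n /=.
rewrite /sint fsbig_finite//; last by case: (pgs n).
rewrite big_seq; elim/big_ind : _ => // v.
rewrite in_fset_set; last by case: (pgs n).
move=> /set_mem[x _ <-]; apply: CZ; first exact: fine_ge0.
by case: (piP (g n x)).
Qed.

End Domain.

Lemma bochner_integrable_sub (V : completeNormedModType K) (D E : set R) (f : R -> V) :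
  meas D -> meas E -> E `<=` D -> BI D f -> BI E f.
Proof.
move=> mD mE ED [mf f_int]; split; first exact: strongly_measurable_sub mf.
apply: le_lt_trans f_int; apply: ge0_subset_integral => //.
  exact: measurable_Ernorm.
by move=> x _; rewrite lee_fin rnorm_ge0.
Qed.

Lemma bochner_integralU (V : completeNormedModType K) (D E : set R) (f : R -> V) :
  meas D -> meas E -> (mu D < +oo)%E -> (mu E < +oo)%E -> D `&` E = set0 ->
  BI (D `|` E) f -> I (D `|` E) f = I D f + I E f.
Proof.
move=> mD mE fD fE DE fi.
have mDE : meas (D `|` E) by exact: measurableU.
have fDE : (mu (D `|` E) < +oo)%E.
  by rewrite measureU//; exact: lte_add_pinfty.
have [g gf] := integrable_approx mDE fDE fi; have [gs gf0] := gf; have [mf _] := fi.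
have sub (A : set R) : meas A -> A `<=` D `|` E -> approximates s A f g.
  move=> mA AD; split=> //; apply: ecvg0_le gf0.
    by move=> n; exact: int_rnorm_ge0.
  move=> n; apply: ge0_subset_integral => //.
    apply: measurable_Ernorm; apply: strongly_measurableB => //.
    exact: simple_strongly_measurable.
  by move=> x _; rewrite lee_fin rnorm_ge0.
have DU : D `<=` D `|` E by left.
have EU : E `<=` D `|` E by right.
have fiD := bochner_integrable_sub mDE mD DU fi.
have fiE := bochner_integrable_sub mDE mE EU fi.
have h1 := approximates_lim mDE fDE (bochner_integralP mDE fDE fi) gf.
have h2 := approximates_lim mD fD (bochner_integralP mD fD fiD) (sub _ mD DU).
have h3 := approximates_lim mE fE (bochner_integralP mE fE fiE) (sub _ mE EU).
have e : (fun n => sint s (D `|` E) (g n)) = (fun n => sint s D (g n) + sint s E (g n)).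
  by apply/funext => n; rewrite sintU.
rewrite e in h1; exact: (cvg_unique _ h1 (cvgD h2 h3)).
Qed.

Section Shift.
Variables (V : completeNormedModType K) (D : set R) (f : R -> V) (c : R).
Hypotheses (mD : meas D) (fD : (mu D < +oo)%E).
Let D' := (fun x => x - c) @^-1` D.

Let is_simple_shift (g : R -> V) : is_simple g -> is_simple (fun x => g (x - c)).
Proof.
move=> [gf gm]; split=> [|v]; last exact: (measurable_translate c (gm v)).
by apply: sub_finite_set gf => _ [x _ <-]; exists (x - c).
Qed.

Lemma strongly_measurable_shift :
  strongly_measurable D f -> strongly_measurable D' (fun x => f (x - c)).
Proof.
move=> /strongly_measurableP[g gs gf]; apply/strongly_measurableP.
by exists (fun n x => g n (x - c)) => [n|x Dx]; [exact: is_simple_shift|exact: gf].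
Qed.

Lemma bochner_integral_shift : BI D f -> I D' (fun x => f (x - c)) = I D f.
Proof.
move=> fi; have [g gf] := integrable_approx mD fD fi; have [gs gf0] := gf.
have [mf _] := fi; have mD' : meas D' by exact: measurable_translate.
have fD' : (mu D' < +oo)%E by rewrite lebesgue_measure_translate.
apply: bochner_integral_eq => //; apply/is_bochner_integralP; split.
  exact: strongly_measurable_shift.
exists (fun n x => g n (x - c)).
  split=> [n|]; first exact: is_simple_shift.
  under eq_fun => n.
    rewrite (ge0_integral_translate c (f := fun x => (N (f x - g n x))%:E))//; first over.
    - apply: measurable_Ernorm; apply: strongly_measurableB => //.
      exact: simple_strongly_measurable.
    - by move=> x; rewrite lee_fin rnorm_ge0.
  exact: gf0.
rewrite (_ : (fun n => _) = (fun n => sint s D (g n))).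
  exact: approximates_lim (bochner_integralP mD fD fi) gf.
apply/funext => n; rewrite /sint.
have -> : range (fun x => g n (x - c)) = range (g n).
  apply/seteqP; split=> _ [x _ <-]; first by exists (x - c).
  by exists (x + c) => //; rewrite addrK.
apply: eq_fsbigr => v _; congr (of_real s (fine _) *: v).
rewrite -[RHS](lebesgue_measure_translate c)//.
by apply: measurableI => //; case: (gs n).
Qed.

End Shift.
End BochnerProperties.

(** * Lebesgue spaces of vector-valued functions *)

Section Lebesgue.
Context (R : realType) (K : numFieldType) (s : scalars R K).
Local Notation mu := (@lebesgue_measure R).
Local Notation N := (rnorm s).
Local Notation meas D := (measurable (D : set (measurableTypeR R))).
Local Notation BI D f := (bochner_integrable s D f).
Context (V : completeNormedModType K).
Implicit Types (D : set R) (f g : R -> V).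

Lemma Lp_finP (r : R) D f : 1 <= r -> Lp s r%:E D f <->
  strongly_measurable D f /\ (\int[mu]_(x in D) ((N (f x)) `^ r)%:E < +oo)%E.
Proof.
move=> r1; have r0 : r != 0 by rewrite gt_eqF// (lt_le_trans ltr01).
have e : (\int[mu]_x `|((fun x => (N (f x))%:E) \_ D) x| `^ r =
    \int[mu]_(x in D) ((N (f x)) `^ r)%:E)%E.
  rewrite [RHS]integral_mkcond; apply: eq_integral => x _.
  rewrite /patch; case: ifP => _; last by rewrite abse0 poweR0r.
  by rewrite gee0_abs ?lee_fin ?rnorm_ge0.
split=> -[mf]; split=> //.
  by rewrite -e -poweR_Lnorm//; exact: poweR_lty.
by rewrite unlock e; exact: poweR_lty.
Qed.

Lemma lebesgue_measure_setT_gt0 : (0 < mu [set: R])%E.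
Proof.
apply: (@lt_le_trans _ _ (mu `[0, 1]%classic)).
  by rewrite lebesgue_measure_itv /= lte_fin ltr01 -EFinB subr0 lte_fin.
by apply: le_measure => //; apply/mem_set.
Qed.

Lemma Lp_infP D f : Lp s +oo%E D f <->
  strongly_measurable D f /\ exists C : R, {ae mu, forall x, D x -> N (f x) <= C}.
Proof.
rewrite /Lp /= unlock lebesgue_measure_setT_gt0.
have h x : D x -> (`|((fun x => (N (f x))%:E) \_ D) x| = (N (f x))%:E)%E.
  by move=> Dx; rewrite patchE mem_set// gee0_abs// lee_fin rnorm_ge0.
split=> -[mf].
  move=> ess_fin; split=> //.
  set y := ess_sup _ _ in ess_fin.
  have ae_y := ess_sup_ge mu (abse \o ((fun x => (N (f x))%:E) \_ D)).
  exists (fine y); apply: ae_imply ae_y => x /= + Dx; rewrite h// -/y.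
  have y0 : ~~ (y == -oo%E) \/ y = -oo%E by case: eqP; [right|left].
  by move: y ess_fin {y0} => [y| |] //=; rewrite ?lee_fin// leNgt ltNye.
move=> [C fC]; split=> //.
apply: (@le_lt_trans _ _ (Num.max C 0)%:E); last exact: ltry.
apply/ess_supP; apply: ae_imply fC => x fC /=.
have [Dx|nDx] := pselect (D x); first by rewrite h// lee_fin le_max fC.
by rewrite patchE memNset//= normr0 lee_fin le_max lexx orbT.
Qed.

Lemma p_cases (p : \bar R) : (1 <= p)%E -> p = +oo%E \/ exists2 r, p = r%:E & 1 <= r.
Proof.
by case: p => [r| |] //; [rewrite lee_fin => r1; right; exists r|left].
Qed.

Lemma measurable_rnorm_pow D f (r : R) : strongly_measurable D f ->
  measurable_fun (D : set (measurableTypeR R)) (fun x => ((N (f x)) `^ r)%:E).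
Proof.
move=> mf; apply/measurable_EFinP.
apply: (@measurableT_comp _ _ _ _ _ _ (fun y : R => y `^ r)) => //.
exact: (measurable_rnorm s mf).
Qed.

Section Exponent.
Variable p : \bar R.
Hypothesis p1 : (1 <= p)%E.

Lemma Lp_integrable D f : meas D -> (mu D < +oo)%E -> Lp s p D f -> BI D f.
Proof.
move=> mD fD; case: (p_cases p1) => [->|[r -> r1]].
  by move=> /Lp_infP[mf [C fC]]; exact: bochner_integrable_bounded fC.
move=> /(Lp_finP _ _ r1)[mf f_int]; split=> //.
have mfr := measurable_rnorm_pow r mf.
apply: (@le_lt_trans _ _ (\int[mu]_(x in D) (1 + (N (f x) `^ r)%:E))%E).
  apply: ge0_le_integral => //.
  - by move=> x _; rewrite lee_fin rnorm_ge0.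
  - exact: measurable_Ernorm.
  - exact: emeasurable_funD.
  - move=> x _; rewrite -EFinD lee_fin.
    have [x1|x1] := leP (N (f x)) 1; first by have := powR_ge0 (N (f x)) r; lra.
    by have := le1r_powR (ltW x1) r1; lra.
rewrite ge0_integralD//; last by move=> x _; rewrite lee_fin powR_ge0.
by rewrite integral_cst// mul1e lte_add_pinfty.
Qed.

Lemma Lp_sub D D' f : meas D -> meas D' -> D' `<=` D -> Lp s p D f -> Lp s p D' f.
Proof.
move=> mD mD' DD'; case: (p_cases p1) => [->|[r -> r1]].
  move=> /Lp_infP[mf [C fC]]; apply/Lp_infP; split.
    exact: strongly_measurable_sub mf.
  by exists C; apply: ae_imply fC => x h /DD'.
move=> /(Lp_finP _ _ r1)[mf f_int]; apply/Lp_finP => //; split.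
  exact: strongly_measurable_sub mf.
apply: le_lt_trans f_int; apply: ge0_subset_integral => //.
  exact: measurable_rnorm_pow.
by move=> x _; rewrite lee_fin powR_ge0.
Qed.

Lemma Lp_bounded D f (C : R) : meas D -> (mu D < +oo)%E -> strongly_measurable D f ->
  (forall x, D x -> N (f x) <= C) -> Lp s p D f.
Proof.
move=> mD fD mf fC; case: (p_cases p1) => [->|[r -> r1]].
  by apply/Lp_infP; split=> //; exists C; apply: aeW.
apply/Lp_finP => //; split=> //.
apply: (@le_lt_trans _ _ (\int[mu]_(x in D) (cst (`|C| `^ r)%:E x))%E).
  apply: ge0_le_integral => //.
  - by move=> x _; rewrite lee_fin powR_ge0.
  - exact: measurable_rnorm_pow.
  - move=> x Dx; rewrite lee_fin ge0_ler_powR ?nnegrE ?rnorm_ge0//.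
      exact: le_trans r1.
    by rewrite (le_trans (fC x Dx))// ler_norm.
by rewrite integral_cst// lte_mul_pinfty// lee_fin powR_ge0.
Qed.

Lemma Lp_shift D f (c : R) : meas D -> Lp s p D f ->
  Lp s p ((fun x => x - c) @^-1` D) (fun x => f (x - c)).
Proof.
move=> mD; case: (p_cases p1) => [->|[r -> r1]].
  move=> /Lp_infP[mf [C [A [mA A0 h]]]]; apply/Lp_infP; split.
    exact: strongly_measurable_shift.
  exists C, ((fun x => x - c) @^-1` A); split=> //.
  - exact: measurable_translate.
  - by rewrite lebesgue_measure_translate.
  - by move=> x /= nx; apply: h.
move=> /(Lp_finP _ _ r1)[mf f_int]; apply/Lp_finP => //; split.
  exact: strongly_measurable_shift.
rewrite (ge0_integral_translate c (f := fun x => ((N (f x)) `^ r)%:E))//.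
- exact: measurable_rnorm_pow.
- by move=> x; rewrite lee_fin powR_ge0.
Qed.

Lemma eq_Lp D f g : (forall x, D x -> f x = g x) -> Lp s p D f -> Lp s p D g.
Proof.
move=> fg [mf f_int]; split; first exact: eq_strongly_measurable mf.
suff <- : (fun x => (N (f x))%:E) \_ D = (fun x => (N (g x))%:E) \_ D by [].
by apply/funext => x; rewrite !patchE; case: ifPn => // /set_mem /fg ->.
Qed.

Lemma Lp_ext D E f : meas D -> E `<=` D -> meas E ->
  (forall x, D x -> ~ E x -> f x = 0) -> Lp s p E f -> Lp s p D f.
Proof.
move=> mD ED mE f0 [mf f_int]; split.
  have /strongly_measurableP[g gs gf] := mf; apply/strongly_measurableP.
  exists (fun n x => if x \in E then g n x else 0).
    by move=> n; apply: is_simple_if => //; exact: is_simple_cst.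
  move=> x Dx; have [Ex|nEx] := pselect (E x).
    by under eq_fun do rewrite mem_set//; exact: gf.
  by rewrite f0//; under eq_fun do rewrite memNset//; exact: cvg_cst.
suff -> : (fun x => (N (f x))%:E) \_ D = (fun x => (N (f x))%:E) \_ E by [].
apply/funext => x; rewrite !patchE; have [Ex|nEx] := pselect (E x).
  by rewrite !mem_set//; exact: ED.
by rewrite (memNset nEx); case: ifPn => // /set_mem Dx; rewrite f0// rnorm0.
Qed.

End Exponent.
End Lebesgue.

(** * Cones of Banach lattices are closed *)

Section Closure.
Context (R : realType) (K : numFieldType) (s : scalars R K).
Context (V : completeNormedModType K).
Local Notation N := (rnorm s).

Lemma rclosureP (A : set V) x :
  closure A x <-> forall e : R, 0 < e -> exists2 y, A y & N (y - x) < e.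
Proof.
split=> [cx e e0|h B /(rnbhsP s)[e e0 eB]].
  have [|y [Ay /= yx]] := cx [set y | N (y - x) < e]; last by exists y.
  by apply/(rnbhsP s); exists e.
by have [y Ay yx] := h e e0; exists y; split=> //; exact: eB.
Qed.

Lemma rclosed (A : set V) :
  (forall x, (forall e : R, 0 < e -> exists2 y, A y & N (y - x) < e) -> A x) ->
  closed A.
Proof. by move=> h x /rclosureP; exact: h. Qed.

Lemma rnorm_small (x : V) : (forall e : R, 0 < e -> N x < e) -> x = 0.
Proof.
move=> h; apply/eqP; rewrite -(rnorm_eq0 s) eq_le rnorm_ge0 andbT leNgt.
by apply/negP => /h; rewrite ltxx.
Qed.

Section Cone.
Variable (Vp : set V).
Hypothesis hV : normed_lattice_cone s Vp.

Lemma cone_half x : Vp (x + x) -> Vp x.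
Proof.
move=> /(coneZ hV (r := 2^-1)); rewrite invr_ge0 ler0n => /(_ isT).
rewrite scalerDr -scalerDl -of_realD (_ : 2^-1 + 2^-1 = 1) ?of_real1 ?scale1r//.
by field.
Qed.

Lemma cone_spanP x : Vp x -> cone_span Vp x.
Proof. by move=> px; exists x, 0; split; rewrite ?subr0//; exact: cone0 hV. Qed.

Lemma cone_spanB x y : cone_span Vp x -> cone_span Vp y -> cone_span Vp (x - y).
Proof.
move=> [a [b [pa pb ->]]] [c [d [pc pd ->]]]; exists (a + d), (b + c).
by split; [exact: coneD hV _ _ pa pd|exact: coneD hV _ _ pb pc|
  rewrite opprB addrACA opprD].
Qed.

Lemma cone_spanN x : cone_span Vp x -> cone_span Vp (- x).
Proof. by move=> [a [b [pa pb ->]]]; exists b, a; rewrite opprB. Qed.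

Lemma cone_lub_pos m : Vp m -> cone_lub Vp [set m; - m] m.
Proof.
move=> pm; split=> [x [->|->]|b h]; last by apply: h; left.
  by rewrite /cone_le subrr; exact: cone0 hV.
by rewrite /cone_le opprK; apply: (coneD hV).
Qed.

(** The element [m] dominates the modulus of [x] and is its own modulus. *)
Lemma cone_norm_le x m : cone_span Vp x -> Vp (m - x) -> Vp (m + x) -> N x <= N m.
Proof.
move=> sx h1 h2.
have pm : Vp m.
  by apply: cone_half; have := coneD hV h1 h2; rewrite addrACA addNr addr0.
have [a ha] := cone_sup hV sx (cone_spanN sx).
rewrite -(le_of_real s) -!normE.
apply: (cone_norm hV sx (cone_spanP pm) ha (cone_lub_pos pm)).
by apply: (proj2 ha) => y [->|->] //; rewrite /cone_le opprK.
Qed.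

(** The negative part [m] of [x] satisfies [0 <= m <= |y - x|] for every [y] in
    the cone, hence has arbitrarily small norm. *)
Lemma cone_closed_in_span x : cone_span Vp x ->
  (forall e : R, 0 < e -> exists2 y, Vp y & N (y - x) < e) -> Vp x.
Proof.
move=> sx h; have s0 := cone_spanP (cone0 hV).
have [m [hm1 hm2]] := cone_sup hV (cone_spanN sx) s0.
have p0 : Vp m by rewrite -(subr0 m); apply: hm1; right.
have p1 : Vp (m + x) by rewrite -[x]opprK; apply: hm1; left.
suff m0 : m = 0 by rewrite m0 add0r in p1.
apply: rnorm_small => e /h[y py yx]; apply: le_lt_trans yx.
have sd := cone_spanB (cone_spanP py) sx.
have [a [ha1 ha2]] := cone_sup hV sd (cone_spanN sd).
have a1 : Vp (a - (y - x)) by apply: ha1; left.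
have a2 : Vp (a + (y - x)) by rewrite -[y - x]opprK; apply: ha1; right.
have pa : Vp a.
  by apply: cone_half; have := coneD hV a1 a2; rewrite addrACA addNr addr0.
rewrite -(le_of_real s) -!normE.
apply: (cone_norm hV (cone_spanP p0) sd (cone_lub_pos p0) (conj ha1 ha2)).
apply: hm2 => z [->|->]; rewrite /cone_le; last by rewrite subr0.
by have := coneD hV a1 py; rewrite opprB -addrA subrK opprK.
Qed.

End Cone.
End Closure.

(** The continuity of [x |-> x^-] is [cone_closed_in_span]. In the complex case
    one has to see first that a limit of elements of the cone is real: the norm
    of a vector dominates those of its real and imaginary parts. *)
Lemma banach_lattice_closed (R : realType) (K : numFieldType) (s : scalars R K)
    (X : completeNormedModType K) (Xp : set X) :
  banach_lattice s Xp -> normed_lattice_cone s Xp /\ closed Xp.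
Proof.
case: s X Xp => X Xp /=.
  move=> [hX sX]; split=> //; apply: (@rclosed _ _ RealScalars) => x.
  exact: (cone_closed_in_span hX).
move=> [hX sX cX]; split=> //; apply: (@rclosed _ _ ComplexScalars) => z hz.
have part u v : cone_span Xp u -> cone_span Xp v ->
    rnorm ComplexScalars u <= rnorm ComplexScalars (u + (0 +i* 1)%C *: v) /\
    rnorm ComplexScalars v <= rnorm ComplexScalars (u + (0 +i* 1)%C *: v).
  move=> su sv; have [m [[hm _] nm]] := cX u v su sv.
  rewrite {2 4}/rnorm nm -/(rnorm ComplexScalars m).
  (* At the angles [0] and [pi] the modulus [m] dominates [u] and [- u]; at
     [pi / 2] and [- pi / 2] it dominates [v] and [- v]. *)
  have h1 := hm _ (ex_intro2 _ _ 0 I erefl).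
  have h2 := hm _ (ex_intro2 _ _ pi I erefl).
  have h3 := hm _ (ex_intro2 _ _ (pi / 2) I erefl).
  have h4 := hm _ (ex_intro2 _ _ (- (pi / 2)) I erefl).
  rewrite /cone_le cos0 sin0 scale1r scale0r addr0 in h1.
  rewrite /cone_le cospi sinpi scale0r addr0 in h2.
  rewrite /cone_le cos_pihalf sin_pihalf scale1r scale0r add0r in h3.
  rewrite /cone_le cosN sinN cos_pihalf sin_pihalf scale0r add0r in h4.
  split; apply: (cone_norm_le hX) => //.
    by move: h2; rewrite rmorphN scaleN1r opprK.
  by move: h4; rewrite rmorphN scaleN1r opprK.
have [a [b [sa sb ze]]] := sX z.
have key y : Xp y -> y - z = (y - a) + (0 +i* 1)%C *: (- b).
  by move=> _; rewrite ze scalerN opprD addrA.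
have b0 : b = 0.
  apply: (@rnorm_small _ _ ComplexScalars) => e /hz[y py]; apply: le_lt_trans.
  have := part _ _ (cone_spanB hX (cone_spanP hX py) sa) (cone_spanN sb).
  by rewrite -key// rnormN => -[].
rewrite ze b0 scaler0 addr0; apply: (cone_closed_in_span hX sa) => e /hz[y py yz].
exists y => //; apply: le_lt_trans yz.
have := part _ _ (cone_spanB hX (cone_spanP hX py) sa) (cone_spanN sb).
by rewrite -key// => -[].
Qed.

(** * Strongly continuous semigroups *)

Section RightLimits.
Context (R : realType) (K : numFieldType) (s : scalars R K).
Context (X : completeNormedModType K).
Local Notation N := (rnorm s).

Lemma near_rightP (P : R -> Prop) :
  (\forall h \near (0 : R)^'+, P h) <->
  exists2 d : R, 0 < d & forall h : R, 0 < h -> h < d -> P h.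
Proof.
split=> [|[d d0 hd]].
  rewrite /at_right /within /= => /nbhs_ballP[d /= d0 hd]; exists d => // h h0 hd'.
  by apply: hd => //; rewrite /ball /= sub0r normrN gtr0_norm.
rewrite /at_right /within /=; apply/nbhs_ballP; exists d => //= h.
rewrite /ball /= sub0r normrN => hd' h0; apply: hd => //.
by rewrite gtr0_norm in hd'.
Qed.

Lemma rcvg_rightP (f : R -> X) (l : X) :
  f h @[h --> 0^'+] --> l <-> forall e : R, 0 < e ->
    exists2 d : R, 0 < d & forall h : R, 0 < h -> h < d -> N (f h - l) < e.
Proof.
rewrite (rcvgP s); split=> h e /h; first by move/near_rightP.
by move=> ?; apply/near_rightP.
Qed.

End RightLimits.

Section Semigroup.
Context (R : realType) (K : numFieldType) (s : scalars R K).
Context (X : completeNormedModType K) (T : R -> {linear X -> X}).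
Local Notation N := (rnorm s).
Hypothesis hT : C0_semigroup T.

Lemma sg_continuous t : 0 <= t -> continuous (T t).
Proof. by case: hT => h _ _ _; exact: h. Qed.

Lemma sg0 x : T 0 x = x.
Proof. by case: hT => _ h _ _; exact: h. Qed.

Lemma sgD t r x : 0 <= t -> 0 <= r -> T (t + r) x = T t (T r x).
Proof. by case: hT => _ _ h _; exact: h. Qed.

Lemma sg_right0 x (e : R) : 0 < e -> exists2 d : R, 0 < d &
  forall h : R, 0 <= h -> h < d -> N (T h x - x) < e.
Proof.
move=> e0; case: hT => _ _ _ /(_ x) /(rcvg_rightP s) /(_ _ e0)[d d0 hd].
exists d => // h; rewrite le_eqVlt => /predU1P[<- _|]; last exact: hd.
by rewrite sg0 subrr rnorm0.
Qed.

(** Uniform boundedness near [0]: otherwise times [h n] tending to [0] would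
    have operators of norm at least [n], although [T (h n) x] converges for
    every [x], so that [x |-> sup_n |T (h n) x|] is a finite seminorm. *)
Lemma sg_bounded0 : exists2 d : R, 0 < d &
  exists2 M : R, 1 <= M & forall (h : R) x, 0 <= h -> h <= d -> N (T h x) <= M * N x.
Proof.
apply: contrapT => hn.
have step (n : nat) : exists hx : R * X,
    [/\ 0 <= hx.1, hx.1 <= n.+1%:R^-1 & n.+1%:R * N hx.2 < N (T hx.1 hx.2)].
  apply: contrapT => h2; apply: hn; exists n.+1%:R^-1; first by rewrite invr_gt0.
  exists n.+1%:R; first by rewrite ler1n.
  move=> h x h0 hle; rewrite leNgt; apply/negP => hx; apply: h2.
  by exists (h, x).
have [hx hxP] := choice step; pose h n := (hx n).1.
have h0 n : 0 <= h n by case: (hxP n).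
have hn0 n : h n <= n.+1%:R^-1 by case: (hxP n).
pose S x := [set N (T (h n) x) | n in [set: nat]].
have hS x : has_sup (S x).
  split; first by exists (N (T (h 0%N) x)), 0%N.
  have [d d0 hd] := sg_right0 x ltr01; pose n0 := Num.truncn d^-1.
  exists (N x + 1 + \sum_(k < n0) N (T (h k) x)) => _ [n _ <-].
  have sum0 : 0 <= \sum_(k < n0) N (T (h k) x).
    by apply: sumr_ge0 => k _; exact: rnorm_ge0.
  have [nn0|nn0] := ltnP n n0.
    have : N (T (h n) x) <= \sum_(k < n0) N (T (h k) x).
      by rewrite (bigD1 (Ordinal nn0))//= lerDl sumr_ge0// => k _; exact: rnorm_ge0.
    by have := rnorm_ge0 s x; lra.
  have hnd : h n < d.
    apply: le_lt_trans (hn0 n) _; rewrite invf_plt ?posrE//.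
    by apply: lt_le_trans (Num.Theory.truncnS_gt _) _; rewrite ler_nat ltnS.
  by have := hd _ (h0 n) hnd; have := ler_rnorm_dist s (T (h n) x) x; lra.
pose p x := sup (S x).
have pge n x : N (T (h n) x) <= p x by apply: sup_upper_bound => //; exists n.
have ple x c : (forall n, N (T (h n) x) <= c) -> p x <= c.
  by move=> hc; apply: ge_sup; [case: (hS x)|move=> _ [n _ <-]].
have [||u x c ux hc|M M0 hM] := @zabreiko _ _ s X p.
- move=> x y; apply: ple => n; rewrite linearD.
  by apply: le_trans (ler_rnormD _ _ _) _; rewrite lerD.
- have le1 (a : R) x : p (of_real s a *: x) <= `|a| * p x.
    by apply: ple => n; rewrite linearZ /= rnormZr ler_wpM2l.
  move=> a x; apply/eqP; rewrite eq_le le1 /=.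
  have [->|a0] := eqVneq a 0.
    rewrite normr0 mul0r; apply: le_trans (pge 0%N _); exact: rnorm_ge0.
  have := le1 a^-1 (of_real s a *: x).
  rewrite scalerA -of_realM mulVf// of_real1 scale1r normfV => h1.
  by rewrite -ler_pdivlMl ?normr_gt0.
- apply: ple => n; rewrite leNgt; apply/negP; rewrite -subr_gt0 => e0.
  have Tc : T (h n) (\sum_(k < m) u k) @[m --> \oo] --> T (h n) x.
    by apply: (@cvg_comp _ _ _ _ (T (h n)) _ _ _ ux); exact: sg_continuous.
  have /(rcvgP s) /(_ _ e0)[m _ /(_ m (leqnn m))] /= := Tc.
  have := ler_rnorm_dist s (T (h n) x) (T (h n) (\sum_(k < m) u k)).
  rewrite rnormB.
  have : N (T (h n) (\sum_(k < m) u k)) <= c.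
    apply: le_trans (hc m); rewrite linear_sum.
    by apply: le_trans (rnorm_sum _ _ _) _; apply: ler_sum => k _.
  by lra.
- have [h1 h2 h3] := hxP (Num.truncn M).
  have := le_trans (ltW h3) (le_trans (pge (Num.truncn M) _) (hM _)).
  have x0 : 0 < N (hx (Num.truncn M)).2.
    rewrite lt_def rnorm_ge0 andbT rnorm_eq0; apply/eqP => x0.
    by move: h3; rewrite x0 linear0 rnorm0 mulr0 ltxx.
  by rewrite ler_pM2r// leNgt Num.Theory.truncnS_gt.
Qed.

Lemma sg_exp_bound : exists M w : R, [/\ 1 <= M, 0 <= w & forall (t : R) x, 0 <= t ->
  N (T t x) <= M * expR (w * t) * N x].
Proof.
have [d d0 [M M1 hM]] := sg_bounded0; have M0 : 0 < M by rewrite (lt_le_trans ltr01).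
have step n r x : 0 <= r -> r <= d -> N (T (n%:R * d + r) x) <= M ^+ n.+1 * N x.
  move=> r0 rd; elim: n x => [|n IH] x; first by rewrite mul0r add0r expr1 hM.
  rewrite -natr1 mulrDl mul1r addrAC sgD ?addr_ge0 ?mulr_ge0 ?(ltW d0)//.
  apply: le_trans (IH _) _; rewrite (exprSr M n.+1) -mulrA ler_wpM2l ?exprn_ge0 ?(ltW M0)//.
  exact: hM (ltW d0) _.
exists M, (ln M / d); split=> // [|t x t0].
  by rewrite divr_ge0 ?ln_ge0// ltW.
pose n := Num.truncn (t / d).
have td0 : 0 <= t / d by rewrite divr_ge0// ltW.
have nle : n%:R <= t / d by rewrite Num.Theory.truncn_le.
have tlt : t / d < n.+1%:R by exact: Num.Theory.truncnS_gt.
have := step n (t - n%:R * d) x; rewrite addrCA subrr addr0 => h.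
have {}h : N (T t x) <= M ^+ n.+1 * N x.
  apply: h; first by rewrite subr_ge0 -ler_pdivlMr.
  rewrite lerBlDl -[X in _ <= _ + X]mul1r -mulrDl natr1 -ler_pdivrMr// ltW//.
apply: le_trans h _; rewrite ler_wpM2r ?rnorm_ge0// exprS ler_wpM2l ?(ltW M0)//.
rewrite -{1}(lnK M0) -expRM_natl ler_expR -mulrA mulrC (mulrC _^-1).
by rewrite ler_wpM2l// ln_ge0.
Qed.

Lemma sg_bounded (t : R) : 0 <= t -> exists2 M : R, 1 <= M &
  forall (r : R) x, 0 <= r -> r <= t -> N (T r x) <= M * N x.
Proof.
move=> t0; have [M [w [M1 w0 h]]] := sg_exp_bound.
exists (M * expR (w * t)); first by rewrite mulr_ege1// -expR0 ler_expR mulr_ge0.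
move=> r x r0 rt; apply: le_trans (h _ _ r0) _; rewrite ler_wpM2r ?rnorm_ge0//.
by rewrite ler_wpM2l ?ler_expR ?ler_wpM2l// (le_trans ler01).
Qed.

Lemma sg_strongly_continuous x (t e : R) : 0 <= t -> 0 < e ->
  exists2 d : R, 0 < d & forall r : R, 0 <= r -> `|r - t| < d -> N (T r x - T t x) < e.
Proof.
move=> t0 e0; have [M M1 hM] := sg_bounded (addr_ge0 t0 ler01).
have M0 : 0 < M by rewrite (lt_le_trans ltr01).
have [d d0 hd] := sg_right0 x (divr_gt0 e0 M0).
exists (Num.min d 1) => [|r r0]; first by rewrite lt_min d0 ltr01.
rewrite lt_min => /andP[rd r1].
have close a b : 0 <= a -> a <= b -> b - a < d -> a <= t + 1 -> N (T b x - T a x) < e.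
  move=> a0 ab bad at1; have -> : b = a + (b - a) by rewrite addrCA subrr addr0.
  rewrite sgD ?subr_ge0// -linearB; apply: le_lt_trans (hM _ _ a0 at1) _.
  by rewrite mulrC -ltr_pdivlMr// hd// subr_ge0.
have [rt|tr] := leP r t.
  by rewrite rnormB close//; [by apply: le_lt_trans rd; rewrite distrC ler_norm|lra].
by rewrite close//; [exact: ltW|apply: le_lt_trans rd; exact: ler_norm|lra].
Qed.

Lemma sg_joint_cvg (a : nat -> R) (u : nat -> X) (t : R) (x : X) : 0 <= t ->
  (forall n, 0 <= a n) -> a @ \oo --> t -> u @ \oo --> x ->
  T (a n) (u n) @[n --> \oo] --> T t x.
Proof.
move=> t0 a0 /cvgrPdist_lt at_ /(rcvgP s) ux.
have [M M1 hM] := sg_bounded (addr_ge0 t0 ler01).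
have M0 : 0 < M by rewrite (lt_le_trans ltr01).
apply/(rcvgP s) => e e0; have e2 : 0 < e / 2 by lra.
have [d d0 hd] := sg_strongly_continuous x t0 e2.
have := ux _ (divr_gt0 e2 M0); have := at_ _ d0; have := at_ 1 ltr01.
apply: filterS3 => n h1 h2 h3.
have := ler_rnormtri s (T (a n) (u n)) (T (a n) x) (T t x).
have : N (T (a n) x - T t x) < e / 2 by rewrite hd// distrC.
have : N (T (a n) (u n) - T (a n) x) < e / 2.
  rewrite -linearB; apply: le_lt_trans (hM _ _ (a0 n) _) _.
    by move: h1; rewrite distrC => /(le_lt_trans (ler_norm _)); lra.
  by rewrite mulrC -ltr_pdivlMr.
by lra.
Qed.

End Semigroup.

(** * Limits at zero from the right, and the Neumann series *)

Section RealLimits.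
Context (R : realType) (K : numFieldType) (s : scalars R K).
Local Notation N := (rnorm s).

Lemma exp_quotient (c : R) : (expR (c * h) - 1) / h @[h --> 0^'+] --> c.
Proof.
apply/cvgrPdist_lt => e e0; apply/near_rightP.
have c1 : 0 < 2 * (c ^+ 2 + 1) by have := sqr_ge0 c; lra.
pose d := Num.min (e / (2 * (c ^+ 2 + 1))) (2^-1 / (`|c| + 1)).
have cc : 0 < `|c| + 1 by have := normr_ge0 c; lra.
exists d => [|h h0]; first by rewrite lt_min !divr_gt0.
rewrite lt_min => /andP[h1 h2].
have ch : `|c * h| <= 2^-1.
  rewrite normrM (gtr0_norm h0); move: h2; rewrite ltr_pdivlMr// => h2.
  by have : 0 <= `|c| by []; move: h2; set a := `|c|; nra.
have lo : c * h <= expR (c * h) - 1 by have := expR_ge1Dx (c * h); lra.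
have lo' : - (c * h) <= expR (- (c * h)) - 1 by have := expR_ge1Dx (- (c * h)); lra.
have up : expR (c * h) - 1 - c * h <= 2 * (c * h) ^+ 2.
  move: ch lo'; rewrite ler_norml expRN; move: (c * h) => x /andP[x1 x2] hx.
  have ex0 := expR_gt0 x.
  have : (1 - x) * expR x <= 1.
    have := ler_wpM2r (ltW ex0) hx; rewrite mulrBl mulVf ?gt_eqF//; lra.
  by move: ex0; move: (expR x) => y y0; nra.
have -> : c - (expR (c * h) - 1) / h = - ((expR (c * h) - 1 - c * h) / h).
  by field; rewrite gt_eqF.
rewrite normrN ger0_norm; last by rewrite divr_ge0 ?(ltW h0)// subr_ge0.
rewrite ltr_pdivrMr//; apply: le_lt_trans up _.
move: h1; rewrite ltr_pdivlMr// exprMn => h1.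
by move: c1 h0 h1; have := sqr_ge0 c; move: (c ^+ 2) => q; nra.
Qed.

Lemma exp_to1 (c : R) : expR (c * h) @[h --> 0^'+] --> (1 : R).
Proof.
have h0 : h @[h --> (0 : R)^'+] --> (0 : R) by exact: cvg_at_right_filter.
have : ((expR (c * h) - 1) / h * h + 1 : R) @[h --> 0^'+] --> (c * 0 + 1 : R).
  by apply: cvgD; [apply: cvgM => //; exact: exp_quotient|exact: cvg_cst].
rewrite mulr0 add0r; apply: cvg_trans; apply: near_eq_cvg.
apply/near_rightP; exists 1 => // h h1 _ /=.
by rewrite divfK ?subrK// gt_eqF.
Qed.

Context (X : completeNormedModType K).

Lemma rcvgZ (I : Type) (F : set_system I) {FF : Filter F} (a : I -> R) (a0 : R)
    (u : I -> X) (x : X) : a @ F --> a0 -> u @ F --> x ->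
  of_real s (a i) *: u i @[i --> F] --> of_real s a0 *: x.
Proof.
move=> ha /(rcvg0P s) hu.
apply: (@rcvg_dom _ _ s _ _ _ _ _ _
  (fun i => `|a i| * N (u i - x) + `|a i - a0| * N x)).
  apply: nearW => i.
  have -> : of_real s (a i) *: u i - of_real s a0 *: x =
      of_real s (a i) *: (u i - x) + of_real s (a i - a0) *: x.
    by rewrite scalerBr of_realB scalerBl addrA subrK.
  by apply: le_trans (ler_rnormD _ _ _) _; rewrite !rnormZr.
have -> : (0 : R) = `|a0| * 0 + 0 * N x by rewrite mulr0 mul0r addr0.
apply: cvgD; apply: cvgM => //; [exact: cvg_norm| |exact: cvg_cst].
rewrite -(normr0 R) -(subrr a0); apply: cvg_norm; apply: cvgB => //.
exact: cvg_cst.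
Qed.

Lemma right_eq_cvg (u v : R -> X) (x : X) : (forall h, 0 < h -> u h = v h) ->
  u @ 0^'+ --> x -> v @ 0^'+ --> x.
Proof.
move=> uv; apply: cvg_trans; apply: near_eq_cvg.
by apply/near_rightP; exists 1 => // h h0 _; rewrite uv.
Qed.

(** The iterates of [x |-> y + S x] converge geometrically. *)
Lemma neumann (S : X -> X) : (forall x y, S (x - y) = S x - S y) ->
  (forall x, N (S x) <= 2^-1 * N x) -> forall y, exists x, x - S x = y.
Proof.
move=> SB S2 y; pose x := fix x (n : nat) : X := if n is m.+1 then y + S (x m) else y.
have xn n : N (x n) <= 2 * N y.
  elim: n => [|n IH] /=; first by have := rnorm_ge0 s y; lra.
  by have := ler_rnormD s y (S (x n)); have := S2 (x n); lra.
have xmn n m : N (x (n + m)%N - x n) <= (2^-1 : R) ^+ n * N y.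
  elim: n => [|n IH].
    rewrite add0n expr0 mul1r; case: m => [|m] /=; first by rewrite subrr rnorm0 rnorm_ge0.
    by rewrite addrAC subrr add0r; have := S2 (x m); have := xn m; lra.
  rewrite addSn /= opprD addrACA subrr add0r -SB.
  by rewrite exprS -mulrA; apply: le_trans (S2 _) _; rewrite ler_wpM2l.
have expV2 : (2^-1 : R) ^+ n * N y @[n --> \oo] --> (0 : R).
  rewrite -[X in _ --> X](mul0r (N y)); apply: cvgM; last exact: cvg_cst.
  by apply: cvg_expr; rewrite ger0_norm// invf_lt1// ltr1n.
have [l hl] : exists l : X, x @ \oo --> l.
  apply: (@rcauchy_cvg _ _ s) => e e0; have e2 : 0 < e / 2 by lra.
  move/cvgrPdist_lt : expV2 => /(_ _ e2)[n _ /(_ n (leqnn n))] /=.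
  rewrite sub0r normrN => /(le_lt_trans (ler_norm _)) hn.
  exists n => i j ni nj; have := xmn n (i - n)%N; have := xmn n (j - n)%N.
  rewrite !subnKC//; have := ler_rnormtri s (x i) (x n) (x j).
  by rewrite (rnormB s (x n) (x j)); move: hn; move: (_ ^+ n * _) => A; lra.
exists l.
have Sl : S (x n) @[n --> \oo] --> S l.
  apply: (@cvg_comp _ _ _ x S _ _ _ hl).
  by apply: (bounded_continuous (s := s) (M := 2^-1)) => u v; rewrite -SB.
have h1 : x n.+1 @[n --> \oo] --> y + S l by apply: cvgD => //; exact: cvg_cst.
have h2 : x n.+1 @[n --> \oo] --> l by rewrite cvg_shiftS.
by rewrite {1}(cvg_unique _ h2 h1) // addrK.
Qed.

End RealLimits.

(** * Bochner integrals over intervals *)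

Section Intervals.
Context (R : realType).
Local Notation mu := (@lebesgue_measure R).
Local Notation meas D := (measurable (D : set (measurableTypeR R))).

Lemma measurable_oc (a b : R) : meas `]a, b]%classic.
Proof. exact: measurable_itv. Qed.

Lemma measurable_cc (a b : R) : meas `[a, b]%classic.
Proof. exact: measurable_itv. Qed.

Lemma measure_oc (a b : R) : a <= b -> mu `]a, b]%classic = (b - a)%:E.
Proof.
move=> ab; rewrite lebesgue_measure_itv /= lte_fin; case: ltP => // ba.
by rewrite (_ : b = a) ?subrr//; apply/eqP; rewrite eq_le ba.
Qed.

Lemma measure_cc (a b : R) : a <= b -> mu `[a, b]%classic = (b - a)%:E.
Proof.
move=> ab; rewrite lebesgue_measure_itv /= lte_fin; case: ltP => // ba.
by rewrite (_ : b = a) ?subrr//; apply/eqP; rewrite eq_le ba.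
Qed.

Lemma fin_oc (a b : R) : (mu `]a, b]%classic < +oo)%E.
Proof.
rewrite lebesgue_measure_itv /= lte_fin; case: ifP => _; last exact: ltry.
by rewrite -EFinB ltry.
Qed.

Lemma fin_cc (a b : R) : (mu `[a, b]%classic < +oo)%E.
Proof.
rewrite lebesgue_measure_itv /= lte_fin; case: ifP => _; last exact: ltry.
by rewrite -EFinB ltry.
Qed.

Lemma split_oc (a b c : R) : a <= b -> b <= c ->
  `]a, c]%classic = `]a, b]%classic `|` `]b, c]%classic.
Proof.
move=> ab bc; apply/seteqP; split=> x /=; rewrite !in_itv /=.
  by move=> /andP[h1 h2]; case: (leP x b) => h; [left|right]; apply/andP.
by move=> [/andP[h1 h2]|/andP[h1 h2]]; apply/andP; split=> //;
  [exact: le_trans bc|exact: le_lt_trans h1].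
Qed.

Lemma split_cc (a b c : R) : a <= b -> b <= c ->
  `[a, c]%classic = `[a, b]%classic `|` `]b, c]%classic.
Proof.
move=> ab bc; apply/seteqP; split=> x /=; rewrite !in_itv /=.
  by move=> /andP[h1 h2]; case: (leP x b) => h; [left|right]; apply/andP.
by move=> [/andP[h1 h2]|/andP[h1 h2]]; apply/andP; split=> //;
  [exact: le_trans bc|exact: le_trans (ltW h1)].
Qed.

Lemma disjoint_oc (a b c : R) : `]a, b]%classic `&` `]b, c]%classic = set0.
Proof.
apply/seteqP; split=> x //=; rewrite !in_itv /= => -[/andP[_ h1] /andP[h2 _]].
by have := lt_le_trans h2 h1; rewrite ltxx.
Qed.

Lemma disjoint_cc (a b c : R) : `[a, b]%classic `&` `]b, c]%classic = set0.
Proof.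
apply/seteqP; split=> x //=; rewrite !in_itv /= => -[/andP[_ h1] /andP[h2 _]].
by have := lt_le_trans h2 h1; rewrite ltxx.
Qed.

Lemma shift_oc (a b c : R) :
  (fun x => x - c) @^-1` `]a, b]%classic = `](a + c), (b + c)]%classic.
Proof. by apply/seteqP; split=> x; rewrite /= !in_itv /= ltrBrDr lerBlDr. Qed.

Lemma shift_cc (a b c : R) :
  (fun x => x - c) @^-1` `[a, b]%classic = `[(a + c), (b + c)]%classic.
Proof. by apply/seteqP; split=> x; rewrite /= !in_itv /= lerBrDr lerBlDr. Qed.

End Intervals.
#[global] Hint Resolve measurable_oc measurable_cc fin_oc fin_cc : core.

Section IntervalIntegrals.
Context (R : realType) (K : numFieldType) (s : scalars R K).
Context (V : completeNormedModType K).
Local Notation mu := (@lebesgue_measure R).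
Local Notation N := (rnorm s).
Local Notation BI D f := (bochner_integrable s D f).
Local Notation I D f := (bochner_integral s D f).
Implicit Types f : R -> V.

Lemma bint_split_oc f (a b c : R) : a <= b -> b <= c -> BI `]a, c]%classic f ->
  I `]a, c]%classic f = I `]a, b]%classic f + I `]b, c]%classic f.
Proof.
move=> ab bc; rewrite (split_oc ab bc) => fi.
by apply: bochner_integralU => //; exact: disjoint_oc.
Qed.

Lemma bint_split_cc f (a b c : R) : a <= b -> b <= c -> BI `[a, c]%classic f ->
  I `[a, c]%classic f = I `[a, b]%classic f + I `]b, c]%classic f.
Proof.
move=> ab bc; rewrite (split_cc ab bc) => fi.
by apply: bochner_integralU => //; exact: disjoint_cc.
Qed.

Lemma bint_null f (D : set R) : measurable (D : set (measurableTypeR R)) ->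
  mu D = 0%E -> strongly_measurable D f -> BI D f /\ I D f = 0.
Proof.
move=> mD D0 mf.
have fD : (mu D < +oo)%E by rewrite D0 ltry.
have f_int : (\int[mu]_(x in D) (N (f x))%:E = 0)%E.
  rewrite (ge0_negligible_integral mD mD _ _ D0).
  - by rewrite setDv integral_set0.
  - exact: measurable_Ernorm.
  - by move=> x _; rewrite lee_fin rnorm_ge0.
have fi : BI D f by split=> //; rewrite f_int ltry.
split=> //; apply/eqP; rewrite -(rnorm_eq0 s) eq_le rnorm_ge0 andbT -lee_fin.
by rewrite -[leRHS]f_int; exact: bochner_integral_norm.
Qed.

Lemma strongly_measurable_point f (a : R) : strongly_measurable `[a, a]%classic f.
Proof.
apply: (@eq_strongly_measurable _ _ _ _ (fun=> f a)).
  by move=> x /=; rewrite in_itv /= -eq_le eq_sym => /eqP ->.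
by apply: simple_strongly_measurable; exact: is_simple_cst.
Qed.

Lemma bint_point f (a : R) : I `[a, a]%classic f = 0.
Proof.
have [] := bint_null (measurable_cc a a) _ (strongly_measurable_point f a) => //.
by rewrite measure_cc ?subrr.
Qed.

Lemma bint_cc_oc f (a b : R) : a <= b -> BI `[a, b]%classic f ->
  I `[a, b]%classic f = I `]a, b]%classic f.
Proof. by move=> ab fi; rewrite (bint_split_cc (lexx a) ab fi) bint_point add0r. Qed.

Lemma sub_oc_cc (a b : R) : `]a, b]%classic `<=` `[a, b]%classic.
Proof. by move=> x /=; rewrite !in_itv /= => /andP[/ltW -> ->]. Qed.

Lemma BI_oc_cc f (a b : R) : BI `[a, b]%classic f -> BI `]a, b]%classic f.
Proof. by apply: bochner_integrable_sub => //; exact: sub_oc_cc. Qed.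

(** The differentiation half of the fundamental theorem of calculus, to be
    combined with a telescoping of intervals in [orbit_expc_int]. *)
Lemma bint_mean f (a b : R) (y : V) : a < b -> BI `]a, b]%classic f ->
  (forall e : R, 0 < e -> exists2 d : R, 0 < d &
     forall r, b - d < r -> r <= b -> N (f r - y) < e) ->
  of_real s h^-1 *: I `](b - h), b]%classic f @[h --> 0^'+] --> y.
Proof.
move=> ab fi fy; apply/(rcvg_rightP s) => e e0.
have e2 : 0 < e / 2 by lra.
have [d d0 hd] := fy _ e2; exists (Num.min d (b - a)) => [|h h0].
  by rewrite lt_min d0 subr_gt0.
rewrite lt_min => /andP[h1 h2].
have sub : `](b - h), b]%classic `<=` `]a, b]%classic.
  by move=> x /=; rewrite !in_itv /= => /andP[h3 ->]; rewrite andbT; lra.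
have fih : BI `](b - h), b]%classic f by apply: bochner_integrable_sub fi.
have ms : strongly_measurable `](b - h), b]%classic (fun=> - y : V).
  by apply: simple_strongly_measurable; exact: is_simple_cst.
have yi : BI `](b - h), b]%classic (fun=> - y : V).
  by apply: (@bochner_integrable_bounded _ _ _ _ _ _ _ _ (N y)) => //; apply: aeW => x _; rewrite rnormN.
have bh : b - h <= b by lra.
have hy : I `](b - h), b]%classic (fun=> - y) = - (of_real s h *: y).
  apply: bochner_integral_eq => //; apply/is_bochner_integralP; split=> //.
  exists (fun _ _ => - y).
    split=> [n|]; first exact: is_simple_cst.
    under eq_fun do under eq_integral do rewrite subrr rnorm0.
    by rewrite integral0; exact: cvg_cst.
  have -> : sint s `](b - h), b]%classic (fun=> - y) = - (of_real s h *: y).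
    rewrite /sint (_ : range _ = [set - y]); last first.
      by apply/seteqP; split=> [_ [_ _ <-]//|_ ->]; exists 0.
    rewrite fsbig_set1 (_ : _ `&` _ = `](b - h), b]%classic); last first.
      by apply/seteqP; split=> [x []//|x ?]; split.
    by rewrite measure_oc// opprD opprK addrA subrr add0r scalerN.
  exact: cvg_cst.
have -> : of_real s h^-1 *: I `](b - h), b]%classic f - y =
    of_real s h^-1 *: I `](b - h), b]%classic (fun r => f r + - y).
  rewrite bochner_integralD// hy scalerDr scalerN scalerA -of_realM mulVf ?gt_eqF//.
  by rewrite of_real1 scale1r.
rewrite rnormZr gtr0_norm ?invr_gt0// ltr_pdivrMl//.
apply: (@le_lt_trans _ _ (e / 2 * fine (mu `](b - h), b]%classic))).
  apply: bochner_integral_bound => //; first exact: ltW.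
    exact: bochner_integrableD.
  apply: aeW => x /=; rewrite in_itv /= => /andP[h3 h4].
  by apply/ltW/hd => //; lra.
rewrite measure_oc//= opprD opprK addrA subrr add0r mulrC ltr_pM2l//.
by lra.
Qed.

End IntervalIntegrals.

(** * Orbits and the rescaled semigroup *)

Section Orbits.
Context (R : realType) (K : numFieldType) (s : scalars R K).
Context (X : completeNormedModType K) (T : R -> {linear X -> X}).
Local Notation mu := (@lebesgue_measure R).
Local Notation N := (rnorm s).
Local Notation BI D f := (bochner_integrable s D f).
Local Notation I D f := (bochner_integral s D f).
Hypothesis hT : C0_semigroup T.

Lemma orbit_strongly_measurable (D : set R) (t : R) (w : R -> X) :
  (forall r, D r -> r <= t) -> strongly_measurable D w ->
  strongly_measurable D (fun r => T (t - r) (w r)).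
Proof.
move=> Dt mw.
apply: (@eq_strongly_measurable _ _ _ _ (fun r => T (Num.max (t - r) 0) (w r))).
  by move=> r /Dt rt; rewrite max_l// subr_ge0.
apply: (strongly_measurable_delay (k := fun r => Num.max (t - r) 0) (phi := fun a v => T a v)) => //.
- have mt : measurable_fun (setT : set (measurableTypeR R)) (fun r : R => t - r).
    exact: measurable_funB.
  exact: (measurable_maxr mt (measurable_cst (0 : R))).
- by move=> r; rewrite le_max lexx orbT.
- move=> r a u _ a0 ar ur; apply: (sg_joint_cvg s hT) => //.
  by rewrite le_max lexx orbT.
Qed.

Lemma orbit_integrable (D : set R) (a t : R) (w : R -> X) :
  measurable (D : set (measurableTypeR R)) -> a <= t ->
  (forall r, D r -> a <= r <= t) -> BI D w -> BI D (fun r => T (t - r) (w r)).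
Proof.
move=> mD at_ Dat wi.
have [|M M1 hM] := @sg_bounded _ _ s _ _ hT (t - a); first by rewrite subr_ge0.
have M0 : 0 <= M by rewrite (le_trans ler01).
apply: (bochner_integrable_dom mD M0 _ _ wi).
  by apply: orbit_strongly_measurable; [move=> r /Dat /andP[]|case: wi].
by move=> r /Dat /andP[ar rt]; apply: hM; rewrite ?subr_ge0// lerB.
Qed.

(** As a control, this function steers to a difference of two orbit values; in
    the state space it turns orbit integrals into Laplace transforms. *)
Definition expc (l : R) (x : X) (r : R) : X := of_real s (expR (l * r)) *: x.

Lemma expc_strongly_measurable l x D : strongly_measurable D (expc l x).
Proof.
apply: (strongly_measurable_delay (k := fun r => expR (l * r))
  (phi := fun a v => of_real s a *: v) (f := fun=> x)).
- by apply: measurableT_comp => //; exact: measurable_funM.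
- by move=> r; exact: expR_ge0.
- by move=> r a u _ _ ha hu; exact: rcvgZ.
- by apply: simple_strongly_measurable; exact: is_simple_cst.
Qed.

Lemma expc_bound l x (a b r : R) : a <= r -> r <= b ->
  N (expc l x r) <= expR (`|l| * (`|a| + `|b|)) * N x.
Proof.
move=> ar rb; rewrite rnormZr ger0_norm ?expR_ge0// ler_wpM2r ?rnorm_ge0//.
rewrite ler_expR (le_trans (ler_norm _))// normrM ler_wpM2l//.
rewrite ler_norml; apply/andP; split.
  by have := ler_norm (- a); rewrite normrN; have := normr_ge0 b; lra.
by have := ler_norm b; have := normr_ge0 a; lra.
Qed.

Lemma expc_integrable l x (a b : R) : BI `]a, b]%classic (expc l x).
Proof.
apply: (@bochner_integrable_bounded _ _ _ _ _ _ _ _ (expR (`|l| * (`|a| + `|b|)) * N x)) => //.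
  exact: expc_strongly_measurable.
by apply: aeW => r /=; rewrite in_itv /= => /andP[ar rb]; apply: expc_bound => //; exact: ltW.
Qed.

Lemma orbit_expc_integrable l x (a b t : R) : b <= t ->
  BI `]a, b]%classic (fun r => T (t - r) (expc l x r)).
Proof.
move=> bt; have [ba|ab] := leP b a.
  have e0 : mu `]a, b]%classic = 0%E by rewrite lebesgue_measure_itv /= lte_fin ltNge ba.
  have [] := bint_null s (measurable_oc a b) e0 (f := fun r => T (t - r) (expc l x r)).
    apply: orbit_strongly_measurable; last exact: expc_strongly_measurable.
    by move=> r /=; rewrite in_itv /= => /andP[_ /le_trans]; apply.
  by [].
apply: (@orbit_integrable _ a) => //; first exact: (ltW (lt_le_trans ab bt)).
- move=> r /=; rewrite in_itv /= => /andP[ar rb].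
  by rewrite (ltW ar) (le_trans rb).
- exact: expc_integrable.
Qed.

(** The rescaled semigroup, generated by [A - l]. *)
Definition rsg (l h : R) (x : X) : X := of_real s (expR (- l * h)) *: T h x.

Lemma rsg_orbit (l h t r : R) x : 0 <= h -> r <= t ->
  rsg l h (T (t - r) (expc l x r)) = T (t - (r - h)) (expc l x (r - h)).
Proof.
move=> h0 rt; rewrite /rsg -sgD ?subr_ge0// /expc !linearZ /= scalerA -of_realM -expRD.
by rewrite opprB addrA; congr (of_real s (expR _) *: T _ x); ring.
Qed.

Lemma rsg_continuous l h : 0 <= h -> continuous (rsg l h).
Proof.
move=> h0; have [M M0 TM] := continuous_bounded s (sg_continuous hT h0).
apply: (bounded_continuous (s := s) (M := expR (- l * h) * M)) => x y.
rewrite /rsg -scalerBr -linearB rnormZr ger0_norm ?expR_ge0//.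
by rewrite -mulrA ler_wpM2l ?expR_ge0.
Qed.

Lemma rsg_linear l h : linear (rsg l h).
Proof.
move=> a x y; rewrite /rsg linearD linearZ /= scalerDr !scalerA.
by rewrite [a * _]mulrC.
Qed.

Section Generator.
Variables (D : set X) (A : X -> X).
Hypothesis hA : generates s D A T.

Lemma gen_limP x y : D x /\ A x = y <->
  (of_real s h)^-1 *: (T h x - x) @[h --> 0^'+] --> y.
Proof. by case: hA => _; apply. Qed.

(** The rescaled semigroup has generator [A - l]. Its difference quotients are
    bounded operators, which commute with integrals while [A] does not. *)
Lemma gen_rsgP (l : R) x y : D x /\ of_real s l *: x - A x = y <->
  of_real s h^-1 *: (x - rsg l h x) @[h --> 0^'+] --> y.
Proof.
split=> [[Dx <-]|hy].
  have /gen_limP hx : D x /\ A x = A x by [].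
  have : of_real s (- ((expR (- l * h) - 1) / h)) *: x -
      of_real s (expR (- l * h)) *: ((of_real s h)^-1 *: (T h x - x)) @[h --> 0^'+]
      --> of_real s l *: x - of_real s 1 *: A x.
    apply: cvgB; apply: rcvgZ => //; [|exact: cvg_cst|exact: exp_to1].
    by rewrite -[X in _ --> X]opprK; apply: cvgN; exact: exp_quotient.
  rewrite of_real1 scale1r; apply: right_eq_cvg => h h0 /=.
  rewrite -of_realV /rsg !scalerBr opprB !scalerA -!of_realM.
  rewrite addrA -scalerDl -of_realD [h^-1 * _]mulrC; congr (of_real s _ *: x - _).
  by ring.
have : of_real s ((expR (l * h) - 1) / h) *: x -
    of_real s (expR (l * h)) *: (of_real s h^-1 *: (x - rsg l h x)) @[h --> 0^'+]
    --> of_real s l *: x - of_real s 1 *: y.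
  by apply: cvgB; apply: rcvgZ => //; [exact: exp_quotient|exact: cvg_cst|exact: exp_to1].
rewrite of_real1 scale1r => hx.
have [|Dx Ax] := proj2 (gen_limP x (of_real s l *: x - y)).
  move: hx; apply: right_eq_cvg => h h0 /=.
  rewrite -of_realV /rsg !scalerBr opprB !scalerA -!of_realM.
  rewrite addrCA -scalerBl -of_realB; congr (of_real s _ *: _ + _).
    rewrite mulrAC -expRD mulNr addrN expR0 mul1r//.
  by rewrite -scaleNr -of_realN; congr (of_real s _ *: x); ring.
by split=> //; rewrite Ax opprB addrCA subrr addr0.
Qed.

End Generator.
End Orbits.

(** * Generators *)

Section Generator.
Context (R : realType) (K : numFieldType) (s : scalars R K).
Context (X : completeNormedModType K) (T : R -> {linear X -> X}).
Local Notation mu := (@lebesgue_measure R).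
Local Notation N := (rnorm s).
Local Notation BI D f := (bochner_integrable s D f).
Local Notation I D f := (bochner_integral s D f).
Local Notation r2 := (of_real s).
Variables (D : set X) (A : X -> X).
Hypothesis hA : generates s D A T.

Let hT : C0_semigroup T. Proof. by case: hA. Qed.

Lemma gen_linear (a : K) x y : D x -> D y -> D (a *: x + y) /\ A (a *: x + y) = a *: A x + A y.
Proof.
move=> Dx Dy; apply/(gen_limP hA).
have /(gen_limP hA) hx : D x /\ A x = A x by [].
have /(gen_limP hA) hy : D y /\ A y = A y by [].
have : a *: ((r2 h)^-1 *: (T h x - x)) + (r2 h)^-1 *: (T h y - y) @[h --> 0^'+]
    --> a *: A x + A y.
  by apply: cvgD => //; apply: cvgZr.
apply: right_eq_cvg => h h0; rewrite scalerA mulrC -scalerA -scalerDr.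
by rewrite (linearP (T h)) /= scalerBr addrACA opprD.
Qed.

Lemma genZ (a : K) x : D x -> D (a *: x) /\ A (a *: x) = a *: A x.
Proof.
move=> Dx; have [D0 A0] := gen_linear (-1) Dx Dx.
rewrite scaleN1r addNr in D0 A0.
have [] := gen_linear a Dx D0; rewrite addr0 => Da ->.
by split=> //; rewrite A0 scaleN1r addNr addr0.
Qed.

Lemma gen0 : D 0 /\ A 0 = 0.
Proof.
by apply/(gen_limP hA); apply: (right_eq_cvg (u := fun=> 0));
  [move=> h h0; rewrite linear0 subrr scaler0|exact: cvg_cst].
Qed.

Lemma genB x y : D x -> D y -> D (x - y) /\ A (x - y) = A x - A y.
Proof.
move=> Dx Dy; have [DN AN] := genZ (-1) Dy.
rewrite !scaleN1r in DN AN.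
by have := gen_linear 1 Dx DN; rewrite !scale1r AN.
Qed.

Lemma gen_sg t x : 0 <= t -> D x -> D (T t x) /\ A (T t x) = T t (A x).
Proof.
move=> t0 Dx; apply/(gen_limP hA).
have /(gen_limP hA) hx : D x /\ A x = A x by [].
have : T t ((r2 h)^-1 *: (T h x - x)) @[h --> 0^'+] --> T t (A x).
  by apply: (@cvg_comp _ _ _ _ (T t) _ _ _ hx); exact: sg_continuous hT _ t0 _.
apply: right_eq_cvg => h h0; rewrite linearZ /= linearB /=.
by rewrite -(sgD hT _ t0 (ltW h0)) -(sgD hT _ (ltW h0) t0) (addrC t h).
Qed.

(** The fundamental theorem of calculus for [r |-> expR (l r) T (t - r) x]. The
    rescaled semigroup shifts the interval of integration by [h], so that the
    difference quotients of [z] telescope to the means over intervals of length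
    [h] at the two end points. *)
Lemma orbit_expc_int (l a b t : R) x : a <= b -> b <= t ->
  let z := I `]a, b]%classic (fun r => T (t - r) (expc s l x r)) in
  D z /\ r2 l *: z - A z =
    r2 (expR (l * b)) *: T (t - b) x - r2 (expR (l * a)) *: T (t - a) x.
Proof.
move=> ab bt z; pose g r := T (t - r) (expc s l x r).
have gi c d : d <= t -> BI `]c, d]%classic g by exact: orbit_expc_integrable.
have gE r : g r = r2 (expR (l * r)) *: T (t - r) x by rewrite /g /expc linearZ.
have mean c : c <= t -> r2 h^-1 *: I `](c - h), c]%classic g @[h --> 0^'+] --> g c.
  move=> ct; apply: (@bint_mean _ _ _ _ _ (c - 1)) => //; [lra|exact: gi|].
  move=> e e0.
  have ex0 : 0 < expR (`|l| * (`|c - 1| + `|c|)) by exact: expR_gt0.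
  have /cvgrPdist_lt lc : expR (l * r) @[r --> c] --> expR (l * c).
    apply: (@cvg_comp _ _ _ (fun r => l * r) expR); last exact: continuous_expR.
    by apply: cvgM; [exact: cvg_cst|exact: cvg_id].
  pose B := expR (l * c) + 1; have B0 : 0 < B by have := expR_gt0 (l * c); rewrite /B; lra.
  pose C := N (T (t - c) x) + 1.
  have C0 : 0 < C by have := rnorm_ge0 s (T (t - c) x); rewrite /C; lra.
  have e1 : 0 < e / 2 / B by rewrite divr_gt0//; lra.
  have e2 : 0 < e / 2 / C by rewrite divr_gt0//; lra.
  have [|d1 d10 hd1] := @sg_strongly_continuous _ _ s _ _ hT x (t - c) _ _ e1.
    by rewrite subr_ge0.
  have /nbhs_ballP[d2 /= d20 hd2] := lc _ e2.
  have /nbhs_ballP[d3 /= d30 hd3] := lc _ ltr01.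
  exists (Num.min d1 (Num.min d2 d3)) => [|r]; first by rewrite !lt_min d10 d20 d30.
  move=> h1 rc.
  have rd (d : R) : Num.min d1 (Num.min d2 d3) <= d -> `|c - r| < d.
    by move=> ?; rewrite ger0_norm ?subr_ge0//; lra.
  have {}hd1 : N (T (t - r) x - T (t - c) x) < e / 2 / B.
    apply: hd1; first by rewrite subr_ge0 (le_trans rc).
    have -> : t - r - (t - c) = c - r by ring.
    by rewrite rd// ge_min lexx.
  have {}hd2 : `|expR (l * c) - expR (l * r)| < e / 2 / C.
    by apply: hd2; rewrite /ball /= rd// !ge_min lexx orbT.
  have {}hd3 : `|expR (l * c) - expR (l * r)| < 1.
    by apply: hd3; rewrite /ball /= rd// !ge_min lexx !orbT.
  have -> : g r - g c = r2 (expR (l * r)) *: (T (t - r) x - T (t - c) x) +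
      r2 (expR (l * r) - expR (l * c)) *: T (t - c) x.
    by rewrite !gE scalerBr of_realB scalerBl addrA subrK.
  apply: le_lt_trans (ler_rnormD _ _ _) _; rewrite !rnormZr.
  have h2 : `|expR (l * r)| * N (T (t - r) x - T (t - c) x) < e / 2.
    apply: (@le_lt_trans _ _ (B * N (T (t - r) x - T (t - c) x))).
      rewrite ler_wpM2r ?rnorm_ge0// /B ger0_norm ?expR_ge0//.
      by move: hd3; rewrite distrC => /(le_lt_trans (ler_norm _)); lra.
    by rewrite mulrC -ltr_pdivlMr.
  have h3 : `|expR (l * r) - expR (l * c)| * N (T (t - c) x) < e / 2.
    apply: (@le_lt_trans _ _ (`|expR (l * r) - expR (l * c)| * C)).
      by rewrite ler_wpM2l// /C; lra.
    by rewrite -ltr_pdivlMr// distrC.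
  by lra.
suff : r2 h^-1 *: (z - rsg s T l h z) @[h --> 0^'+] --> g b - g a.
  by move=> /(gen_rsgP hA); rewrite !gE.
have : r2 h^-1 *: I `](b - h), b]%classic g - r2 h^-1 *: I `](a - h), a]%classic g
    @[h --> 0^'+] --> g b - g a.
  by apply: cvgB; apply: mean => //; exact: le_trans bt.
apply: right_eq_cvg => h h0; rewrite -scalerBr; congr (_ *: _).
have at_ := le_trans ab bt.
pose S : {linear X -> X} := HB.pack (rsg s T l h)
  (GRing.isLinear.Build _ _ _ _ _ (rsg_linear s T l h)).
have Sz : rsg s T l h z = I `](a - h), (b - h)]%classic g.
  have Sc0 := @rsg_continuous _ _ s _ _ hT l h (ltW h0). have Sc : continuous S by exact: Sc0.
  rewrite -[LHS]/(S z) /z -(bochner_integral_op (measurable_oc a b) (fin_oc a b) Sc (gi _ _ bt)).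
  have bh : b - h <= t by apply: le_trans bt; lra.
  rewrite -(bochner_integral_shift h (measurable_oc _ _) (fin_oc _ _) (gi (a - h) (b - h) bh)).
  rewrite shift_oc !subrK; apply: eq_bochner_integral => r /=.
  rewrite in_itv /= => /andP[_ rb]; rewrite (rsg_orbit s hT)//; first exact: ltW.
  exact: le_trans bt.
have e1 : I `](a - h), b]%classic g = I `](a - h), a]%classic g + z.
  by apply: bint_split_oc => //; [lra|exact: gi].
have e2 : I `](a - h), b]%classic g =
    I `](a - h), (b - h)]%classic g + I `](b - h), b]%classic g.
  by apply: bint_split_oc => //; [lra|lra|exact: gi].
rewrite Sz; apply/eqP; rewrite subr_eq addrAC eq_sym subr_eq; apply/eqP.
by rewrite addrC -e1 e2 addrC.
Qed.

End Generator.

(** * Resolvents *)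

Section Resolvent.
Context (R : realType) (K : numFieldType) (s : scalars R K).
Context (X : completeNormedModType K) (T : R -> {linear X -> X}).
Local Notation mu := (@lebesgue_measure R).
Local Notation N := (rnorm s).
Local Notation BI D f := (bochner_integrable s D f).
Local Notation I D f := (bochner_integral s D f).
Local Notation r2 := (of_real s).
Variables (D : set X) (A : X -> X).
Hypothesis hA : generates s D A T.

Let hT : C0_semigroup T. Proof. by case: hA. Qed.

(** [expR (l tau)] times the Laplace transform of the semigroup cut off at
    [tau]: the finite horizon makes [l - A] invertible without any improper
    integral. *)
Definition lapl (l tau : R) (x : X) : X :=
  I `]0, tau]%classic (fun r => T (tau - r) (expc s l x r)).

Let lint l tau x : BI `]0, tau]%classic (fun r => T (tau - r) (expc s l x r)).
Proof. exact: orbit_expc_integrable. Qed.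

Lemma resolvent_sub (l : K) x y : D x -> D y ->
  l *: (x - y) - A (x - y) = (l *: x - A x) - (l *: y - A y).
Proof.
move=> Dx Dy; have [_ ->] := genB hA Dx Dy.
by rewrite scalerBr !opprB addrACA [RHS]addrACA; congr (_ + _); exact: addrC.
Qed.

Lemma lapl_gen l tau x : 0 <= tau -> D (lapl l tau x) /\
  r2 l *: lapl l tau x - A (lapl l tau x) = r2 (expR (l * tau)) *: x - T tau x.
Proof.
move=> tau0; have := orbit_expc_int hA l x tau0 (lexx tau) => /=.
by rewrite subrr subr0 mulr0 expR0 of_real1 scale1r (sg0 hT).
Qed.

Lemma lapl_linear l tau : linear (lapl l tau).
Proof.
move=> a x y.
have ac : continuous ( *:%R a : X -> X).
  apply: (bounded_continuous (s := s) (M := real_part s `|a|)) => u v.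
  by rewrite -scalerBr rnormZ.
rewrite /lapl -(bochner_integral_op (measurable_oc 0 tau) (fin_oc 0 tau) (L := *:%R a) ac (lint _ _ _)).
rewrite -bochner_integralD//; last first.
  exact: (bochner_integrable_op (measurable_oc 0 tau) (L := *:%R a) ac (lint _ _ _)).
apply: eq_bochner_integral => r _; rewrite /expc scalerDr linearD scalerA [_ * a]mulrC.
by rewrite -scalerA linearZ.
Qed.

Lemma laplB l tau x y : lapl l tau (x - y) = lapl l tau x - lapl l tau y.
Proof.
by rewrite addrC -scaleN1r lapl_linear scaleN1r addrC.
Qed.

Lemma lapl_bound l tau M x : 0 <= tau -> 0 <= M ->
  (forall r y, 0 <= r -> r <= tau -> N (T r y) <= M * N y) ->
  N (lapl l tau x) <= M * expR (`|l| * tau) * tau * N x.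
Proof.
move=> tau0 M0 hM; have h := expc_bound s l x (a := 0) (b := tau).
rewrite normr0 add0r (ger0_norm tau0) in h.
rewrite mulrAC -[leRHS]mulrA.
have -> : M * expR (`|l| * tau) * (N x * tau) =
    M * (expR (`|l| * tau) * N x) * fine (mu `]0, tau]%classic).
  by rewrite measure_oc//= subr0 !mulrA.
apply: bochner_integral_bound => //; first by rewrite !mulr_ge0 ?expR_ge0 ?rnorm_ge0.
apply: aeW => r /=; rewrite in_itv /= => /andP[r0 rt].
apply: le_trans (hM _ _ _ _) _; rewrite ?subr_ge0//; first lra.
by rewrite ler_wpM2l// h// ltW.
Qed.

Lemma lapl_continuous l tau : 0 <= tau -> continuous (lapl l tau).
Proof.
move=> tau0; have [M M1 hM] := @sg_bounded _ _ s _ _ hT _ tau0.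
have M0 : 0 <= M by rewrite (le_trans ler01).
apply: (bounded_continuous (s := s) (M := M * expR (`|l| * tau) * tau)) => x y.
by rewrite -laplB; exact: lapl_bound.
Qed.

Lemma lapl_rsg l tau h x : 0 <= h -> lapl l tau (rsg s T l h x) = rsg s T l h (lapl l tau x).
Proof.
move=> h0; pose S : {linear X -> X} := HB.pack (rsg s T l h)
  (GRing.isLinear.Build _ _ _ _ _ (rsg_linear s T l h)).
have Sc0 := @rsg_continuous _ _ s _ _ hT l h h0; have Sc : continuous S by exact: Sc0.
rewrite -[RHS]/(S _) /lapl -(bochner_integral_op (measurable_oc 0 tau) (fin_oc 0 tau) Sc (lint _ _ _)).
apply: eq_bochner_integral => r /=; rewrite in_itv /= => /andP[r0 rt].
rewrite /S /= /rsg /expc !linearZ /= -!(sgD hT) ?subr_ge0//.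
by rewrite (addrC h) !scalerA mulrC.
Qed.

(** The operator [l - A] is the limit of difference quotients of the rescaled
    semigroup, which commutes with [lapl]. *)
Lemma lapl_comm l tau x : 0 <= tau -> D x ->
  lapl l tau (r2 l *: x - A x) = r2 l *: lapl l tau x - A (lapl l tau x).
Proof.
move=> tau0 Dx; have /(gen_rsgP hA) hx : D x /\ r2 l *: x - A x = r2 l *: x - A x by [].
have [DV _] := lapl_gen l x tau0.
have /(gen_rsgP hA) hV : D (lapl l tau x) /\ r2 l *: lapl l tau x - A (lapl l tau x) =
  r2 l *: lapl l tau x - A (lapl l tau x) by [].
have h1 : lapl l tau (r2 h^-1 *: (x - rsg s T l h x)) @[h --> 0^'+] -->
    lapl l tau (r2 l *: x - A x).
  by apply: (@cvg_comp _ _ _ _ (lapl l tau) _ _ _ hx); exact: lapl_continuous.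
apply: (cvg_unique _ h1) => //; move: hV; apply: right_eq_cvg => h h0.
have := lapl_linear l tau (r2 h^-1) (x - rsg s T l h x) 0.
have l0 : lapl l tau 0 = 0 by have := laplB l tau 0 0; rewrite !subrr.
by rewrite l0 !addr0 => ->; rewrite laplB lapl_rsg// ltW.
Qed.

(** Together with [lapl_gen] this makes [lapl l tau] a two-sided inverse of
    [l - A], up to the factor [expR (l tau) - T tau]. *)
Lemma lapl_resolvent l tau x : 0 <= tau -> D x ->
  lapl l tau (r2 l *: x - A x) = r2 (expR (l * tau)) *: x - T tau x.
Proof. by move=> tau0 Dx; rewrite lapl_comm//; case: (lapl_gen l x tau0). Qed.

Definition exp_bounded (w : R) := exists M : R, forall t x, 0 <= t ->
  N (T t x) <= M * expR (w * t) * N x.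

Lemma exp_bounded_pos w : exp_bounded w -> exists2 M : R, 1 <= M & forall t x, 0 <= t ->
  N (T t x) <= M * expR (w * t) * N x.
Proof.
move=> [M hM]; exists (Num.max M 1) => [|t x t0]; first by rewrite le_max lexx orbT.
apply: le_trans (hM _ _ t0) _; rewrite ler_wpM2r ?rnorm_ge0// ler_wpM2r ?expR_ge0//.
by rewrite le_max lexx.
Qed.

Lemma half_decay w l : exp_bounded w -> w < l -> exists2 tau : R, 0 <= tau &
  forall x, N (r2 (expR (- (l * tau))) *: T tau x) <= 2^-1 * N x.
Proof.
move=> /exp_bounded_pos[M M1 hM] wl; have M0 : 0 < M by rewrite (lt_le_trans ltr01).
have wl0 : 0 < l - w by lra.
pose tau := ln (2 * M) / (l - w).
have tau0 : 0 <= tau by rewrite divr_ge0 ?ln_ge0 ?(ltW wl0)//; lra.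
exists tau => // x; rewrite rnormZr ger0_norm ?expR_ge0//.
apply: le_trans (ler_wpM2l (expR_ge0 _) (hM _ _ tau0)) _.
rewrite mulrA ler_wpM2r ?rnorm_ge0// mulrCA -expRD.
have -> : - (l * tau) + w * tau = - ln (2 * M).
  by rewrite /tau; field; rewrite gt_eqF.
rewrite expRN lnK ?posrE ?mulr_gt0// invfM mulrCA mulfV ?gt_eqF// mulr1//.
Qed.

(** For large [tau] the operator [expR (- l tau) T tau] has norm at most [1/2],
    so that [expR (l tau) - T tau] is invertible by the Neumann series. *)
Lemma resolvent_real w l : exp_bounded w -> w < l -> resolvent_set D A (r2 l).
Proof.
move=> hw wl; have [tau tau0 half] := half_decay hw wl.
have SB x y : r2 (expR (- (l * tau))) *: T tau (x - y) =
    r2 (expR (- (l * tau))) *: T tau x - r2 (expR (- (l * tau))) *: T tau y.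
  by rewrite linearB scalerBr.
have fact x : r2 (expR (l * tau)) *: x - T tau x =
    r2 (expR (l * tau)) *: (x - r2 (expR (- (l * tau))) *: T tau x).
  by rewrite scalerBr scalerA -of_realM -expRD addrN expR0 of_real1 scale1r.
have lower x : expR (l * tau) * (2^-1 * N x) <= N (r2 (expR (l * tau)) *: x - T tau x).
  rewrite fact rnormZr ger0_norm ?expR_ge0// ler_wpM2l ?expR_ge0//.
  have := ler_rnorm_dist s x (r2 (expR (- (l * tau))) *: T tau x).
  by have := half x; lra.
have [M M1 hM] := @sg_bounded _ _ s _ _ hT _ tau0.
have M0 : 0 <= M by rewrite (le_trans ler01).
pose C := M * expR (`|l| * tau) * tau.
have bound x : D x -> N x <= 2 * C / expR (l * tau) * N (r2 l *: x - A x).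
  move=> Dx; have := lapl_bound l (r2 l *: x - A x) tau0 M0 hM.
  rewrite lapl_resolvent// => /(le_trans (lower x)) h.
  rewrite mulrAC ler_pdivlMr ?expR_gt0//; move: h; rewrite -/C.
  by move: C (N _) (N _) (expR _) => c a b d; lra.
split=> [y|]; last first.
  exists (r2 (2 * C / expR (l * tau))) => x Dx.
  by rewrite !(normE s) -of_realM le_of_real bound.
have [x0 hx0] := neumann (s := s) SB half (r2 (expR (- (l * tau))) *: y).
have [Dx Ax] := lapl_gen l x0 tau0.
have {}Ax : r2 l *: lapl l tau x0 - A (lapl l tau x0) = y.
  by rewrite Ax fact hx0 scalerA -of_realM -expRD addrN expR0 of_real1 scale1r.
exists (lapl l tau x0); split=> // z [Dz Az].
have [Dd _] := genB hA Dx Dz.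
apply/eqP; rewrite -subr_eq0 -(rnorm_eq0 s) eq_le rnorm_ge0 andbT.
apply: le_trans (bound _ Dd) _.
have -> : r2 l *: (lapl l tau x0 - z) - A (lapl l tau x0 - z) = 0.
  by rewrite resolvent_sub// Ax Az subrr.
by rewrite rnorm0 mulr0.
Qed.

(** Means of an orbit over short intervals lie in the domain. *)
Lemma domain_dense x (e : R) : 0 < e -> exists2 y, D y & N (y - x) < e.
Proof.
move=> e0; pose g r := T (1 - r) (expc s 0 x r).
have gi : BI `]0, 1]%classic g by exact: orbit_expc_integrable.
have : r2 h^-1 *: I `](1 - h), 1]%classic g @[h --> 0^'+] --> x.
  apply: (bint_mean _ gi) => [|e' e'0]; first exact: ltr01.
  have [d d0 hd] := @sg_right0 _ _ s _ _ hT x _ e'0; exists d => // r r1 r2.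
  by rewrite /g /expc mul0r expR0 of_real1 scale1r hd//; lra.
move=> /(rcvg_rightP s) /(_ _ e0)[d d0 hd].
have h0 : 0 < d / 2 by lra.
exists (r2 (d / 2)^-1 *: I `](1 - d / 2), 1]%classic g); last by apply: hd => //; lra.
have hle : 1 - d / 2 <= 1 by lra.
have [Dz _] := orbit_expc_int hA 0 x hle (lexx 1).
by case: (genZ hA (r2 (d / 2)^-1) Dz).
Qed.

(** For a horizon [tau] of order [1 / l] the norm of [lapl l tau] is of order
    [1 / l], while [expR (l tau)] keeps a fixed value, twice a bound on [T tau]. *)
Lemma resolvent_decay : exists k C : R, [/\ 0 < k, 0 <= C & forall l x, k <= l -> D x ->
  N x <= C / l * N (r2 l *: x - A x)].
Proof.
have [M M1 hM] := @sg_bounded _ _ s _ _ hT _ ler01.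
have M0 : 0 < M by rewrite (lt_le_trans ltr01).
(* This [k] makes [expR (l tau)] twice the bound [M] on [T tau]. *)
pose k := ln (2 * M); have k0 : 0 < k by rewrite ln_gt0//; lra.
exists k, (2 * k * M); split=> // [|l x kl Dx]; first by rewrite !mulr_ge0// ltW.
have l0 : 0 < l by rewrite (lt_le_trans k0).
pose tau := k / l; have tau0 : 0 <= tau by rewrite divr_ge0// ltW.
have tau1 : tau <= 1 by rewrite ler_pdivrMr// mul1r.
have etau : expR (l * tau) = 2 * M.
  by rewrite /tau mulrC divfK ?gt_eqF// lnK// posrE; lra.
have := lapl_bound l (r2 l *: x - A x) tau0 (ltW M0)
  (fun r y r0 rt => hM r y r0 (le_trans rt tau1)).
rewrite lapl_resolvent// (gtr0_norm l0) etau => h.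
have h2 := hM _ x tau0 tau1.
have := ler_rnorm_dist s (r2 (2 * M) *: x) (T tau x).
rewrite rnormZr ger0_norm; last by lra.
have -> : 2 * k * M / l = 2 * M * tau by rewrite /tau; field; rewrite gt_eqF.
move=> h3; rewrite -(ler_pM2l M0); lra.
Qed.

(** The operators [l (l - A)^-1] are bounded as [l] grows, and converge to the
    identity on the domain, which is dense. *)
Lemma resolvent_to_id (x : X) (e : R) : 0 < e -> exists l0 : R, forall l y, l0 <= l ->
  D y -> r2 l *: y - A y = r2 l *: x -> N (y - x) < e.
Proof.
move=> e0; have [k [C [k0 C0 hR]]] := resolvent_decay.
have C1 : 0 < C + 1 by lra.
have [z Dz xz] := domain_dense x (divr_gt0 e0 (mulr_gt0 (ltr0n R 2) C1)).
exists (Num.max k (2 * C * N (A z) / e + 1)) => l y; rewrite ge_max => /andP[kl lz] Dy hy.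
have l0 : 0 < l by rewrite (lt_le_trans k0).
have [Dd _] := genB hA Dy Dz.
have := hR _ _ kl Dd; rewrite resolvent_sub// hy.
have -> : r2 l *: x - (r2 l *: z - A z) = r2 l *: (x - z) + A z.
  by rewrite scalerBr opprB addrA addrAC.
have := ler_rnormD s (r2 l *: (x - z)) (A z); rewrite rnormZr (gtr0_norm l0) => h1 h2.
have h3 : N (y - z) <= C * N (x - z) + C / l * N (A z).
  apply: le_trans h2 _; apply: le_trans (ler_wpM2l (divr_ge0 C0 (ltW l0)) h1) _.
  by rewrite mulrDr mulrA divfK ?gt_eqF.
have h4 : C / l * N (A z) < e / 2.
  rewrite mulrAC ltr_pdivrMr//; move: lz; rewrite -lerBrDr ler_pdivrMr// => lz.
  by nra.
have := ler_rnormtri s y z x.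
move: xz; rewrite ltr_pdivlMr ?mulr_gt0// => xz.
rewrite (rnormB s x z) in h3.
by lra.
Qed.

Section Positive.
Variable (C : set X).
Hypotheses (Cc : closed C) (C0 : C 0) (CD : forall x y, C x -> C y -> C (x + y)).
Hypothesis CZ : forall (r : R) x, 0 <= r -> C x -> C (r2 r *: x).
Hypothesis Tpos : forall r : R, 0 <= r -> positive_op C C (T r).

Lemma lapl_pos l tau y : C y -> C (lapl l tau y).
Proof.
move=> Cy; apply: (bochner_integral_cone (measurable_oc 0 tau) (fin_oc 0 tau) Cc C0 CD CZ (lint _ _ _)).
apply: aeW => r /=; rewrite in_itv /= => /andP[_ rt].
by apply: Tpos; rewrite ?subr_ge0//; apply: CZ => //; exact: expR_ge0.
Qed.

(** As [tau] grows, [x] is the limit of [expR (- l tau) lapl l tau (l x - A x)],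
    which lies in the cone. *)
Lemma resolvent_pos w l x : exp_bounded w -> w < l -> D x -> C (r2 l *: x - A x) -> C x.
Proof.
move=> hw wl Dx Cy; apply: contrapT => nCx.
have [M M1 hM] := exp_bounded_pos hw; have M0 : 0 < M by rewrite (lt_le_trans ltr01).
have /(rnbhsP s)[e e0 he] : nbhs x (~` C).
  by apply: open_nbhs_nbhs; split=> //; exact: closed_openC.
have wl0 : 0 < l - w by lra.
pose tau := (M * N x / e) / (l - w).
have tau0 : 0 <= tau by rewrite !divr_ge0 ?mulr_ge0 ?rnorm_ge0 ?ltW.
have CV := lapl_pos l tau Cy.
rewrite lapl_resolvent// in CV.
apply: (he (x - r2 (expR (- (l * tau))) *: T tau x)); last first.
  have := CZ (expR_ge0 (- (l * tau))) CV.
  by rewrite scalerBr scalerA -of_realM -expRD addNr expR0 of_real1 scale1r.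
rewrite addrAC subrr add0r rnormN rnormZr ger0_norm ?expR_ge0//.
apply: le_lt_trans (ler_wpM2l (expR_ge0 _) (hM _ _ tau0)) _.
rewrite mulrA mulrCA -expRD.
have -> : - (l * tau) + w * tau = - (M * N x / e).
  by rewrite /tau; field; rewrite !gt_eqF.
have q1 : M * N x / e < expR (M * N x / e).
  by apply: lt_le_trans (expR_ge1Dx _); rewrite ltrDr.
by rewrite mulrAC expRN ltr_pdivrMr ?expR_gt0// -ltr_pdivrMl// mulrC.
Qed.

End Positive.
End Resolvent.

(** * Dirichlet operators of a boundary system *)

Section Boundary.
Context (R : realType) (K : numFieldType) (s : scalars R K).
Context (X dX U : completeNormedModType K).
Variable S : boundary_system s X dX U.
Local Notation N := (rnorm s).
Local Notation D := (DA S).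
Local Notation A := (Am S).

Lemma bs_generates : generates s D A (T S).
Proof. exact: A_generates. Qed.

Let hA := bs_generates.
Let hT : C0_semigroup (T S). Proof. by case: hA. Qed.

Lemma DmB x y : Dm S x -> Dm S y ->
  [/\ Dm S (x - y), A (x - y) = A x - A y & Q S (x - y) = Q S x - Q S y].
Proof.
move=> Dx Dy; have [_ Dl] := Dm_subspace S.
rewrite -scaleN1r addrC; split; first exact: Dl.
  by rewrite (Am_linear (-1) Dy Dx) scaleN1r addrC.
by rewrite (Q_linear (-1) Dy Dx) scaleN1r addrC.
Qed.

Lemma rho_solve l y : rhoA S l -> exists2 x, D x & l *: x - A x = y.
Proof. by case=> /(_ y)[x [[Dx hx] _]] _; exists x. Qed.

Lemma rho_inj l x y : rhoA S l -> D x -> D y -> l *: x - A x = l *: y - A y -> x = y.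
Proof.
move=> [/(_ (l *: y - A y))[z [_ hz]] _] Dx Dy e.
by rewrite -(hz x) ?(hz y).
Qed.

(** A bounding constant in [K] need be neither nonnegative nor real; its modulus
    bounds as well. *)
Lemma real_bound (C : K) (a b : R) : 0 <= a -> 0 <= b ->
  of_real s a <= C * of_real s b -> a <= real_part s `|C| * b.
Proof.
move=> a0 b0 h; rewrite -(le_of_real s) of_realM real_partK//.
apply: (le_trans h); have [->|n0] := eqVneq b 0; first by rewrite of_real0 !mulr0.
have bp : 0 < of_real s b by rewrite -(of_real0 s) lt_of_real lt_def n0.
rewrite ler_pM2r//; have [c0|nc] := boolP (0 <= C); first by rewrite ger0_norm.
have : 0 <= C * of_real s b by apply: (le_trans _ h); rewrite -(of_real0 s) le_of_real.
by rewrite pmulr_lge0// (negbTE nc).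
Qed.

Lemma rho_bound l : rhoA S l -> exists2 C : R, 0 <= C &
  forall x, D x -> N x <= C * N (l *: x - A x).
Proof.
move=> [_ [C hC]]; exists (real_part s `|C|) => [|x Dx].
  by rewrite -(le_of_real s) of_real0 real_partK.
by apply: real_bound; rewrite ?rnorm_ge0// -!normE; exact: hC.
Qed.

(** The resolvent [(l - A)^-1], when [l] lies in [rhoA]. *)
Definition Rsv (l : K) (y : X) : X := xget 0 [set x | D x /\ l *: x - A x = y].

Lemma RsvP l y : rhoA S l -> D (Rsv l y) /\ l *: Rsv l y - A (Rsv l y) = y.
Proof.
move=> hl; rewrite /Rsv; case: xgetP => [x _ //|/(_ _) h].
by have [x Dx hx] := rho_solve y hl; case: (h x).
Qed.

Lemma Rsv_eq l x y : rhoA S l -> D x -> l *: x - A x = y -> Rsv l y = x.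
Proof.
by move=> hl Dx hx; have [Dr hr] := RsvP y hl; apply: (rho_inj hl) => //; rewrite hr.
Qed.

Lemma Rsv_linear l : rhoA S l -> linear (Rsv l).
Proof.
move=> hl a x y; have [Dx hx] := RsvP x hl; have [Dy hy] := RsvP y hl.
have [Dz Az] := gen_linear hA a Dx Dy; apply: (Rsv_eq hl) => //.
rewrite Az scalerDr -[in RHS]hx -[in RHS]hy scalerBr !scalerA [l * a]mulrC.
by rewrite opprD addrACA.
Qed.

Lemma Rsv_continuous l : rhoA S l -> continuous (Rsv l).
Proof.
move=> hl; have [C C0 hC] := rho_bound hl.
apply: (bounded_continuous (s := s) (M := C)) => x y.
have -> : Rsv l x - Rsv l y = Rsv l (x - y).
  by rewrite -scaleN1r addrC -(Rsv_linear hl) scaleN1r addrC.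
by have [Dr hr] := RsvP (x - y) hl; rewrite -{2}hr hC.
Qed.

Lemma Rsv_sg l t x : rhoA S l -> 0 <= t -> Rsv l (T S t x) = T S t (Rsv l x).
Proof.
move=> hl t0; have [Dx hx] := RsvP x hl; have [DT AT] := gen_sg hA t0 Dx.
by apply: (Rsv_eq hl) => //; rewrite AT -linearZ -linearB hx.
Qed.

(** Any preimage of [y] under [Q] is brought into the kernel of [l - Am] by an
    element of the domain of [A], found by solving a resolvent equation. *)
Lemma Q_P l y : rhoA S l ->
  [/\ Dm S (Q_ S l y), A (Q_ S l y) = l *: Q_ S l y & Q S (Q_ S l y) = y].
Proof.
move=> hl; rewrite /Q_; case: xgetP => [x _ //|h].
have [x0 Dx0 Qx0] := Q_surjective S y.
have [d [Dd Qd] hd] := rho_solve (l *: x0 - A x0) hl.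
have [Dxd Axd Qxd] := DmB Dx0 Dd.
case: (h (x0 - d)); split=> //; last by rewrite Qxd Qd subr0.
have Ad : A d = l *: d - (l *: x0 - A x0) by rewrite -hd opprB addrCA subrr addr0.
by rewrite Axd scalerBr Ad opprB addrA [A x0 + _]addrC subrK.
Qed.

Lemma Q_eq l x y : rhoA S l -> Dm S x -> A x = l *: x -> Q S x = y -> Q_ S l y = x.
Proof.
move=> hl Dx Ax Qx; have [Dq Aq Qq] := Q_P y hl.
have [Dd Ad Qd] := DmB Dq Dx.
have D0 : D (Q_ S l y - x) by split; rewrite // Qd Qq Qx subrr.
have [D00 A00] := gen0 hA.
apply/eqP; rewrite -subr_eq0; apply/eqP; apply: (rho_inj hl) => //.
by rewrite Ad Aq Ax -scalerBr subrr A00 scaler0 subr0.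
Qed.

Lemma Q_linear_ l : rhoA S l -> linear (Q_ S l).
Proof.
move=> hl a x y; have [Dx Ax Qx] := Q_P x hl; have [Dy Ay Qy] := Q_P y hl.
have [_ Dl] := Dm_subspace S; apply: (Q_eq hl).
- exact: Dl.
- by rewrite (Am_linear a Dx Dy) Ax Ay scalerDr !scalerA mulrC.
- by rewrite (Q_linear a Dx Dy) Qx Qy.
Qed.

(** The closed graph theorem for [Q_ l], in the form of Zabreiko's lemma: the
    graph is closed because [Am] is closed and [Q] is continuous for the graph
    norm. *)
Lemma Q_bounded_ l : rhoA S l -> exists2 M : R, 0 < M &
  forall y, N (Q_ S l y) <= M * N y.
Proof.
move=> hl; have Ql := Q_linear_ hl.
have Q0 : Q_ S l 0 = 0.
  have [D00 A00] := gen0 hA; apply: (Q_eq hl); first by case: D00.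
  - by rewrite A00 scaler0.
  - by case: D00.
have QD x y : Q_ S l (x + y) = Q_ S l x + Q_ S l y by have := Ql 1 x y; rewrite !scale1r.
have QZ a x : Q_ S l (a *: x) = a *: Q_ S l x by have := Ql a x 0; rewrite !addr0 Q0 addr0.
apply: (@zabreiko _ _ s) => [x y|a x|u y c uy hc].
- by rewrite QD ler_rnormD.
- by rewrite QZ rnormZr.
pose x n := \sum_(k < n) Q_ S l (u k).
have xE n : x n = Q_ S l (\sum_(k < n) u k).
  by rewrite /x; elim: n => [|n IH]; rewrite ?big_ord0 ?Q0// !big_ord_recr /= QD IH.
pose b n := \sum_(k < n) N (Q_ S l (u k)).
have b_nd : nondecreasing_seq b.
  by apply/nondecreasing_seqP => n; rewrite /b big_ord_recr /= lerDl rnorm_ge0.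
have b_cvg : cvgn b.
  apply: nondecreasing_is_cvgn => //; exists c => _ [n _ <-]; exact: hc.
have xb i j : (i <= j)%N -> N (x j - x i) <= b j - b i.
  move=> /subnK <-; elim: (j - i)%N => [|k IH]; first by rewrite !subrr rnorm0.
  rewrite addSn /x /b !big_ord_recr /= addrAC [leRHS]addrAC.
  by apply: le_trans (ler_rnormD _ _ _) _; rewrite lerD2r.
have [z xz] : exists z : X, x @ \oo --> z.
  apply: (@rcauchy_cvg _ _ s) => e e0; have e2 : 0 < e / 2 by lra.
  have /cvgrPdist_lt /(_ _ e2)[n _ hn] := b_cvg.
  exists n => i j ni nj.
  wlog ij : i j ni nj / (i <= j)%N => [hw|].
    by case: (leqP i j) => ij; [exact: hw|rewrite rnormB; apply: hw => //; exact: ltnW].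
  rewrite rnormB; apply: le_lt_trans (xb _ _ ij) _.
  have := hn i ni; have := hn j nj; rewrite /= !ltr_norml => /andP[h1 h2] /andP[h3 h4].
  by lra.
have Axn n : Dm S (x n) /\ A (x n) = l *: x n by rewrite xE; case: (Q_P (\sum_(k < n) u k) hl).
have [Dz Az] : Dm S z /\ l *: z = A z.
  have xl : (x n, l *: x n) @[n --> \oo] --> (z, l *: z).
    by apply: cvg_pair => //; apply: cvgZr.
  apply: (@closed_cvg _ _ \oo _ _ _ (Am_closed (b := S)) _ _ xl).
  by apply: nearW => n /=; have [? ?] := Axn n.
have [C hC] := Q_bounded S.
have Qz : Q S z = y.
  apply: (cvg_unique _ _ uy) => //.
  have Qx n : Q S (x n) = \sum_(k < n) u k by rewrite xE; case: (Q_P (\sum_(k < n) u k) hl).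
  pose b' := real_part s `|C| * (1 + real_part s `|l|).
  have Qxz n : N (\sum_(k < n) u k - Q S z) <= b' * N (x n - z).
    have [Dxn Axn'] := Axn n; have [Dd Ad Qd] := DmB Dxn Dz.
    rewrite -Qx -Qd /b' -mulrA mulrDl mul1r -rnormZ scalerBr Az -Axn' -Ad.
    apply: real_bound; rewrite ?addr_ge0 ?rnorm_ge0//.
    by rewrite of_realD -!normE; exact: hC.
  apply: (@rcvg_dom _ _ s _ _ _ _ _ _ (fun n => b' * N (x n - z))).
    by apply: nearW => n; exact: Qxz.
  rewrite -[X in _ --> X](mulr0 b'); apply: cvgM; first exact: cvg_cst.
  by apply/(rcvg0P s).
have -> : Q_ S l y = z by apply: (Q_eq hl).
rewrite leNgt; apply/negP; rewrite -subr_gt0 => e0.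
move/(rcvgP s) : xz => /(_ _ e0)[n _ /(_ n (leqnn n))] /=.
have : N (x n) <= c by apply: le_trans (hc n); exact: rnorm_sum.
have := ler_rnorm_dist s z (x n); rewrite (rnormB s z); lra.
Qed.

Lemma B_linear l : rhoA S l -> linear (B_ S l).
Proof. by move=> hl a x y; rewrite /B_ linearP (Q_linear_ hl). Qed.

Lemma B_bounded_ l : rhoA S l -> exists2 M : R, 0 < M &
  forall v, N (B_ S l v) <= M * N v.
Proof.
move=> hl; have [M M0 hM] := Q_bounded_ hl.
have [M' M'0 hM'] := continuous_bounded s (B_bounded (b := S)).
exists (M * M') => [|v]; first exact: mulr_gt0.
by apply: le_trans (hM _) _; rewrite -mulrA ler_wpM2l ?hM' ?(ltW M0).
Qed.

Lemma B_continuous l : rhoA S l -> continuous (B_ S l).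
Proof.
move=> hl; have [M M0 hM] := B_bounded_ hl.
apply: (bounded_continuous (s := s) (M := M)) => x y.
have -> : B_ S l x - B_ S l y = B_ S l (x - y).
  by rewrite -scaleN1r addrC -(B_linear hl) scaleN1r addrC.
exact: hM.
Qed.

(** The resolvent identity for the Dirichlet operators: the two images have the
    same boundary value, so their difference lies in the domain of [A]. *)
Lemma B_diff l m v : rhoA S l -> rhoA S m ->
  B_ S l v - B_ S m v = Rsv l ((m - l) *: B_ S m v).
Proof.
move=> hl hm; have [Dl Al Ql] := Q_P (B S v) hl; have [Dm' Am' Qm] := Q_P (B S v) hm.
have [Dd Ad Qd] := DmB Dl Dm'.
apply/esym/(Rsv_eq hl); first by split; rewrite // Qd Ql Qm subrr.
rewrite Ad Al Am' -/(B_ S l v) -/(B_ S m v) scalerBr scalerBl opprB addrC addrA subrK.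
by [].
Qed.

End Boundary.

(** * Controllability maps *)

Section Convolution.
Context (R : realType) (K : numFieldType) (s : scalars R K).
Context (X dX U : completeNormedModType K).
Variable S : boundary_system s X dX U.
Variable p : \bar R.
Hypothesis p1 : (1 <= p)%E.
Local Notation mu := (@lebesgue_measure R).
Local Notation N := (rnorm s).
Local Notation D := (DA S).
Local Notation A := (Am S).
Local Notation BI D f := (bochner_integrable s D f).
Local Notation I D f := (bochner_integral s D f).

Let hA := bs_generates S.
Let hT : C0_semigroup (T S). Proof. by case: hA. Qed.

Definition integrand (l : K) (t : R) (u : R -> U) (r : R) : X :=
  T S (t - r) (B_ S l (u r)).

Lemma B_0 l : rhoA S l -> B_ S l 0 = 0.
Proof.
move=> hl; have := B_linear hl (-1) 0 0.
by rewrite scaleN1r addNr scaleN1r addNr.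
Qed.

Lemma integrand_integrable l (t a b : R) u : rhoA S l -> b <= t ->
  Lp s p `[a, b]%classic u -> BI `[a, b]%classic (integrand l t u).
Proof.
move=> hl bt hu; have [ba|ab] := ltP b a.
  have e : `[a, b]%classic = set0 :> set R by rewrite set_itv_ge// bnd_simp -ltNge.
  rewrite e; split.
    apply: (@eq_strongly_measurable _ _ _ _ (fun=> 0)) => //.
    by apply: simple_strongly_measurable; exact: is_simple_cst.
  by rewrite integral_set0 ltry.
have [M M0 hM] := B_bounded_ hl.
have ui := Lp_integrable p1 (measurable_cc a b) (fin_cc a b) hu.
have Bi : BI `[a, b]%classic (fun r => B_ S l (u r)).
  apply: (bochner_integrable_dom (measurable_cc a b) (ltW M0) _ _ ui) => //.
  by apply: strongly_measurable_comp; [exact: B_continuous|case: ui].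
apply: (orbit_integrable hT (measurable_cc a b) (le_trans ab bt) _ Bi).
by move=> r /=; rewrite in_itv /= => /andP[-> rb]; exact: le_trans bt.
Qed.

Lemma bint_zero (V : completeNormedModType K) (E : set R) (f : R -> V) :
  measurable (E : set (measurableTypeR R)) -> (mu E < +oo)%E ->
  (forall x, E x -> f x = 0) -> I E f = 0.
Proof.
move=> mE fE f0; have fi : BI E f.
  apply: (@eq_bochner_integrable _ _ _ _ _ (fun=> 0)) => [x /f0//|].
  apply: (@bochner_integrable_bounded _ _ _ _ _ _ _ _ 0) => //.
    by apply: simple_strongly_measurable; exact: is_simple_cst.
  by apply: aeW => x _; rewrite rnorm0.
apply/eqP; rewrite -(rnorm_eq0 s) eq_le rnorm_ge0 andbT.
apply: le_trans (bochner_integral_bound mE fE (lexx 0) fi _) _; last by rewrite mul0r.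
by apply: aeW => x /f0 ->; rewrite rnorm0.
Qed.

Lemma convolution_diff l m (t : R) u : rhoA S l -> rhoA S m ->
  Lp s p `[0, t]%classic u ->
  convolution S l t u - convolution S m t u = Rsv S l ((m - l) *: convolution S m t u).
Proof.
move=> hl hm hu; rewrite /convolution.
have il := integrand_integrable hl (lexx t) hu; have im := integrand_integrable hm (lexx t) hu.
have mD := measurable_cc 0 t; have fD := fin_cc 0 t.
have Ll : linear (fun x : X => Rsv S l ((m - l) *: x)).
  by move=> a x y; rewrite scalerDr scalerA mulrC -scalerA Rsv_linear.
pose L : {linear X -> X} := HB.pack (fun x : X => Rsv S l ((m - l) *: x))
  (GRing.isLinear.Build _ _ _ _ _ Ll).
have Lc : continuous L.
  move=> x; apply: (@continuous_comp _ _ _ (fun x : X => (m - l) *: x) (Rsv S l)).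
    exact: scaler_continuous.
  exact: Rsv_continuous.
rewrite -[RHS]/(L _) -(bochner_integral_op mD fD Lc im).
apply/eqP; rewrite subr_eq; apply/eqP.
rewrite -bochner_integralD//; last exact: bochner_integrable_op im.
apply: eq_bochner_integral => r /=; rewrite in_itv /= => /andP[_ rt].
rewrite /integrand /L /= -linearZ Rsv_sg ?subr_ge0// -linearD -B_diff// subrK.
by [].
Qed.

(** By [B_diff] under the integral sign, the two convolutions differ by a value
    of the resolvent. Hence neither admissibility nor the state reached depends
    on the point of the resolvent set used to write them. *)
Lemma convolution_change l m (t : R) u : rhoA S l -> rhoA S m ->
  Lp s p `[0, t]%classic u -> D (convolution S m t u) ->
  D (convolution S l t u) /\
  l *: convolution S l t u - A (convolution S l t u) =
  m *: convolution S m t u - A (convolution S m t u).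
Proof.
move=> hl hm hu; have := convolution_diff hl hm hu.
move: (convolution S l t u) (convolution S m t u) => zl zm e Dm.
have [Dr hr] := RsvP ((m - l) *: zm) hl.
have ze : zl = Rsv S l ((m - l) *: zm) - (- zm) by rewrite opprK -e subrK.
have [DN AN] := genZ hA (-1) Dm; rewrite !scaleN1r in DN AN.
have Dz : D zl by rewrite ze; case: (genB hA Dr DN).
split=> //; rewrite ze (resolvent_sub hA)// hr AN scalerN opprK opprD opprK scalerBl.
by rewrite addrA subrK.
Qed.

Definition admissible_at l t := forall u, Lp s p `[0, t]%classic u -> D (convolution S l t u).

Lemma admissible_change l m t : rhoA S l -> rhoA S m ->
  admissible_at m t -> admissible_at l t.
Proof.
by move=> hl hm h u hu; have [] := convolution_change hl hm hu (h u hu).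
Qed.

Lemma integrand_shift l t c u r :
  integrand l (t + c) (fun x => u (x - c)) r = integrand l t u (r - c).
Proof. by rewrite /integrand opprB [c - r]addrC addrA addrAC. Qed.

Lemma convolution_oc l (t : R) u : rhoA S l -> 0 <= t -> Lp s p `[0, t]%classic u ->
  convolution S l t u = I `]0, t]%classic (integrand l t u).
Proof. by move=> hl t0 hu; apply: bint_cc_oc => //; exact: integrand_integrable. Qed.

Lemma Lp_cc_oc (a b : R) (u : R -> U) :
  Lp s p `[a, b]%classic u -> Lp s p `]a, b]%classic u.
Proof. by apply: Lp_sub => //; exact: sub_oc_cc. Qed.

Lemma Lp_cc_sub (a b c d : R) (u : R -> U) : a <= c -> d <= b ->
  Lp s p `[a, b]%classic u -> Lp s p `[c, d]%classic u.
Proof.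
move=> ac db; apply: Lp_sub => // x /=; rewrite !in_itv /= => /andP[h1 h2].
by rewrite (le_trans ac)//= (le_trans h2).
Qed.

(** A control on the shorter interval is delayed until its end points agree and
    extended by zero. *)
Lemma admissible_le l (t t0 : R) : rhoA S l -> 0 <= t -> t <= t0 ->
  admissible_at l t0 -> admissible_at l t.
Proof.
move=> hl t_ge0 tt0 adm u hu; pose c := t0 - t.
have c0 : 0 <= c by rewrite subr_ge0.
have ct0 : c <= t0 by rewrite /c; lra.
have tc : t + c = t0 by rewrite /c addrCA subrr addr0.
pose u' r := if r <= c then 0 else u (r - c).
have hu' : Lp s p `[0, t0]%classic u'.
  apply: (Lp_ext (measurable_cc 0 t0) (E := `]c, t0]%classic)) => //.
  - by move=> x /=; rewrite !in_itv /= => /andP[cx ->]; rewrite (le_trans c0)// ltW.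
  - move=> x; rewrite /= !in_itv /= => /andP[x0 ->]; rewrite andbT /u' => /negP.
    by rewrite -leNgt => ->.
  apply: (eq_Lp (f := fun x => u (x - c))).
    by move=> x /=; rewrite in_itv /= => /andP[cx _]; rewrite /u' leNgt cx.
  rewrite -tc -[X in `]X, _]](add0r c) -shift_oc.
  by apply: Lp_shift => //; exact: Lp_cc_oc.
have := adm _ hu'; suff -> : convolution S l t0 u' = convolution S l t u by [].
have i' := integrand_integrable hl (lexx t0) hu'.
have i := integrand_integrable hl (lexx t) hu.
rewrite [LHS](bint_split_cc c0 ct0 i') bint_zero//; last first.
  move=> r /=; rewrite in_itv /= => /andP[_ rc].
  by rewrite /integrand /u' rc B_0// linear0.
rewrite add0r (convolution_oc hl t_ge0 hu).
rewrite -(bochner_integral_shift c (measurable_oc 0 t) (fin_oc 0 t) (BI_oc_cc i)).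
rewrite shift_oc add0r tc; apply: eq_bochner_integral => r /=.
rewrite in_itv /= => /andP[cr _].
by rewrite -integrand_shift tc /integrand /u' leNgt cr.
Qed.

Lemma convolution_split l (t a : R) u : rhoA S l -> 0 <= a -> a <= t ->
  Lp s p `[0, t]%classic u ->
  convolution S l t u =
  T S (t - a) (convolution S l a u) + I `]a, t]%classic (integrand l t u).
Proof.
move=> hl a0 at_ hu; have i := integrand_integrable hl (lexx t) hu.
have hua : Lp s p `[0, a]%classic u by apply: Lp_cc_sub hu.
have ia := integrand_integrable hl (lexx a) hua.
rewrite [LHS](bint_split_cc a0 at_ i); congr (_ + _).
have ta : 0 <= t - a by rewrite subr_ge0.
rewrite /convolution -(bochner_integral_op (measurable_cc 0 a) (fin_cc 0 a) (sg_continuous hT ta) ia).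
apply: eq_bochner_integral => r /=; rewrite in_itv /= => /andP[r0 ra].
by rewrite /integrand -(sgD hT) ?subr_ge0// addrA subrK.
Qed.

(** The control is cut at [t]; the semigroup preserves the domain, and the rest
    of the control is a delayed one. *)
Lemma admissible_add l (t t' : R) : rhoA S l -> 0 <= t -> 0 <= t' ->
  admissible_at l t -> admissible_at l t' -> admissible_at l (t + t').
Proof.
move=> hl t0 t0' adm adm' u hu.
have tt' : t <= t + t' by rewrite lerDl.
have hut : Lp s p `[0, t]%classic u by apply: Lp_cc_sub hu.
pose u' r := u (r - - t).
have hu' : Lp s p `[0, t']%classic u'.
  have hut' : Lp s p `[t, (t + t')]%classic u by apply: Lp_cc_sub hu.
  have := Lp_shift p1 (- t) (measurable_cc _ _) hut'.
  by rewrite shift_cc subrr addrAC subrr add0r.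
rewrite (convolution_split hl t0 tt' hu).
have tt0 : 0 <= t + t' - t by rewrite subr_ge0.
have [D1 _] := gen_sg hA tt0 (adm _ hut).
have D2 : D (I `]t, (t + t')]%classic (integrand l (t + t') u)).
  suff <- : convolution S l t' u' = I `]t, (t + t')]%classic (integrand l (t + t') u).
    exact: adm'.
  rewrite (convolution_oc hl t0' hu').
  have i' := BI_oc_cc (integrand_integrable hl (lexx t') hu').
  rewrite -(bochner_integral_shift t (measurable_oc 0 t') (fin_oc 0 t') i').
  rewrite shift_oc add0r [t' + t]addrC; apply: eq_bochner_integral => r _.
  by rewrite /integrand /u' opprK subrK opprB [t' + _]addrA [t + t']addrC.
have [+ _] := gen_linear hA 1 D1 D2; by rewrite scale1r.
Qed.

Lemma admissible_all : boundary_admissible S p ->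
  exists2 m, rhoA S m & forall l t, rhoA S l -> 0 <= t -> admissible_at l t.
Proof.
move=> [t0 [m [t00 hm adm]]]; exists m => // l t hl t_ge0.
have {}adm : admissible_at l t0 by exact: admissible_change hm adm.
have admn n : admissible_at l (n.+1%:R * t0).
  elim: n => [|n IH]; first by rewrite mul1r.
  rewrite -natr1 mulrDl mul1r; apply: admissible_add => //; last exact: ltW.
  by rewrite mulr_ge0// ltW.
apply: (admissible_le hl t_ge0 _ (admn (Num.truncn (t / t0)))).
by rewrite -ler_pdivrMr// ltW// Num.Theory.truncnS_gt.
Qed.

Lemma controllability_mapE l (t : R) u : boundary_admissible S p -> rhoA S l -> 0 <= t ->
  Lp s p `[0, t]%classic u ->
  controllability_map S t u = l *: convolution S l t u - A (convolution S l t u).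
Proof.
move=> adm hl t0 hu; have [m0 hm0 hadm] := admissible_all adm.
have hm := xgetPex 0 (ex_intro (rhoA S) m0 hm0).
rewrite /controllability_map; move: (xget 0 _) hm => m hm.
have [_ ->] := convolution_change hm hl hu (hadm l t hl t0 u hu).
by [].
Qed.

End Convolution.

(** * Positive reachable states and exponential monotonicity *)

Section Positivity.
Context (R : realType) (K : numFieldType) (s : scalars R K).
Context (X dX U : completeNormedModType K) (Xp : set X) (Up : set U).
Variable S : boundary_system s X dX U.
Variable p : \bar R.
Hypotheses (hX : normed_lattice_cone s Xp) (cX : closed Xp).
Hypothesis hU : normed_lattice_cone s Up.
Hypothesis p1 : (1 <= p)%E.
Hypothesis adm : boundary_admissible S p.
Local Notation mu := (@lebesgue_measure R).
Local Notation N := (rnorm s).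
Local Notation r2 := (of_real s).
Local Notation D := (DA S).
Local Notation A := (Am S).
Local Notation BI D f := (bochner_integrable s D f).
Local Notation I D f := (bochner_integral s D f).

Let hA := bs_generates S.
Let hT : C0_semigroup (T S). Proof. by case: hA. Qed.

Definition exp_monotone (l t : R) : Prop :=
  forall a b : R, 0 <= a -> a <= b -> b <= t ->
  positive_op Up Xp (fun v =>
    r2 (expR (l * b)) *: T S (t - b) (B_ S (r2 l) v)
    - r2 (expR (l * a)) *: T S (t - a) (B_ S (r2 l) v)).

(** The vector to be shown positive is the state reached by the exponential
    control in direction [v], switched on during [ ]a, b] ]; see
    [orbit_expc_int]. *)
Lemma reach_exp_monotone (l t : R) : rhoA S (r2 l) -> 0 <= t ->
  exact_reach_at S p Up t `<=` Xp -> exp_monotone l t.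
Proof.
move=> hl t0 reach a b a0 ab bt v pv; apply: reach.
pose u (r : R) : U := if (a < r) && (r <= b) then expc s l v r else 0.
have at_ := le_trans ab bt; have b0 := le_trans a0 ab.
have hu : Lp s p `[0, t]%classic u.
  apply: (Lp_ext (measurable_cc 0 t) (E := `]a, b]%classic)) => //.
  - move=> x /=; rewrite !in_itv /= => /andP[ax xb].
    by rewrite (le_trans a0 (ltW ax)) (le_trans xb).
  - by move=> x _ /=; rewrite in_itv /= /u => /negP/negbTE ->.
  apply: (eq_Lp (f := expc s l v)).
    by move=> x /=; rewrite in_itv /= /u => ->.
  apply: (Lp_bounded p1 (C := expR (`|l| * (`|a| + `|b|)) * N v)) => //.
    exact: expc_strongly_measurable.
  by move=> x /=; rewrite in_itv /= => /andP[ax xb]; apply: expc_bound => //; exact: ltW.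
exists u.
  split=> //; apply: aeW => x _; rewrite /u; case: ifP => _; last exact: cone0 hU.
  by apply: (coneZ hU) => //; exact: expR_ge0.
rewrite (controllability_mapE p1 adm hl t0 hu).
have i := integrand_integrable p1 hl (lexx t) hu.
have -> : convolution S (r2 l) t u =
    I `]a, b]%classic (fun r => T S (t - r) (expc s l (B_ S (r2 l) v) r)).
  have ia : BI `]a, t]%classic (integrand S (r2 l) t u).
    apply: bochner_integrable_sub i => // x /=; rewrite !in_itv /= => /andP[ax ->].
    by rewrite andbT (le_trans a0)// ltW.
  rewrite [LHS](bint_split_cc a0 at_ i) (bint_split_oc ab bt ia).
  rewrite bint_zero//; last first.
    move=> r /=; rewrite in_itv /= => /andP[_ ra].
    by rewrite /integrand /u ltNge ra /= (B_0 hl) linear0.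
  rewrite add0r [X in _ + X]bint_zero//; last first.
    move=> r /=; rewrite in_itv /= => /andP[br _].
    by rewrite /integrand /u [r <= b]leNgt br andbF (B_0 hl) linear0.
  rewrite addr0; apply: eq_bochner_integral => r /=; rewrite in_itv /= => rab.
  rewrite /integrand /u rab /expc; congr (T S _ _).
  have := B_linear hl (r2 (expR (l * r))) v 0.
  by rewrite (B_0 hl) !addr0.
by case: (orbit_expc_int hA l (B_ S (r2 l) v) ab bt).
Qed.

Lemma rdiff_linear l h : linear (fun x => x - rsg s (T S) l h x).
Proof.
by move=> a x y /=; rewrite rsg_linear scalerBr opprD addrACA.
Qed.

Lemma rdiff_continuous l h : 0 <= h -> continuous (fun x => x - rsg s (T S) l h x).
Proof.
move=> h0 x; apply: cvgB; first exact: cvg_id.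
exact: (@rsg_continuous _ _ s _ _ hT l h h0).
Qed.

Lemma pos_expZ (a c : R) x y : Xp (r2 (expR a) *: x - r2 (expR c) *: y) ->
  forall d : R, Xp (r2 (expR (a + d)) *: x - r2 (expR (c + d)) *: y).
Proof.
move=> h d; have := coneZ hX (expR_ge0 d) h.
by rewrite scalerBr !scalerA -!of_realM -!expRD (addrC d a) (addrC d c).
Qed.

Lemma cone_right_limit (f : R -> X) (y : X) (a : R) : 0 < a ->
  f h @[h --> 0^'+] --> y -> (forall h, 0 < h -> h < a -> Xp (f h)) -> Xp y.
Proof.
move=> a0 fy pf; apply: (@closed_cvg _ _ (0 : R)^'+ _ f Xp cX _ _ fy).
by apply/near_rightP; exists a.
Qed.

Lemma sg_right_limit (f : R -> X) (y : X) (a : R) : 0 < a ->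
  f h @[h --> 0^'+] --> y -> T S (a - h) (f h) @[h --> 0^'+] --> T S a y.
Proof.
move=> a0 /(rcvg_rightP s) fy; apply/(rcvg_rightP s) => e e0.
have [M M1 hM] := @sg_bounded _ _ s _ _ hT _ (ltW a0).
have M0 : 0 < M by rewrite (lt_le_trans ltr01).
have e2 : 0 < e / 2 by lra.
have [d1 d10 h1] := fy _ (divr_gt0 e2 M0).
have [d2 d20 h2] := @sg_strongly_continuous _ _ s _ _ hT y _ _ (ltW a0) e2.
exists (Num.min a (Num.min d1 d2)) => [|h h0]; first by rewrite !lt_min a0 d10 d20.
rewrite !lt_min => /and3P[ha hd1 hd2].
have ah : 0 <= a - h by lra.
have := ler_rnormtri s (T S (a - h) (f h)) (T S (a - h) y) (T S a y).
have : N (T S (a - h) y - T S a y) < e / 2.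
  by apply: h2 => //; rewrite addrAC subrr add0r normrN gtr0_norm.
have : N (T S (a - h) (f h) - T S (a - h) y) < e / 2.
  rewrite -linearB; apply: le_lt_trans (hM _ _ ah _) _; first by lra.
  by rewrite mulrC -ltr_pdivlMr// h1.
by lra.
Qed.

(** Write the state as the limit of difference quotients of the rescaled
    semigroup applied to the convolution, and carry these under the integral
    sign. The difference quotient at delay [h] compares the orbits issued at
    times [r - h] and [r], which requires [h <= r]. For the part of the control
    before [t / 2] it is therefore composed with [T (t / 2 - h)] in place of
    [T (t / 2)], so as to compare the times [r] and [r + h] instead. The
    comparison is made pointwise under the integral, because step functions are
    not dense in [Lp] for [p = +oo]. *)
Lemma exp_monotone_reach (l t : R) : rhoA S (r2 l) -> 0 < t ->
  exp_monotone l t -> exact_reach_at S p Up t `<=` Xp.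
Proof.
move=> hl t0 mono _ [u [hu up] <-]; have t_ge0 := ltW t0.
rewrite (controllability_mapE p1 adm hl t_ge0 hu).
have [m hm hadm] := admissible_all p1 adm.
pose a := t / 2; have a0 : 0 < a by rewrite /a; lra.
have at_ : a <= t by rewrite /a; lra.
have tE : t = a + a by rewrite /a; field.
have ta : t - a = a by rewrite [LHS](congr1 (fun x => x - a) tE) addrK.
have hua : Lp s p `[0, a]%classic u by apply: (Lp_cc_sub p1 _ _ hu).
pose c := convolution S (r2 l) a u; pose z := convolution S (r2 l) t u.
have Dc : D c by exact: (hadm _ _ hl (ltW a0)).
have Dz : D z by exact: (hadm _ _ hl t_ge0).
pose z2 := I `]a, t]%classic (integrand S (r2 l) t u).
have zE : z = T S a c + z2 by rewrite /z (convolution_split p1 hl (ltW a0) at_ hu) ta.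
have [D1 A1] := gen_sg hA (ltW a0) Dc.
have D2 : D z2.
  have -> : z2 = z - T S a c by rewrite zE addrAC subrr add0r.
  by case: (genB hA Dz D1).
have -> : r2 l *: z - A z = T S a (r2 l *: c - A c) + (r2 l *: z2 - A z2).
  have [_ Az] := gen_linear hA 1 D1 D2; rewrite !scale1r -zE in Az.
  by rewrite Az zE A1 scalerDr linearB linearZ /= opprD addrACA.
have ia := integrand_integrable p1 hl (lexx a) hua.
have iz : BI `]a, t]%classic (integrand S (r2 l) t u).
  exact: (BI_oc_cc (integrand_integrable p1 hl (lexx t) (Lp_cc_sub p1 (ltW a0) (lexx t) hu))).
apply: (coneD hX).
  have /(gen_rsgP hA) hc : D c /\ r2 l *: c - A c = r2 l *: c - A c by [].
  apply: (@cone_right_limit (fun h => T S (a - h) (r2 h^-1 *: (c - rsg s (T S) l h c))) _ a) => //.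
    exact: sg_right_limit.
  move=> h h0 ha; have ah : 0 <= a - h by lra.
  rewrite linearZ; apply: (coneZ hX); first by rewrite invr_ge0 ltW.
  pose L : {linear X -> X} := HB.pack (fun x => x - rsg s (T S) l h x)
    (GRing.isLinear.Build _ _ _ _ _ (rdiff_linear l h)).
  have Lc : continuous L by exact: (@rdiff_continuous l h (ltW h0)).
  have mD := measurable_cc 0 a; have fD := fin_cc 0 a.
  have iL := bochner_integrable_op mD Lc ia.
  rewrite -[c - _]/(L c) /c -(bochner_integral_op mD fD Lc ia).
  rewrite -(bochner_integral_op mD fD (sg_continuous hT ah) iL).
  apply: (bochner_integral_cone mD fD cX (cone0 hX) (coneD hX) (coneZ hX)).
    exact: (bochner_integrable_op mD (sg_continuous hT ah) iL).
  apply: ae_imply up => r pu /=; rewrite in_itv /= => /andP[r0 ra].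
  have rt : r <= t by exact: le_trans at_.
  have {}pu : Up (u r) by apply: pu; rewrite /= in_itv /= r0.
  have r0h : r <= r + h by rewrite lerDl ltW.
  have rht : r + h <= t by lra.
  (* The hypothesis at the times [r <= r + h], rescaled. *)
  have := pos_expZ (mono _ _ r0 r0h rht _ pu) (- (l * (r + h))).
  rewrite addrN expR0 of_real1 scale1r /rsg /integrand.
  have ar : 0 <= a - r by lra.
  have har : 0 <= h + (a - r) by lra.
  rewrite [T S (a - h) (_ - _)]linearB [T S (a - h) (_ *: _)]linearZ /=.
  rewrite -(sgD hT _ (ltW h0) ar) -(sgD hT _ ah ar) -(sgD hT _ ah har).
  have -> : l * r - l * (r + h) = - l * h by ring.
  have -> : t - (r + h) = a - h + (a - r) by rewrite tE; ring.
  have -> : t - r = a - h + (h + (a - r)) by rewrite tE; ring.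
  by [].
have /(gen_rsgP hA) h2 : D z2 /\ r2 l *: z2 - A z2 = r2 l *: z2 - A z2 by [].
apply: (@cone_right_limit (fun h => r2 h^-1 *: (z2 - rsg s (T S) l h z2)) _ a) => //.
move=> h h0 ha.
apply: (coneZ hX); first by rewrite invr_ge0 ltW.
pose L : {linear X -> X} := HB.pack (fun x => x - rsg s (T S) l h x)
  (GRing.isLinear.Build _ _ _ _ _ (rdiff_linear l h)).
have Lc : continuous L by exact: (@rdiff_continuous l h (ltW h0)).
have mD := measurable_oc a t; have fD := fin_oc a t.
rewrite -[z2 - _]/(L z2) /z2 -(bochner_integral_op mD fD Lc iz).
apply: (bochner_integral_cone mD fD cX (cone0 hX) (coneD hX) (coneZ hX)).
  exact: (bochner_integrable_op mD Lc iz).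
apply: ae_imply up => r pu /=; rewrite in_itv /= => /andP[ar rt].
have {}pu : Up (u r).
  by apply: pu; rewrite /= in_itv /= rt andbT; lra.
have rh0 : 0 <= r - h by lra.
have rh : r - h <= r by lra.
(* The hypothesis at the times [r - h <= r], rescaled. *)
have := pos_expZ (mono _ _ rh0 rh rt _ pu) (- (l * r)).
rewrite addrN expR0 of_real1 scale1r /rsg /integrand.
rewrite -(sgD hT) ?(ltW h0) ?subr_ge0//.
have -> : l * (r - h) + - (l * r) = - l * h by ring.
by have -> : t - (r - h) = h + (t - r) by ring.
Qed.

End Positivity.

(** * Positive semigroups *)

Section GrowthBound.
Context (R : realType) (K : numFieldType) (s : scalars R K).
Context (X : completeNormedModType K) (T : R -> {linear X -> X}).

Lemma growth_boundP (l : R) : (growth_bound s T < l%:E)%E ->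
  exists2 w, exp_bounded s T w & w < l.
Proof.
move=> /ereal_inf_lt[_ [w [M hM] <-]]; rewrite lte_fin => wl; exists w => //.
exists M => t x t0; rewrite -(le_of_real s) of_realM -!(normE s); exact: hM.
Qed.

Lemma growth_bound_lt (w l : R) : exp_bounded s T w -> w < l -> (growth_bound s T < l%:E)%E.
Proof.
move=> [M hM] wl; apply: (@le_lt_trans _ _ w%:E); last by rewrite lte_fin.
apply: ereal_inf_lbound; exists w => //; exists M => t t0 x.
by rewrite !(normE s) -of_realM le_of_real; exact: hM.
Qed.

End GrowthBound.

Section PositiveSemigroup.
Context (R : realType) (K : numFieldType) (s : scalars R K).
Context (X dX U : completeNormedModType K) (Xp : set X) (Up : set U).
Variable S : boundary_system s X dX U.
Hypotheses (hX : normed_lattice_cone s Xp) (cX : closed Xp).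
Local Notation N := (rnorm s).
Local Notation r2 := (of_real s).
Local Notation D := (DA S).
Local Notation A := (Am S).

Let hA := bs_generates S.
Let hT : C0_semigroup (T S). Proof. by case: hA. Qed.

Lemma rho_growth_bound (l : R) : (omega0 S < l%:E)%E -> rhoA S (r2 l).
Proof. by move=> /growth_boundP[w hw wl]; exact: (resolvent_real hA hw). Qed.

Lemma growth_bound_finite : exists l : R, (omega0 S < l%:E)%E.
Proof.
have [M [w [_ _ hM]]] := sg_exp_bound s hT; exists (w + 1).
by apply: (@growth_bound_lt _ _ _ _ _ w); [exists M|rewrite ltrDl].
Qed.

Definition exp_dominates (l tau : R) : Prop := forall r : R, 0 <= r -> r <= tau ->
  positive_op Up Xp (fun v => r2 (expR (l * r)) *: B_ S (r2 l) v - T S r (B_ S (r2 l) v)).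

Lemma exp_monotone_dominates (l t : R) : exp_monotone Xp Up S l t -> exp_dominates l t.
Proof.
move=> mono r r0 rt v pv.
have t0 : 0 <= t - r by rewrite subr_ge0.
have rt' : t - r <= t by rewrite lerBlDr lerDl.
have := pos_expZ hX (mono _ _ t0 rt' (lexx t) _ pv) (- (l * (t - r))).
rewrite subrr (sg0 hT) (subrr (l * _)) expR0 of_real1 scale1r.
have -> : l * t - l * (t - r) = l * r by ring.
by have -> : t - (t - r) = r by ring.
Qed.

Section Positive.
Hypothesis Tpos : forall r : R, 0 <= r -> positive_op Xp Xp (T S r).

Lemma exp_dominates_monotone (l t : R) : exp_dominates l t -> exp_monotone Xp Up S l t.
Proof.
move=> dom a b a0 ab bt v pv.
have ba : 0 <= b - a by rewrite subr_ge0.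
have bat : b - a <= t by lra.
have tb : 0 <= t - b by rewrite subr_ge0.
have := Tpos tb (dom _ ba bat _ pv); rewrite linearB linearZ /= -(sgD hT)//.
move/(coneZ hX (expR_ge0 (l * a))); rewrite scalerBr scalerA -of_realM -expRD.
have -> : l * a + l * (b - a) = l * b by ring.
by have -> : t - b + (b - a) = t - a by ring.
Qed.

(** This is [expR (l (r + q)) - T (r + q) =
    expR (l q) (expR (l r) - T r) + T r (expR (l q) - T q)]. *)
Lemma exp_dominatesD (l r q : R) v : 0 <= r -> 0 <= q ->
  Xp (r2 (expR (l * r)) *: B_ S (r2 l) v - T S r (B_ S (r2 l) v)) ->
  Xp (r2 (expR (l * q)) *: B_ S (r2 l) v - T S q (B_ S (r2 l) v)) ->
  Xp (r2 (expR (l * (r + q))) *: B_ S (r2 l) v - T S (r + q) (B_ S (r2 l) v)).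
Proof.
move=> r0 q0 hr hq; have := Tpos r0 hq; rewrite linearB linearZ /= -(sgD hT)//.
move/(coneD hX (coneZ hX (expR_ge0 (l * q)) hr)).
rewrite scalerBr scalerA -of_realM -expRD addrA subrK.
by rewrite -mulrDr [q + r]addrC.
Qed.

Lemma exp_dominates_all (l tau t : R) : 0 < tau -> exp_dominates l tau -> exp_dominates l t.
Proof.
move=> tau0 dom r r0 _ v pv; pose n := Num.truncn (r / tau).
have rt0 : 0 <= r / tau by rewrite divr_ge0// ltW.
have nle : n%:R <= r / tau by rewrite Num.Theory.truncn_le.
have rlt : r / tau < n.+1%:R by exact: Num.Theory.truncnS_gt.
have step k : Xp (r2 (expR (l * (k%:R * tau))) *: B_ S (r2 l) v
    - T S (k%:R * tau) (B_ S (r2 l) v)).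
  elim: k => [|k IH].
    by rewrite mul0r mulr0 expR0 of_real1 scale1r (sg0 hT) subrr; exact: cone0 hX.
  rewrite -natr1 mulrDl mul1r; apply: exp_dominatesD => //.
  - by rewrite mulr_ge0// ltW.
  - exact: ltW.
  - by apply: dom => //; exact: ltW.
have -> : r = n%:R * tau + (r - n%:R * tau) by rewrite addrCA subrr addr0.
have q0 : 0 <= r - n%:R * tau by rewrite subr_ge0 -ler_pdivlMr.
apply: exp_dominatesD => //; first by rewrite mulr_ge0// ltW.
apply: dom => //.
by rewrite lerBlDl -[X in _ <= _ + X]mul1r -mulrDl natr1 -ler_pdivrMr// ltW.
Qed.

(** By the resolvent identity [B_m = (l - A) (m - A)^-1 B_l], a limit of
    difference quotients at [0] of the rescaled semigroup. The positive resolvent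
    is applied before the limit, since [B_l v] is not in the domain of [A]. *)
Lemma exp_dominates_B_pos (l tau m : R) : (omega0 S < l%:E)%E -> 0 < tau -> l <= m ->
  exp_dominates l tau -> positive_op Up Xp (B_ S (r2 m)).
Proof.
move=> wl tau0 lm dom v pv.
have hl := rho_growth_bound wl.
have wm : (omega0 S < m%:E)%E by rewrite (lt_le_trans wl)// lee_fin.
have hm := rho_growth_bound wm; have [w hw wm'] := growth_boundP wm.
pose y := B_ S (r2 l) v; pose x := Rsv S (r2 m) y; have [Dx hx] := RsvP y hm.
have -> : B_ S (r2 m) v = r2 l *: x - A x.
  have e := B_diff v hm hl.
  have RL := Rsv_linear hm (r2 l - r2 m) y 0.
  have R0 : Rsv S (r2 m) 0 = 0.
    by have := Rsv_linear hm 1 0 0; rewrite !scale1r addr0 -[LHS]addr0 => /addrI.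
  rewrite R0 !addr0 -e -/y -/x scalerBl in RL.
  by move: RL => /(congr1 (fun z => z + y)); rewrite subrK -hx => ->; rewrite addrA subrK.
have /(gen_rsgP hA) lim : D x /\ r2 l *: x - A x = r2 l *: x - A x by [].
apply: (cone_right_limit cX tau0 lim) => h h0 ht.
apply: (coneZ hX); first by rewrite invr_ge0 ltW.
have -> : x - rsg s (T S) l h x = Rsv S (r2 m) (y - rsg s (T S) l h y).
  apply/esym.
  have := Rsv_linear hm (- r2 (expR (- l * h))) (T S h y) y.
  rewrite (Rsv_sg _ hm (ltW h0)) -/x /rsg !scaleNr.
  by rewrite [- _ + y]addrC [- _ + x]addrC.
have [Dz hz] := RsvP (y - rsg s (T S) l h y) hm.
apply: (resolvent_pos hA cX (cone0 hX) (coneD hX) (coneZ hX) Tpos hw wm' Dz).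
rewrite hz; have := pos_expZ hX (a := l * h) (c := 0) (x := y) (y := T S h y).
rewrite expR0 of_real1 scale1r => /(_ (dom _ (ltW h0) (ltW ht) _ pv)) /(_ (- (l * h))).
by rewrite addrN expR0 of_real1 scale1r add0r /rsg mulNr.
Qed.

(** For [x = m (m - A)^-1 B_l v] the resolvent identity gives
    [l x - A x = m B_m v >= 0], so that [expR (l r) x - T r x] is positive by
    [lapl_resolvent]; as [m] grows, [x] tends to [B_l v]. *)
Lemma B_pos_dominates (l t : R) : (omega0 S < l%:E)%E ->
  (forall m, l <= m -> positive_op Up Xp (B_ S (r2 m))) -> exp_dominates l t.
Proof.
move=> wl pos r r0 _ v pv; pose y := B_ S (r2 l) v.
have hl := rho_growth_bound wl.
have [L LE] : exists L : X -> X, forall x, L x = r2 (expR (l * r)) *: x - T S r x by eexists.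
have Lc : continuous L.
  move=> x; rewrite (_ : L = (fun x => r2 (expR (l * r)) *: x - T S r x)); last exact/funext.
  apply: cvgB; last exact: (sg_continuous hT r0).
  by apply: cvgZr; exact: cvg_id.
rewrite -LE; apply: contrapT => nL.
have /(rnbhsP s)[e e0 he] : nbhs y (L @^-1` (~` Xp)).
  by apply: Lc; apply: open_nbhs_nbhs; split=> //; exact: closed_openC.
have [m0 hm0] := resolvent_to_id hA y e0.
pose m := Num.max m0 (Num.max l 1).
have mm0 : m0 <= m by rewrite le_max lexx.
have ml : l <= m by rewrite !le_max lexx orbT.
have m1 : 1 <= m by rewrite !le_max lexx !orbT.
have wm : (omega0 S < m%:E)%E by rewrite (lt_le_trans wl)// lee_fin.
have hm := rho_growth_bound wm.
have [Dx hx] := RsvP (r2 m *: y) hm; set x := Rsv S (r2 m) (r2 m *: y) in Dx hx.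
apply: (he x (hm0 _ _ mm0 Dx hx)).
rewrite /= LE -(lapl_resolvent hA _ r0 Dx).
apply: (lapl_pos hA cX (cone0 hX) (coneD hX) (coneZ hX) Tpos).
have RZ c : Rsv S (r2 m) (c *: y) = c *: Rsv S (r2 m) y.
  have := Rsv_linear hm c y 0.
  have R0 : Rsv S (r2 m) 0 = 0.
    by have := Rsv_linear hm 1 0 0; rewrite !scale1r addr0 -[LHS]addr0 => /addrI.
  by rewrite R0 !addr0.
have -> : r2 l *: x - A x = r2 m *: B_ S (r2 m) v.
  have := B_diff v hm hl; rewrite -/y RZ => /(congr1 (fun z => r2 m *: z + r2 m *: y)).
  rewrite scalerBr subrK => ->; rewrite -hx scalerA mulrC -scalerA -RZ -/x.
  by rewrite scalerBl addrA subrK.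
by apply: (coneZ hX); [rewrite (le_trans ler01)|exact: pos].
Qed.

End Positive.
End PositiveSemigroup.

Section ReachabilityCone.
Context (R : realType) (K : numFieldType) (s : scalars R K).
Context (X dX U : completeNormedModType K) (Xp : set X) (Up : set U).
Variable S : boundary_system s X dX U.
Variable p : \bar R.
Hypotheses (hX : normed_lattice_cone s Xp) (cX : closed Xp).
Hypothesis hU : normed_lattice_cone s Up.
Hypothesis p1 : (1 <= p)%E.
Hypothesis adm : boundary_admissible S p.
Local Notation r2 := (of_real s).

Let hA := bs_generates S.

Lemma closure_sub_cone (E : set X) : E `<=` Xp -> closure E `<=` Xp.
Proof. by move=> EX; apply: subset_trans cX; exact: closure_subset. Qed.

(** The union over all times includes [0], at which only [0] is reached. *)
Lemma exact_reach0 : exact_reach_at S p Up 0 `<=` Xp.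
Proof.
move=> _ [u [hu _] <-]; have [l wl] := growth_bound_finite S.
rewrite (controllability_mapE p1 adm (rho_growth_bound wl) (lexx 0) hu).
have [D0 A0] := gen0 hA.
rewrite /convolution bint_point A0 scaler0 subr0; exact: cone0 hX.
Qed.

Lemma exp_monotone_exact_reach (l : R) : rhoA S (r2 l) ->
  (forall t, exp_monotone Xp Up S l t) -> exact_reach S p Up `<=` Xp.
Proof.
move=> hl mono x [t /= t0]; have [->|tn] := eqVneq t 0; first exact: exact_reach0.
move=> hx.
by apply: (exp_monotone_reach hX cX p1 adm hl _ (mono t) hx); rewrite lt_def tn.
Qed.

End ReachabilityCone.

(** * The characterization of positive reachability *)

Theorem proposition4p3 (R : realType) (K : numFieldType) (s : scalars R K)
    (X dX U : completeNormedModType K) (Xp : set X) (Up : set U)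
    (S : boundary_system s X dX U) (p : \bar R) (t : R)
    (X_lattice : banach_lattice s Xp) (U_lattice : banach_lattice s Up)
    (p_ge1 : (1 <= p)%E) (B_admissible : boundary_admissible S p)
    (t_gt0 : 0 < t) :
  [<-> exact_reach_at S p Up t `<=` Xp;
       approx_reach_at S p Up t `<=` Xp;
       exists l : R, rhoA S (of_real s l) /\
         forall a b : R, 0 <= a -> a <= b -> b <= t ->
         positive_op Up Xp (fun v =>
           of_real s (expR (l * b)) *: T S (t - b) (B_ S (of_real s l) v)
           - of_real s (expR (l * a)) *: T S (t - a) (B_ S (of_real s l) v))]
  /\
  ((forall r : R, 0 <= r -> positive_op Xp Xp (T S r)) ->
   [<-> exact_reach_at S p Up t `<=` Xp;
        approx_reach_at S p Up t `<=` Xp;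
        exists l : R, rhoA S (of_real s l) /\
          forall a b : R, 0 <= a -> a <= b -> b <= t ->
          positive_op Up Xp (fun v =>
            of_real s (expR (l * b)) *: T S (t - b) (B_ S (of_real s l) v)
            - of_real s (expR (l * a)) *: T S (t - a) (B_ S (of_real s l) v));
        exact_reach S p Up `<=` Xp;
        approx_reach S p Up `<=` Xp;
        exists (l tau : R), [/\ (omega0 S < l%:E)%E, 0 < tau &
          forall r : R, 0 <= r -> r <= tau ->
          positive_op Up Xp (fun v =>
            of_real s (expR (l * r)) *: B_ S (of_real s l) v
            - T S r (B_ S (of_real s l) v))];
        exists l0 : R, (omega0 S < l0%:E)%E /\
          forall l : R, l0 <= l ->
          positive_op Up Xp (B_ S (of_real s l))]).
Proof.
have [hX cX] := banach_lattice_closed X_lattice.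
have [hU _] := banach_lattice_closed U_lattice.
have [w hw] := growth_bound_finite S; have rw := rho_growth_bound hw.
have reach_mono l : (omega0 S < l%:E)%E -> exact_reach_at S p Up t `<=` Xp ->
    exp_monotone Xp Up S l t.
  by move=> wl; apply: reach_exp_monotone => //; [exact: rho_growth_bound|exact: ltW].
have exact_approx : exact_reach_at S p Up t `<=` Xp -> approx_reach_at S p Up t `<=` Xp.
  exact: closure_sub_cone.
have approx_mono : approx_reach_at S p Up t `<=` Xp ->
    exists l : R, rhoA S (of_real s l) /\ exp_monotone Xp Up S l t.
  by move=> ha; exists w; split=> //; apply: reach_mono => // x /subset_closure; exact: ha.
have mono_reach : (exists l : R, rhoA S (of_real s l) /\ exp_monotone Xp Up S l t) ->
    exact_reach_at S p Up t `<=` Xp.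
  by move=> [l [hl mono]]; exact: (exp_monotone_reach hX cX p_ge1 B_admissible hl t_gt0).
split; first by split; [exact: exact_approx|split; [exact: approx_mono|exact: mono_reach]].
move=> Tpos.
have mono_all l tau : (omega0 S < l%:E)%E -> 0 < tau -> exp_dominates Xp Up S l tau ->
    forall t', exp_monotone Xp Up S l t'.
  move=> wl tau0 dom t'; apply: exp_dominates_monotone => //.
  exact: exp_dominates_all dom.
tfae.
- exact: exact_approx.
- exact: approx_mono.
- move=> /mono_reach /(reach_mono w hw) /(exp_monotone_dominates hX) dom.
  by apply: (exp_monotone_exact_reach hX cX p_ge1 B_admissible rw); exact: mono_all dom.
- move=> ha; apply: closure_sub_cone => // x [t' t'0].
  by apply: closure_sub_cone x => // x xt; apply: ha; exists t'.
- move=> ha; exists w, t; split=> //.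
  apply: (exp_monotone_dominates hX); apply: reach_mono => // x hx; apply: ha.
  by apply: subset_closure; exists t; [exact: ltW|exact: subset_closure].
- move=> [l [tau [wl tau0 dom]]]; exists l; split=> // m lm.
  exact: (exp_dominates_B_pos hX cX Tpos wl tau0 lm dom).
- move=> [l [wl pos]]; apply: mono_reach; exists l; split; first exact: rho_growth_bound.
  by apply: exp_dominates_monotone => //; exact: B_pos_dominates.
Qed.
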